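(* Let $\alpha>-\frac12$, $\lambda\in\mathbb{C}$ and $x,y\in\mathbb{R}\setminus\{0\}$. The product formula $$E_\alpha(i\lambda,x)\,E_\alpha(i\lambda,y)=\int_{\mathbb{R}}E_\alpha(i\lambda,z)\,k_\alpha(x,y,z)\,|z|^{2\alpha+1}\,dz$$ is the limit, as $\varepsilon\to0^+$, of the product formula $$G_{\lambda/\varepsilon}^{(\alpha,\alpha)}(\varepsilon x)\,G_{\lambda/\varepsilon}^{(\alpha,\alpha)}(\varepsilon y)=\int_{\mathbb{R}}G_{\lambda/\varepsilon}^{(\alpha,\alpha)}(z)\,\mathcal{K}_{\alpha,\alpha}(\varepsilon x,\varepsilon y,z)\,A_{\alpha,\alpha}(|z|)\,dz ;$$ that is, as $\varepsilon\to0^+$ the left-hand side of the second formula tends to $E_\alpha(i\lambda,x)E_\alpha(i\lambda,y)$ and its right-hand side tends to $\int_{\mathbb{R}}E_\alpha(i\lambda,z)\,k_\alpha(x,y,z)\,|z|^{2\alpha+1}\,dz$, so that the first formula holds.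
   Context: For parameters $a\ge b>-\frac12$ and $\lambda\in\mathbb{C}$, $x\in\mathbb{R}$, $\varphi_\lambda^{(a,b)}(x)={}_2F_1\bigl(\frac{a+b+1+i\lambda}2,\frac{a+b+1-i\lambda}2;a+1;-\sinh^2x\bigr)$ (Gauss hypergeometric function, analytically continued to $(-\infty,0]$), and $$G_\lambda^{(\alpha,\alpha)}(x)=\varphi_\lambda^{(\alpha,\alpha)}(x)+\frac{2\alpha+1+i\lambda}{4(\alpha+1)}\sinh(2x)\,\varphi_\lambda^{(\alpha+1,\alpha+1)}(x).$$ $A_{\alpha,\alpha}(z)=(\sinh z\cosh z)^{2\alpha+1}$ for $z\ge0$; $M_{\alpha,\alpha}=\dfrac{\Gamma(\alpha+1)}{\sqrt\pi\,\Gamma(\alpha+\frac12)}$. For $x,y,z\in\mathbb{R}\setminus\{0\}$ with $\bigl||x|-|y|\bigr|<|z|<|x|+|y|$, $$\mathcal{K}_{\alpha,\alpha}(x,y,z)=2^{4\alpha+2}M_{\alpha,\alpha}\,e^{x+y-z}\,\frac{\bigl[\sinh(x+y+z)\sinh(-x+y+z)\sinh(x-y+z)\sinh(x+y-z)\bigr]^{\alpha-\frac12}}{|\sinh2x\,\sinh2y\,\sinh2z|^{2\alpha}}\cdot\frac{\sinh(x+y+z)\sinh(-x+y+z)\sinh(x-y+z)}{\sinh2x\,\sinh2y\,\sinh2z},$$ $$k_\alpha(x,y,z)=2^{-2\alpha-1}M_{\alpha,\alpha}\,\frac{\bigl[(x+y+z)(-x+y+z)(x-y+z)(x+y-z)\bigr]^{\alpha-\frac12}}{|xyz|^{2\alpha}}\cdot\frac{(x+y+z)(-x+y+z)(x-y+z)}{xyz},$$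 and both kernels vanish for all other $(x,y,z)$. The one-dimensional Dunkl kernel is $E_\alpha(i\lambda,x)=j_\alpha(\lambda x)+\frac{i\lambda x}{2(\alpha+1)}\,j_{\alpha+1}(\lambda x)$, where $j_\alpha(t)=\Gamma(\alpha+1)\sum_{m=0}^{\infty}\frac{(-1)^m}{m!\,\Gamma(\alpha+1+m)}\bigl(\frac t2\bigr)^{2m}$. *)

(* Defs.v *)
From HB Require Import structures.
From mathcomp Require Import all_boot all_order all_algebra.
From mathcomp Require Import all_classical all_reals all_analysis.
From mathcomp Require Export complex.
Import Order.TTheory GRing.Theory Num.Theory numFieldNormedType.Exports.

Set Implicit Arguments.
Unset Strict Implicit.
Unset Printing Implicit Defensive.

Local Open Scope classical_set_scope.
Local Open Scope ring_scope.
Local Open Scope complex_scope.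

(* [R[i]] carries its topology and normed-module structure only through the
   alias [R[i]^o]; the latter is used wherever limits or complex derivatives
   are taken. *)

Section definitions.
Variable R : realType.
Local Notation C := R[i].
Local Notation mu := (@lebesgue_measure R).
Implicit Types (a b alpha x y z s : R) (lambda t : C).

Definition sinh x : R := (expR x - expR (- x)) / 2.
Definition cosh x : R := (expR x + expR (- x)) / 2.

(* Euler's integral; only used for s > 0, where it converges. *)
Definition Gamma s : R := \int[mu]_(t in `]0, +oo[) (t `^ (s - 1) * expR (- t)).

Definition cintegrable (f : R -> C) : Prop :=
  mu.-integrable setT (EFin \o (fun z => complex.Re (f z))) /\
  mu.-integrable setT (EFin \o (fun z => complex.Im (f z))).

Definition cintegral (f : R -> C) : C :=
  (\int[mu]_z complex.Re (f z)) +i* (\int[mu]_z complex.Im (f z)).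

Definition csum (u : nat -> C) : C := limn (series (u : nat -> C^o)).

Definition pochhammer (p : C) (n : nat) : C := \prod_(k < n) (p + k%:R).

Definition gauss_series (p q r z : C) : C :=
  csum (fun n => pochhammer p n * pochhammer q n
                 / (pochhammer r n * n`!%:R) * z ^+ n).

Definition slit_plane : set C :=
  [set w | ~ (complex.Im w = 0 /\ 1 <= complex.Re w)].

Definition holomorphic_on (U : set C) (F : C -> C) : Prop :=
  forall w : C, U w -> derivable (F : C^o -> C^o) w 1.

(* By the identity theorem at most one function on the slit plane satisfies
   this predicate; values on the cut [1, +oo[ are irrelevant. *)
Definition is_gauss_continuation (p q r : C) (F : C -> C) : Prop :=
  holomorphic_on slit_plane F /\
  forall z : C, `|z| < 1 -> F z = gauss_series p q r z.

Definition gauss_continuation (p q r : C) : C -> C :=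
  xget (fun=> 0) [set F | is_gauss_continuation p q r F].

Definition hyp2F1 (p q r z : C) : C :=
  if `|z| < 1 then gauss_series p q r z else gauss_continuation p q r z.

Definition jacobi_phi a b lambda x : C :=
  hyp2F1 (((a + b + 1)%:C + 'i * lambda) / 2)
         (((a + b + 1)%:C - 'i * lambda) / 2)
         (a + 1)%:C
         (- sinh x ^+ 2)%:C.

(* G_lambda^{(alpha,alpha)} *)
Definition opdam_G alpha lambda x : C :=
  jacobi_phi alpha alpha lambda x
  + ((2 * alpha + 1)%:C + 'i * lambda) / (4 * (alpha + 1))%:C
    * (sinh (2 * x))%:C * jacobi_phi (alpha + 1) (alpha + 1) lambda x.

(* A_{alpha,alpha}, meant for z >= 0 *)
Definition jacobi_weight alpha z : R :=
  (sinh z * cosh z) `^ (2 * alpha + 1).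

Definition M_const alpha : R :=
  Gamma (alpha + 1) / (Num.sqrt pi * Gamma (alpha + 2^-1)).

Definition kernel_support x y z : bool :=
  [&& x != 0, y != 0, z != 0, `| `|x| - `|y| | < `|z| & `|z| < `|x| + `|y| ].

(* Inside the support, each of the products in square brackets below is
   positive, so that the real powers are taken of positive numbers. *)
Definition opdam_kernel alpha x y z : R :=
  if kernel_support x y z then
    2 `^ (4 * alpha + 2) * M_const alpha * expR (x + y - z)
    * ((sinh (x + y + z) * sinh (- x + y + z)
        * sinh (x - y + z) * sinh (x + y - z)) `^ (alpha - 2^-1)
       / `|sinh (2 * x) * sinh (2 * y) * sinh (2 * z)| `^ (2 * alpha))
    * (sinh (x + y + z) * sinh (- x + y + z) * sinh (x - y + z)
       / (sinh (2 * x) * sinh (2 * y) * sinh (2 * z)))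
  else 0.

Definition dunkl_kernel alpha x y z : R :=
  if kernel_support x y z then
    2 `^ (- 2 * alpha - 1) * M_const alpha
    * (((x + y + z) * (- x + y + z) * (x - y + z) * (x + y - z))
         `^ (alpha - 2^-1)
       / `|x * y * z| `^ (2 * alpha))
    * ((x + y + z) * (- x + y + z) * (x - y + z) / (x * y * z))
  else 0.

(* The normalized Bessel function j_alpha *)
Definition bessel_j alpha t : C :=
  (Gamma (alpha + 1))%:C
  * csum (fun m => (-1) ^+ m / (m`!%:R * (Gamma (alpha + 1 + m%:R))%:C)
                   * (t / 2) ^+ (2 * m)).

(* [dunkl_E alpha lambda x] is E_alpha(i lambda, x). *)
Definition dunkl_E alpha lambda x : C :=
  bessel_j alpha (lambda * x%:C)
  + 'i * lambda * x%:C / (2 * (alpha + 1))%:C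
    * bessel_j (alpha + 1) (lambda * x%:C).

Definition dunkl_integrand alpha lambda x y z : C :=
  dunkl_E alpha lambda z
  * (dunkl_kernel alpha x y z * `|z| `^ (2 * alpha + 1))%:C.

Definition opdam_integrand alpha lambda x y z : C :=
  opdam_G alpha lambda z
  * (opdam_kernel alpha x y z * jacobi_weight alpha `|z|)%:C.

End definitions.

(* Main.v *)
(* The Dunkl product formula is proved directly.  After the substitution
   [z ^+ 2 = x ^+ 2 + y ^+ 2 + 2 * x * y * t], the even and odd moments in z of
   [dunkl_kernel a x y z * `|z| `^ (2 * a + 1)] are moments of the ultraspherical
   weight [(1 - t ^+ 2) `^ (a - 2^-1)].  These moments and the coefficients of the
   Cauchy products of two 0F1 series satisfy the same recursion, which relates
   the parameters a and a + 1, so that the product of the power series of the two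
   Dunkl kernels is obtained by integrating the series of the third one termwise.

   For the limit, [phi_(lam / eps) (eps * x)] is, for small [eps], a power series
   in [(sinh (eps * x) / eps) ^+ 2] whose coefficients have a summable majorant
   independent of [eps] and tend to those of the Bessel function: no analytic
   continuation of 2F1 enters, since [`|sinh (eps * z)| < 1] on the support of
   the kernel.  Rescaling [z] by [eps] turns the Opdam kernel and weight into the
   Dunkl ones times a factor which is bounded and tends to 1, and dominated
   convergence applies. *)

Require Import Defs.
From mathcomp Require Import all_boot all_order all_algebra.
From mathcomp Require Import all_classical all_reals all_analysis.
From mathcomp Require Import measurable_realfun ring lra.
Import Order.TTheory GRing.Theory Num.Theory numFieldNormedType.Exports.
Local Open Scope classical_set_scope.
Local Open Scope ring_scope.
Local Open Scope complex_scope.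

Set Implicit Arguments.
Unset Strict Implicit.
Unset Printing Implicit Defensive.

(** The formula for [eps > 0] is not a hypothesis, so the limiting formula cannot be read off from
    two equal limits; hence the independent proof by moments. Both halves rest on the same
    coefficients and the same integrable envelope. With sinhc u = sinh u / u, the rescaled Opdam
    function and weight make sense at [eps = 0] too and are the Dunkl ones there, so that the limit
    becomes a matter of continuity at 0. One threshold serves every estimate: eps * Z <= 1/4, where
    Z bounds |z| (on the support, Z = |x| + |y|). Under it all arguments of sinhc are at most 1/2 in
    modulus, so sinhc lies between 1/2 and 2, |sinh (eps z)| < 1, and the majorant series has ratio
    tending to 1/4. Two singularities shape the integration. For a < 1/2 the weight (1 - t^2)^(a -
    1/2) is unbounded at both ends, so substitution is proved on open intervals for nonnegative
    functions. And the part of the kernel that changes sign with z lacks the factor |z| that turns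
    dz into dt; it is recovered by an estimate near z = 0, which matters when |x| = |y|. *)

Local Notation Re := complex.Re.
Local Notation Im := complex.Im.
Local Notation normc := ComplexField.Normc.normc.

(** * Limits and absolutely convergent series of complex numbers *)

Section complex_limits.
Context {R : realType}.
Implicit Types (z w : R[i]).

Lemma ReD z w : Re (z + w) = Re z + Re w. Proof. by case: z w => [a b] []. Qed.
Lemma ImD z w : Im (z + w) = Im z + Im w. Proof. by case: z w => [a b] []. Qed.
Lemma ReM z w : Re (z * w) = Re z * Re w - Im z * Im w.
Proof. by case: z w => [a b] []. Qed.
Lemma ImM z w : Im (z * w) = Re z * Im w + Im z * Re w.
Proof. by case: z w => [a b] []. Qed.
Lemma ReMr z (r : R) : Re (z * r%:C) = Re z * r.
Proof. by rewrite ReM /= mulr0 subr0. Qed.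
Lemma ImMr z (r : R) : Im (z * r%:C) = Im z * r.
Proof. by rewrite ImM /= mulr0 add0r. Qed.

Lemma Re_sum n (u : nat -> R[i]) : Re (\sum_(0 <= k < n) u k) = \sum_(0 <= k < n) Re (u k).
Proof. by elim: n => [|n IH]; rewrite ?big_nil// !big_nat_recr//= ReD IH. Qed.
Lemma Im_sum n (u : nat -> R[i]) : Im (\sum_(0 <= k < n) u k) = \sum_(0 <= k < n) Im (u k).
Proof. by elim: n => [|n IH]; rewrite ?big_nil// !big_nat_recr//= ImD IH. Qed.

Lemma normc_ge0 z : 0 <= normc z.
Proof. by case: z => a b; exact: sqrtr_ge0. Qed.

Lemma normcE z : `|z| = (normc z)%:C. Proof. by case: z. Qed.

Lemma normc_Re z : `|Re z| <= normc z.
Proof. by rewrite -lecR -normcE; exact: normc_ge_Re. Qed.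

Lemma normc_Im z : `|Im z| <= normc z.
Proof.
have := normc_Re (z * - 'i); rewrite ReM /= oppr0 mulr0 sub0r mulrN mulr1 opprK.
by rewrite ComplexField.Normc.normcM/= oppr0 expr0n/= add0r sqrrN expr1n sqrtr1 mulr1.
Qed.

Lemma normc_real (r : R) : normc r%:C = `|r|.
Proof. by rewrite /= expr0n/= addr0 sqrtr_sqr. Qed.

Lemma normcX z n : normc (z ^+ n) = normc z ^+ n.
Proof.
elim: n => [|n IH]; first by rewrite !expr0 ComplexField.Normc.normc1.
by rewrite !exprS ComplexField.Normc.normcM IH.
Qed.

Lemma normc_le_ReIm z : normc z <= `|Re z| + `|Im z|.
Proof.
case: z => a b /=; rewrite -(@ler_pXn2r _ 2)// ?nnegrE ?sqrtr_ge0 ?addr_ge0//.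
rewrite sqr_sqrtr ?addr_ge0 ?sqr_ge0// sqrrD !real_normK ?num_real//.
by rewrite lerD2r lerDl mulrn_wge0// mulr_ge0.
Qed.

Lemma normc_triangle z w : normc (z + w) <= normc z + normc w.
Proof. exact: le_normcD. Qed.

(** The modulus is at most |Re| + |Im|; with [cvg_ReIm] this reduces every complex limit below to
    two real ones. *)
Lemma cvg_complex (T : Type) (F : set_system T) {FF : Filter F} (f : T -> R[i]) (l : R[i]) :
  Re (f t) @[t --> F] --> Re l -> Im (f t) @[t --> F] --> Im l ->
  f @ F --> (l : R[i]^o).
Proof.
move=> fR fI; apply/(@cvgrPdist_lt R[i] R[i]^o) => -[e e'] e0.
(* A positive complex number is real, since the order compares only numbers with equal imaginary
   parts. *)
have -> : e' = 0 by move: e0; rewrite ltcE /= => /andP[/eqP].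
have {}e0 : 0 < e by move: e0; rewrite ltcE /= => /andP[].
have e20 : 0 < e / 2 by rewrite divr_gt0.
move/cvgrPdist_lt/(_ _ e20): fR => fR; move/cvgrPdist_lt/(_ _ e20): fI => fI.
near=> t.
rewrite normcE ltcR (le_lt_trans (normc_le_ReIm _))// [e]splitr ltrD//.
  have -> : Re (l - f t) = Re l - Re (f t) by case: (l) (f t) => ? ? [].
  by near: t.
have -> : Im (l - f t) = Im l - Im (f t) by case: (l) (f t) => ? ? [].
by near: t.
Unshelve. all: by end_near. Qed.

Lemma cvg_ReIm (T : Type) (F : set_system T) {FF : Filter F} (f : T -> R[i]) (l : R[i]) :
  f @ F --> (l : R[i]^o) ->
  Re (f t) @[t --> F] --> Re l /\ Im (f t) @[t --> F] --> Im l.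
Proof.
move=> /(@cvgrPdist_lt R[i] R[i]^o) fl; split; apply/cvgrPdist_lt => e e0.
  have e0' : 0 < e%:C by rewrite ltcR.
  near=> t; have : `|l - f t| < e%:C by near: t; exact: fl.
  rewrite normcE ltcR; apply: le_lt_trans.
  have -> : Re l - Re (f t) = Re (l - f t) by case: (l) (f t) => ? ? [].
  exact: normc_Re.
have e0' : 0 < e%:C by rewrite ltcR.
near=> t; have : `|l - f t| < e%:C by near: t; exact: fl.
rewrite normcE ltcR; apply: le_lt_trans.
have -> : Im l - Im (f t) = Im (l - f t) by case: (l) (f t) => ? ? [].
exact: normc_Im.
Unshelve. all: by end_near. Qed.

Lemma cvg_real_complex (T : Type) (F : set_system T) {FF : Filter F} (f : T -> R) (l : R) :
  f @ F --> l -> (f t)%:C @[t --> F] --> (l%:C : R[i]^o).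
Proof. by move=> fl; apply: cvg_complex => //=; exact: cvg_cst. Qed.

Lemma ccvg_cst (T : Type) (F : set_system T) {FF : Filter F} (l : R[i]) :
  l @[_ --> F] --> (l : R[i]^o).
Proof. by apply: cvg_complex; exact: cvg_cst. Qed.

Lemma ccvgD (T : Type) (F : set_system T) {FF : Filter F} (f g : T -> R[i]) (l m : R[i]) :
  f @ F --> (l : R[i]^o) -> g @ F --> (m : R[i]^o) ->
  f t + g t @[t --> F] --> (l + m : R[i]^o).
Proof.
move=> /cvg_ReIm[fR fI] /cvg_ReIm[gR gI]; apply: cvg_complex.
  by rewrite ReD; under eq_fun do rewrite ReD; apply: cvgD.
by rewrite ImD; under eq_fun do rewrite ImD; apply: cvgD.
Qed.

Lemma ccvgM (T : Type) (F : set_system T) {FF : Filter F} (f g : T -> R[i]) (l m : R[i]) :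
  f @ F --> (l : R[i]^o) -> g @ F --> (m : R[i]^o) ->
  f t * g t @[t --> F] --> (l * m : R[i]^o).
Proof.
move=> /cvg_ReIm[fR fI] /cvg_ReIm[gR gI]; apply: cvg_complex.
  by rewrite ReM; under eq_fun do rewrite ReM; apply: cvgB; apply: cvgM.
by rewrite ImM; under eq_fun do rewrite ImM; apply: cvgD; apply: cvgM.
Qed.

(** Absolute convergence, phrased in [R]. Under it [csum], a bare limit, splits into the sums of
    real and imaginary parts. *)
Definition csummable (u : nat -> R[i]) := cvgn (series (fun n => normc (u n))).

Lemma csummable_Re u : csummable u -> cvgn (series (fun n => Re (u n))).
Proof.
move=> su; apply: normed_cvg.
apply: (@series_le_cvg _ _ (fun n => normc (u n))) => // n; rewrite /= ?normr_ge0 ?normc_ge0//.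
exact: normc_Re.
Qed.

Lemma csummable_Im u : csummable u -> cvgn (series (fun n => Im (u n))).
Proof.
move=> su; apply: normed_cvg.
apply: (@series_le_cvg _ _ (fun n => normc (u n))) => // n; rewrite /= ?normr_ge0 ?normc_ge0//.
exact: normc_Im.
Qed.

Lemma csummable_le (u : nat -> R[i]) (M : nat -> R) :
  (forall n, normc (u n) <= M n) -> cvgn (series M) -> csummable u.
Proof.
move=> uM; apply: series_le_cvg => // n; first exact: normc_ge0.
by apply: le_trans (uM n); exact: normc_ge0.
Qed.

Lemma csummable_cvg u : csummable u -> series (u : nat -> R[i]^o) @ \oo -->
  (limn (series (fun n => Re (u n))) +i* limn (series (fun n => Im (u n))) : R[i]^o).
Proof.
move=> su; apply: cvg_complex => /=.
  have -> : (fun t => Re (series (u : nat -> R[i]^o) t)) = series (fun n => Re (u n)).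
    by apply/funext => n; rewrite /series /= -Re_sum.
  exact: csummable_Re.
have -> : (fun t => Im (series (u : nat -> R[i]^o) t)) = series (fun n => Im (u n)).
  by apply/funext => n; rewrite /series /= -Im_sum.
exact: csummable_Im.
Qed.

Lemma csumE u : csummable u ->
  csum u = limn (series (fun n => Re (u n))) +i* limn (series (fun n => Im (u n))).
Proof. by move=> /csummable_cvg su; apply: (@cvg_lim R[i]^o) => //; exact: norm_hausdorff. Qed.

Lemma csum_cvg u : csummable u -> series (u : nat -> R[i]^o) @ \oo --> (csum u : R[i]^o).
Proof. by move=> su; rewrite csumE//; exact: csummable_cvg. Qed.

Lemma lim_series_norm_le (u M : nat -> R) : (forall n, `|u n| <= M n) -> cvgn (series M) ->
  cvgn (series u) /\ `|limn (series u)| <= limn (series M).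
Proof.
move=> uM cM.
have cu : cvgn [normed series u].
  apply: (@series_le_cvg _ _ M) => // n; rewrite /= ?normr_ge0//.
  exact: le_trans (normr_ge0 _) (uM n).
split; first exact: normed_cvg.
apply: le_trans (lim_series_norm cu) _; apply: lim_series_le => //.
Qed.

(** Dominated convergence for series: beyond a suitable [N] both tails are below e / 3 uniformly in
    [t], because the tail of [M] is, and the first [N] terms form a finite sum. *)
Lemma tannery (T : Type) (F : set_system T) {FF : ProperFilter F}
    (a : T -> nat -> R) (b M : nat -> R) :
  (forall n, a t n @[t --> F] --> b n) ->
  (\forall t \near F, forall n, `|a t n| <= M n) -> cvgn (series M) ->
  limn (series (a t)) @[t --> F] --> limn (series b).
Proof.
move=> ab aM cM.
have bM n : `|b n| <= M n.
  have h : `|a t n| @[t --> F] --> `|b n| by apply: cvg_norm; exact: ab.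
  apply: (cvgr_to_le h).
  by near=> t; near: t; apply: filterS aM => t; exact.
have [cb _] := lim_series_norm_le bM cM.
apply/cvgrPdist_le => e e0.
have e3 : 0 < e / 3 by rewrite divr_gt0.
have /cvgrPdist_le/(_ _ e3)[N _ HN] := cM.
have tail (u : nat -> R) : (forall n, `|u n| <= M n) ->
    `|limn (series u) - series u N| <= e / 3.
  move=> uM; have [cu _] := lim_series_norm_le uM cM.
  have c1 : `|series u n - series u N| @[n --> \oo] --> `|limn (series u) - series u N|.
    by apply: cvg_norm; apply: cvgB => //; exact: cvg_cst.
  apply: (cvgr_to_le c1); near=> n.
  have Nn : (N <= n)%N by near: n; exact: nbhs_infty_ge.
  rewrite sub_series_geq// (le_trans (ler_norm_sum _ _ _))//.
  apply: (@le_trans _ _ (\sum_(N <= k < n) M k)); first exact: ler_sum.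
  rewrite -sub_series_geq//.
  have sM m : (N <= m)%N -> series M m <= limn (series M).
    move=> _; apply: nondecreasing_cvgn_le => //; apply: nondecreasing_series => k _ _.
    exact: le_trans (uM k).
  have := HN N (leqnn _); rewrite ger0_norm ?subr_ge0 ?sM//.
  by apply: le_trans; rewrite lerB ?sM.
have fin : series (a t) N @[t --> F] --> series b N.
  rewrite /series /=; elim: (N) => [|k IH].
    by under eq_fun do rewrite big_nil; rewrite big_nil; exact: cvg_cst.
  under eq_fun do rewrite big_nat_recr//=; rewrite big_nat_recr//=.
  by apply: cvgD.
move/cvgrPdist_le/(_ _ e3): fin => fin.
near=> t.
have aMt : forall n, `|a t n| <= M n by near: t.
have H1 := tail _ aMt; have H2 := tail _ bM.
have H3 : `|series b N - series (a t) N| <= e / 3 by near: t.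
have -> : limn (series b) - limn (series (a t)) =
  (limn (series b) - series b N) + (series b N - series (a t) N)
   - (limn (series (a t)) - series (a t) N) by ring.
have -> : e = e / 3 + e / 3 + e / 3 by field.
by rewrite (le_trans (ler_normB _ _))// lerD// (le_trans (ler_normD _ _))// lerD.
Unshelve. all: by end_near. Qed.

Lemma ctannery (T : Type) (F : set_system T) {FF : ProperFilter F}
    (a : T -> nat -> R[i]) (b : nat -> R[i]) (M : nat -> R) :
  (forall n, a t n @[t --> F] --> (b n : R[i]^o)) ->
  (\forall t \near F, forall n, normc (a t n) <= M n) -> cvgn (series M) ->
  csummable b ->
  csum (a t) @[t --> F] --> (csum b : R[i]^o).
Proof.
move=> ab aM cM sb.
have E : \forall t \near F, csum (a t) =
    limn (series (fun n => Re (a t n))) +i* limn (series (fun n => Im (a t n))).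
  by apply: filterS aM => t /csummable_le/(_ cM)/csumE.
apply: (cvg_trans (near_eq_cvg _)); first by apply: filterS E => t ->; reflexivity.
rewrite (csumE sb); apply: cvg_complex => /=.
  apply: (tannery (M := M)) => //; first by move=> n; have [] := cvg_ReIm (ab n).
  by apply: filterS aM => t h n; apply: le_trans (h n); exact: normc_Re.
apply: (tannery (M := M)) => //; first by move=> n; have [] := cvg_ReIm (ab n).
by apply: filterS aM => t h n; apply: le_trans (h n); exact: normc_Im.
Qed.

(** The factor 2 comes from bounding real and imaginary parts separately; later uses need only some
    bound independent of the parameters. *)
Lemma normc_csum_le (u : nat -> R[i]) (M : nat -> R) :
  (forall n, normc (u n) <= M n) -> cvgn (series M) ->
  normc (csum u) <= 2 * limn (series M).
Proof.
move=> uM cM; rewrite csumE; last exact: csummable_le cM.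
apply: le_trans (normc_le_ReIm _) _; rewrite /= mulr2n mulrDl !mul1r lerD//.
  apply: (lim_series_norm_le _ cM).2 => n; apply: le_trans (uM n); exact: normc_Re.
apply: (lim_series_norm_le _ cM).2 => n; apply: le_trans (uM n); exact: normc_Im.
Qed.

(** From index [N] on, the terms lie below a geometric sequence of ratio 1/2. *)
Lemma ratio_test_half (u : nat -> R) N : (forall n, 0 <= u n) ->
  (forall n, (N <= n)%N -> u n.+1 <= u n / 2) -> cvgn (series u).
Proof.
move=> u0 uN.
have H n : u (n + N)%N <= geometric (u N) 2^-1 n.
  elim: n => [|n IH]; first by rewrite /= expr0 mulr1 add0n.
  rewrite addSn (le_trans (uN _ (leq_addl _ _)))// /= exprSr mulrA ler_pM2r ?invr_gt0//.
have c : cvgn (series (fun n => u (n + N)%N)).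
  apply: series_le_cvg H _ => // [n|]; first by rewrite /= mulr_ge0// exprn_ge0// invr_ge0.
  by apply: is_cvg_geometric_series; rewrite ger0_norm ?invf_lt1 ?invr_ge0// ltr1n.
apply: nondecreasing_is_cvgn; first by apply: nondecreasing_series => k _ _.
have /cvg_seq_bounded/bounded_fun_has_ubound[B HB] := c.
exists (B + series u N) => _ [n _ <-].
apply: (@le_trans _ _ (series u (n + N)%N)).
  by apply: nondecreasing_series (leq_addr _ _) => k _ _.
rewrite series_addn addrC lerD2r.
apply: le_trans (HB (series (fun n => u (n + N)%N) n) _); last by exists n.
by rewrite -{1}[N]add0n big_addn addnK /series /=.
Qed.

End complex_limits.

Arguments real_complex_def : simpl never.

(** * Power series of the rescaled Jacobi functions and their majorant *)

Section jacobi_power_series.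
Context {R : realType}.
Implicit Types (a eps s x r : R) (lam : R[i]).

Definition cpseries (c : nat -> R[i]) s : R[i] := csum (fun n => c n * (s ^+ n)%:C).

Definition poch a n : R := \prod_(k < n) (a + k%:R).

Lemma poch0 a : poch a 0 = 1. Proof. by rewrite /poch big_ord0. Qed.
Lemma pochS a n : poch a n.+1 = poch a n * (a + n%:R).
Proof. by rewrite /poch big_ord_recr. Qed.
Lemma pochSl a n : poch a n.+1 = a * poch (a + 1) n.
Proof.
rewrite /poch big_ord_recl addr0; congr (_ * _); apply: eq_bigr => k _.
by rewrite /= /bump /= add1n -addrA; congr (_ + _); rewrite -natr1 addrC.
Qed.
Lemma poch_gt0 a n : 0 < a -> 0 < poch a n.
Proof. by move=> a0; apply: prodr_gt0 => k _; rewrite ltr_wpDr. Qed.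

(* Coefficients, in powers of [(sinh (eps * x) / eps) ^+ 2], of
   phi_(lam/eps)^(a,a) (eps * x); for [eps = 0] they are the coefficients of
   j_a (lam * x) in powers of [x ^+ 2]. *)
Definition jacobi_coef a lam eps n : R[i] :=
  (-1) ^+ n * (\prod_(k < n) (((eps * (a + 2^-1 + k%:R)) ^+ 2)%:C + lam ^+ 2 / 4))
  / (poch (a + 1) n * n`!%:R)%:C.

(** Majorant of the modulus of [jacobi_coef]: [l] stands for the modulus of lam^2 / 4 and [e] for an
    upper bound of [eps]. *)
Definition jacobi_coef_bound a (l e : R) n : R :=
  (\prod_(k < n) ((e * (a + 2^-1 + k%:R)) ^+ 2 + l)) / (poch (a + 1) n * n`!%:R).

Lemma normc_prod n (f : 'I_n -> R[i]) : normc (\prod_k f k) = \prod_k normc (f k).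
Proof.
elim: n f => [|n IH] f; first by rewrite !big_ord0 ComplexField.Normc.normc1.
by rewrite !big_ord_recr /= ComplexField.Normc.normcM IH.
Qed.

Lemma normc_jacobi_coef_le a lam eps e n : - 2^-1 < a -> 0 <= eps -> eps <= e ->
  normc (jacobi_coef a lam eps n) <= jacobi_coef_bound a (normc (lam ^+ 2 / 4)) e n.
Proof.
move=> ha e0 ee; rewrite /jacobi_coef /jacobi_coef_bound; move: (lam ^+ 2 / 4) => L.
have a1 : 0 < a + 1 by lra.
have h0 : 0 < poch (a + 1) n * n`!%:R by rewrite mulr_gt0 ?poch_gt0// ltr0n fact_gt0.
rewrite !ComplexField.Normc.normcM ComplexField.Normc.normcV normc_real (gtr0_norm h0).
rewrite normcX normcN ComplexField.Normc.normc1 expr1n mul1r ler_pM2r ?invr_gt0//.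
rewrite normc_prod; apply: ler_prod => k _; rewrite normc_ge0 andTb.
apply: le_trans (normc_triangle _ _) _; apply: lerD => //; rewrite normc_real ger0_norm ?sqr_ge0//.
have ak : 0 <= a + 2^-1 + k%:R by rewrite addr_ge0//; lra.
by rewrite ler_pXn2r ?nnegrE ?mulr_ge0// ?ler_wpM2r// (le_trans e0).
Qed.

Lemma jacobi_coef_bound_ge0 a l e n : - 2^-1 < a -> 0 <= l -> 0 <= jacobi_coef_bound a l e n.
Proof.
move=> ha l0; rewrite /jacobi_coef_bound divr_ge0//.
  by apply: prodr_ge0 => k _; rewrite addr_ge0 ?sqr_ge0.
by rewrite mulr_ge0// ltW// poch_gt0//; lra.
Qed.

(** The ratio of consecutive terms tends to e^2 * r <= 1/4; the room between 1/4 and 1/2 absorbs [l]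
    and the shifts by [a]. *)
Lemma jacobi_coef_bound_summable a l e r : - 2^-1 < a -> 0 <= l -> 0 <= r -> e ^+ 2 * r <= 4^-1 ->
  cvgn (series (fun n => jacobi_coef_bound a l e n * r ^+ n)).
Proof.
move=> ha l0 r0 er.
(* For n >= 2 a + 16 r l, the summand with [e] contributes at most 3/8 to the ratio and the summand
   with [l] at most 1/8. *)
pose N := (Num.truncn (2 * a + 16 * r * l)).+1.
apply: (@ratio_test_half _ _ N).
  by move=> n; rewrite mulr_ge0 ?exprn_ge0 ?jacobi_coef_bound_ge0.
move=> n Nn.
have nN : 2 * a + 16 * r * l <= n%:R.
  apply: le_trans (ltW (truncnS_gt _)) _; by rewrite ler_nat.
have -> : jacobi_coef_bound a l e n.+1 * r ^+ n.+1 = jacobi_coef_bound a l e n * r ^+ n *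
   (((e * (a + 2^-1 + n%:R)) ^+ 2 + l) * r / ((a + 1 + n%:R) * n.+1%:R)).
  rewrite /jacobi_coef_bound big_ord_recr /= pochS factS natrM [r ^+ n.+1]exprSr.
  have h1 : poch (a + 1) n != 0 by rewrite gt_eqF// poch_gt0//; lra.
  have h2 : (n`!%:R : R) != 0 by rewrite pnatr_eq0 -lt0n fact_gt0.
  have h3 : a + 1 + n%:R != 0 by have := ler0n R n; lra.
  have h4 : n%:R + 1 != 0 :> R by rewrite natr1 pnatr_eq0.
  by field; rewrite h1 h2 [1 + n%:R]addrC h4 h3.
apply: ler_wpM2l; first by rewrite mulr_ge0 ?exprn_ge0 ?jacobi_coef_bound_ge0.
have n0 := ler0n R n.
rewrite ler_pdivrMr -?[n.+1%:R]natr1; last by rewrite mulr_gt0//; lra.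
set m := n%:R in n0 nN *.
have rl : 0 <= r * l by rewrite mulr_ge0.
have q1 : e ^+ 2 * r * (a + 2^-1 + m) ^+ 2 <= 4^-1 * (a + 2^-1 + m) ^+ 2.
  by rewrite ler_wpM2r// sqr_ge0.
have q2 : (a + 2^-1 + m) ^+ 2 <= 3 / 2 * ((a + 1 + m) * (m + 1)).
  by rewrite mulrCA expr2 ler_pM//; lra.
have q3 : (a + 1 + m) * (m + 1) >= 8 * (r * l).
  have : 2^-1 * (16 * (r * l)) <= (a + 1 + m) * (m + 1) by rewrite ler_pM//; lra.
  by lra.
rewrite [X in X <= _](_ : _ = e ^+ 2 * r * (a + 2^-1 + m) ^+ 2 + r * l); last by ring.
move: q1 q2 q3; set A := (a + 2^-1 + m) ^+ 2; set P := (a + 1 + m) * (m + 1).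
by move=> q1 q2 q3; lra.
Qed.

Lemma normc_cpseries_term_le (c : nat -> R[i]) s (M : nat -> R) r n :
  normc (c n) <= M n -> `|s| <= r -> normc (c n * (s ^+ n)%:C) <= M n * r ^+ n.
Proof.
move=> cM sr; rewrite ComplexField.Normc.normcM normc_real normrX ler_pM ?normc_ge0 ?exprn_ge0//.
by rewrite lerXn2r ?nnegrE//; exact: le_trans sr.
Qed.

Lemma cpseries_cvg (T : Type) (F : set_system T) {FF : ProperFilter F}
   (ct : T -> nat -> R[i]) (c : nat -> R[i]) (st : T -> R) s (M : nat -> R) r :
  (forall n, ct t n @[t --> F] --> (c n : R[i]^o)) -> st @ F --> s ->
  (\forall t \near F, forall n, normc (ct t n) <= M n) ->
  (\forall t \near F, `|st t| <= r) ->
  (forall n, normc (c n) <= M n) -> `|s| <= r ->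
  cvgn (series (fun n => M n * r ^+ n)) ->
  cpseries (ct t) (st t) @[t --> F] --> (cpseries c s : R[i]^o).
Proof.
move=> cc ss cM sM lM lr sum.
rewrite /cpseries; apply: (@ctannery R T F FF (fun t n => ct t n * (st t ^+ n)%:C)
  (fun n => c n * (s ^+ n)%:C) (fun n => M n * r ^+ n)) => [n|||]; last 2 first.
- exact: sum.
- by apply: (csummable_le (M := fun n => M n * r ^+ n)) => // n; exact: normc_cpseries_term_le.
- apply: ccvgM; first exact: cc.
  apply: cvg_real_complex.
  elim: n => [|n IH]; first by under eq_fun do rewrite expr0; exact: cvg_cst.
  by under eq_fun do rewrite exprS; rewrite exprS; apply: cvgM.
- by apply: filterS2 cM sM => t h1 h2 n; exact: normc_cpseries_term_le.
Qed.

End jacobi_power_series.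

(** * The quotient sinh u / u and its elementary bounds *)

Section sinhc.
Context {R : realType}.
Implicit Types (u : R).

(** The factorization sinh (eps u) = eps * u * sinhc (eps u) exhibits the power of [eps] that
    rescaling has to cancel, and what remains is defined at [eps = 0]. *)
Definition sinhc u : R := if u == 0 then 1 else sinh u / u.

Lemma sinh0 : sinh 0 = 0 :> R. Proof. by rewrite /sinh oppr0 subrr mul0r. Qed.

Lemma sinhcE u : sinh u = u * sinhc u.
Proof.
rewrite /sinhc; case: eqVneq => [->|u0]; first by rewrite sinh0 mul0r.
by rewrite mulrC divfK.
Qed.

Lemma sinhcN u : sinhc (- u) = sinhc u.
Proof.
rewrite /sinhc oppr_eq0; case: eqP => // _; rewrite /sinh opprK.
by rewrite invrN mulrN -mulNr -mulNr opprB.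
Qed.

(** For u > 0 the bounds are e^(2u) >= 1 + 2u divided by e^u and e^(-2u) >= 1 - 2u multiplied by
    e^u; evenness gives the rest. They yield the positivity of [sinhc] as well as its limit 1 at
    0. *)
Lemma sinhc_bounds u : expR (- `|u|) <= sinhc u <= expR `|u|.
Proof.
wlog u0 : u / 0 <= u.
  move=> H; case: (leP 0 u) => [/H//|un].
  by have := H (- u); rewrite sinhcN normrN oppr_ge0 (ltW un); exact.
rewrite (ger0_norm u0) /sinhc; case: eqVneq => [->|un0].
  by rewrite oppr0 expR0 lexx.
have up : 0 < u by rewrite lt_neqAle eq_sym un0.
rewrite ler_pdivlMr// ler_pdivrMr// /sinh.
have E := expRxMexpNx_1 u.
have h1 := expR_ge1Dx (2 * u); have h2 := expR_ge1Dx (- (2 * u)).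
rewrite -mulrN in h2.
have s1 : expR (2 * u) = expR u * expR u by rewrite -expRD; congr expR; ring.
have s2 : expR (2 * - u) = expR (- u) * expR (- u) by rewrite -expRD; congr expR; ring.
rewrite s1 in h1; rewrite s2 in h2.
have p1 := expR_gt0 u; have p2 := expR_gt0 (- u).
by apply/andP; split; nra.
Qed.

Lemma sinhc_gt0 u : 0 < sinhc u.
Proof. by have /andP[h _] := sinhc_bounds u; apply: lt_le_trans h; exact: expR_gt0. Qed.

Lemma cvg_sinhc (T : Type) (F : set_system T) {FF : Filter F} (f : T -> R) :
  f @ F --> (0 : R) -> sinhc (f t) @[t --> F] --> (1 : R).
Proof.
move=> f0.
have fn : `|f t| @[t --> F] --> (0 : R) by rewrite -(@normr0 _ R); exact: cvg_norm.
apply: (@squeeze_cvgr _ _ _ _ (fun t => expR (- `|f t|)) (fun t => expR `|f t|)).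
- by near=> t; exact: sinhc_bounds.
- rewrite -expR0 -oppr0; apply: continuous_cvg; first exact: continuous_expR.
  exact: cvgN.
- by rewrite -expR0; apply: continuous_cvg; first exact: continuous_expR.
Unshelve. all: by end_near. Qed.

(** A consequence of e^(-1/2) >= 1 - 1/2. It is the source of the constant 2 for arguments of
    modulus at most 1/2. *)
Lemma expR_half : expR (2^-1 : R) <= 2.
Proof.
have h := expR_ge1Dx (- 2^-1 : R); have E := expRxMexpNx_1 (2^-1 : R).
have p := expR_gt0 (2^-1 : R); nra.
Qed.

Lemma sinhc_le2 u : `|u| <= 2^-1 -> sinhc u <= 2.
Proof.
move=> h; have /andP[_ H] := sinhc_bounds u; apply: le_trans H _.
by apply: le_trans expR_half; rewrite ler_expR.
Qed.

(** Here |sinh u| <= 2 |u| <= 1/2, which puts - sinh^2 u inside the unit disc, where [hyp2F1] is the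
    Gauss series itself. *)
Lemma sinh_lt1 u : `|u| <= 4^-1 -> `|sinh u| < 1.
Proof.
move=> h; rewrite sinhcE normrM (gtr0_norm (sinhc_gt0 u)).
have h2 : sinhc u <= 2 by apply: sinhc_le2; lra.
have := sinhc_gt0 u; have := normr_ge0 u; nra.
Qed.

End sinhc.

(** * The rescaled Opdam function: expansion, limit and uniform bound *)

Section rescaled_opdam.
Context {R : realType}.
Implicit Types (a eps x Z : R) (lam : R[i]).

Lemma pochhammer_real (r : R) n : pochhammer r%:C n = (poch r n)%:C.
Proof.
rewrite /pochhammer /poch rmorph_prod; apply: eq_bigr => k _.
by rewrite rmorphD /= rmorph_nat.
Qed.

(** The factors of the two Pochhammer symbols pair up as (A + i m) (A - i m) = A^2 + m^2 with A = a
    + 1/2 + k and m = lam / (2 eps). Taking eps^(-2) out of each pair turns the variable sinh^2 x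
    into (sinh x / eps)^2. *)
Lemma jacobi_phiE a lam eps x : eps != 0 -> `|sinh x| < 1 ->
  jacobi_phi a a (lam / eps%:C) x = cpseries (jacobi_coef a lam eps) ((sinh x / eps) ^+ 2).
Proof.
move=> e0 sx.
have z1 : `|(- sinh x ^+ 2)%:C| < 1 :> R[i].
  by rewrite normcE normc_real ltcR normrN normrX expr_lt1.
rewrite /jacobi_phi /hyp2F1 z1 /gauss_series /cpseries; congr csum; apply/funext => n.
have ec0 : eps%:C != 0 :> R[i] by rewrite -(rmorph0 (real_complex R)) (inj_eq (@complexI R)).
have two0 : (2 : R[i]) != 0 by rewrite pnatr_eq0.
have four0 : (4 : R[i]) != 0 by rewrite pnatr_eq0.
have -> : pochhammer (((a + a + 1)%:C + 'i * (lam / eps%:C)) / 2) n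
        * pochhammer (((a + a + 1)%:C - 'i * (lam / eps%:C)) / 2) n
  = (\prod_(k < n) (((eps * (a + 2^-1 + k%:R)) ^+ 2)%:C + lam ^+ 2 / 4)) * (eps%:C ^- 2) ^+ n.
  rewrite /pochhammer -big_split /=.
  rewrite -[X in _ * _ ^+ X](card_ord n) -prodr_const -big_split /=.
  apply: eq_bigr => k _.
  have -> : ((a + a + 1)%:C : R[i]) = 2 * (a + 2^-1)%:C.
    rewrite -(rmorph_nat (real_complex R) 2) -rmorphM /=; congr (_%:C); by field.
  set A := (a + 2^-1)%:C; set e := eps%:C.
  rewrite rmorphXn rmorphM rmorphD /= rmorph_nat -/A -/e.
  transitivity ((A + k%:R) ^+ 2 - 'i ^+ 2 * (lam / (2 * e)) ^+ 2).
    by field; rewrite ?two0 ?ec0.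
  by rewrite sqr_i; field; rewrite ?two0 ?four0 ?ec0.
rewrite pochhammer_real /jacobi_coef !rmorphM !rmorphXn /= rmorphM fmorphV rmorphN rmorphXn /= rmorph_nat.
set P := \prod_(k < n) _; set s := (sinh x)%:C; set e := eps%:C; set Q := (poch _ _)%:C.
rewrite [(- s ^+ 2) ^+ n]exprNn exprVn !expr_div_n.
by ring.
Qed.

(** This is [opdam_G] at spectral parameter lam / eps and point eps * x, with every negative power
    of [eps] cancelled: the 1 / eps of the spectral parameter meets the [eps] in sinh (2 eps x).
    Hence it is meaningful at [eps = 0]. *)
Definition opdam_scaled a lam eps x : R[i] :=
  cpseries (jacobi_coef a lam eps) ((x * sinhc (eps * x)) ^+ 2)
  + ((eps * (2 * a + 1))%:C + 'i * lam) / (4 * (a + 1))%:C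
    * (2 * x * sinhc (2 * eps * x))%:C
    * cpseries (jacobi_coef (a + 1) lam eps) ((x * sinhc (eps * x)) ^+ 2).

Lemma opdam_GE a lam eps x : 0 < eps -> `|eps * x| <= 4^-1 ->
  opdam_G a (lam / eps%:C) (eps * x) = opdam_scaled a lam eps x.
Proof.
move=> e0 ex; have en0 : eps != 0 by rewrite gt_eqF.
have ec0 : eps%:C != 0 :> R[i] by rewrite -(rmorph0 (real_complex R)) (inj_eq (@complexI R)).
rewrite /opdam_G /opdam_scaled !jacobi_phiE ?sinh_lt1//.
have -> : sinh (eps * x) / eps = x * sinhc (eps * x) by rewrite sinhcE; field.
congr (_ + _ * _).
have -> : sinh (2 * (eps * x)) = eps * (2 * x * sinhc (2 * eps * x)).
  by rewrite sinhcE [2 * (eps * x)]mulrA; ring.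
set u := 2 * x * _.
have -> : (eps * u)%:C = eps%:C * u%:C :> R[i] by rewrite rmorphM.
have -> : (eps * (2 * a + 1))%:C = eps%:C * (2 * a + 1)%:C :> R[i] by rewrite rmorphM.
set w := ((4 * (a + 1))%:C)^-1; set z := (2 * a + 1)%:C; set e := eps%:C.
by field; rewrite ?ec0.
Qed.

Lemma jacobi_coef_cvg a lam (F : set_system R) {FF : Filter F} n : F --> (0 : R) ->
  jacobi_coef a lam eps n @[eps --> F] --> (jacobi_coef a lam 0 n : R[i]^o).
Proof.
move=> F0; rewrite /jacobi_coef; apply: ccvgM; last exact: ccvg_cst.
apply: ccvgM; first exact: ccvg_cst.
elim: n => [|n IH].
  by under eq_fun do rewrite big_ord0; rewrite big_ord0; exact: ccvg_cst.
pose P e := \prod_(k < n) (((e * (a + 2^-1 + k%:R)) ^+ 2)%:C + lam ^+ 2 / 4).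
pose X e : R[i] := ((e * (a + 2^-1 + n%:R)) ^+ 2)%:C + lam ^+ 2 / 4.
have E e : \prod_(k < n.+1) (((e * (a + 2^-1 + k%:R)) ^+ 2)%:C + lam ^+ 2 / 4) = P e * X e.
  by rewrite big_ord_recr.
rewrite E (funext E); apply: (@ccvgM R _ F FF P X _ _ IH).
apply: ccvgD; last exact: ccvg_cst.
apply: cvg_real_complex; rewrite expr2; under eq_fun do rewrite expr2.
by apply: cvgM; (apply: cvgM; [exact: F0|exact: cvg_cst]).
Qed.

Lemma opdam_scaled_arg_le eps x Z : 0 <= eps -> eps * Z <= 4^-1 -> `|x| <= Z ->
  `|(x * sinhc (eps * x)) ^+ 2| <= (2 * Z) ^+ 2.
Proof.
move=> e0 eZ xZ; rewrite normrX ler_pXn2r ?nnegrE//; last first.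
  by rewrite mulr_ge0// (le_trans _ xZ).
rewrite normrM mulrC ler_pM// (gtr0_norm (sinhc_gt0 _)) sinhc_le2//.
rewrite normrM (ger0_norm e0); apply: (@le_trans _ _ (eps * Z)); first by rewrite ler_wpM2l.
lra.
Qed.

(** With e = 1 / (4 Z) bounding [eps] and r = (2 Z)^2 bounding the variable of the series, e^2 * r
    is exactly the threshold of [jacobi_coef_bound_summable]. *)
Lemma scale_bound Z : 0 < Z -> ((4 * Z)^-1) ^+ 2 * (2 * Z) ^+ 2 = 4^-1.
Proof. by move=> Z0; field; rewrite gt_eqF. Qed.

Lemma scale_le eps Z : 0 < Z -> eps * Z <= 4^-1 -> eps <= (4 * Z)^-1.
Proof. by move=> Z0 h; rewrite -[_^-1]mul1r ler_pdivlMr ?mulr_gt0//; lra. Qed.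

Lemma opdam_scaled_cvg a lam x : - 2^-1 < a ->
  opdam_scaled a lam eps x @[eps --> (0 : R)^'+] --> (opdam_scaled a lam 0 x : R[i]^o).
Proof.
move=> ha.
(* Adding 1 keeps [Z] positive at x = 0. *)
pose Z := `|x| + 1.
have Z0 : 0 < Z by rewrite ltr_wpDl.
have xZ : `|x| <= Z by rewrite lerDl.
have idc : (eps : R) @[eps --> (0 : R)^'+] --> (0 : R) by apply: cvg_at_right_filter; exact: cvg_id.
have fe (k : R) : k * eps * x @[eps --> (0 : R)^'+] --> (0 : R).
  rewrite -[X in _ --> X](mul0r x) -[X in _ --> X * x](mulr0 k).
  by apply: cvgM; [apply: cvgM => //|]; exact: cvg_cst.
have near_e : \forall eps \near (0 : R)^'+, 0 <= eps /\ eps * Z <= 4^-1.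
  have h : (0 : R) < (4 * Z)^-1 by rewrite invr_gt0 mulr_gt0.
  near=> eps; split; first by near: eps; exact: nbhs_right_ge.
  rewrite -ler_pdivlMr//; have -> : 4^-1 / Z = (4 * Z)^-1 by rewrite invfM.
  by near: eps; exact: nbhs_right_le.
have argc : (x * sinhc (eps * x)) ^+ 2 @[eps --> (0 : R)^'+] --> (x * sinhc (0 * x)) ^+ 2.
  have h : x * sinhc (eps * x) @[eps --> (0 : R)^'+] --> x * sinhc (0 * x).
    apply: cvgM; first exact: cvg_cst.
    rewrite mul0r {2}/sinhc eqxx; apply: cvg_sinhc.
    by have := fe 1; under eq_fun do rewrite mul1r.
  by rewrite expr2; under eq_fun do rewrite expr2; apply: cvgM.
have cc b : - 2^-1 < b -> cpseries (jacobi_coef b lam eps) ((x * sinhc (eps * x)) ^+ 2) @[eps --> (0 : R)^'+]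
    --> (cpseries (jacobi_coef b lam 0) ((x * sinhc (0 * x)) ^+ 2) : R[i]^o).
  move=> hb; apply: (@cpseries_cvg _ _ _ _ _ _ _ _ (jacobi_coef_bound b (normc (lam ^+ 2 / 4)) (4 * Z)^-1) ((2 * Z) ^+ 2)) => //.
  - by move=> n; exact: jacobi_coef_cvg.
  - by apply: filterS near_e => e [e0 eZ] n; apply: normc_jacobi_coef_le => //; exact: scale_le.
  - by apply: filterS near_e => e [e0 eZ]; exact: opdam_scaled_arg_le.
  - by move=> n; apply: normc_jacobi_coef_le => //; rewrite invr_ge0 mulr_ge0// ltW.
  - by apply: opdam_scaled_arg_le => //; rewrite mul0r invr_ge0.
  - by apply: jacobi_coef_bound_summable; rewrite ?normc_ge0 ?sqr_ge0// scale_bound.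
apply: ccvgD; first exact: cc.
apply: ccvgM; last by apply: cc; lra.
apply: ccvgM.
  apply: ccvgM; last exact: ccvg_cst.
  apply: ccvgD; last exact: ccvg_cst.
  by apply: cvg_real_complex; apply: cvgM => //; exact: cvg_cst.
apply: cvg_real_complex; apply: cvgM; first exact: cvg_cst.
rewrite mulr0 mul0r {2}/sinhc eqxx; apply: cvg_sinhc; exact: fe.
Unshelve. all: by end_near. Qed.

(** Uniformity in both [eps] and [x] is the point: this is the share of the Opdam function in the
    majorant for dominated convergence. *)
Lemma opdam_scaled_bounded a lam Z : - 2^-1 < a -> 0 < Z ->
  exists2 B, 0 <= B & forall eps x, 0 <= eps -> eps * Z <= 4^-1 -> `|x| <= Z ->
    normc (opdam_scaled a lam eps x) <= B.
Proof.
move=> ha Z0.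
have cb b : - 2^-1 < b -> exists2 B, 0 <= B & forall eps x, 0 <= eps -> eps * Z <= 4^-1 -> `|x| <= Z ->
    normc (cpseries (jacobi_coef b lam eps) ((x * sinhc (eps * x)) ^+ 2)) <= B.
  move=> hb.
  have H (eps x : R) : 0 <= eps -> eps * Z <= 4^-1 -> `|x| <= Z ->
    normc (cpseries (jacobi_coef b lam eps) ((x * sinhc (eps * x)) ^+ 2)) <=
     2 * limn (series (fun n => jacobi_coef_bound b (normc (lam ^+ 2 / 4)) (4 * Z)^-1 n * ((2 * Z) ^+ 2) ^+ n)).
    move=> e0 eZ xZ; apply: normc_csum_le => [n|].
      apply: normc_cpseries_term_le; last exact: opdam_scaled_arg_le.
      by apply: normc_jacobi_coef_le => //; exact: scale_le.
    by apply: jacobi_coef_bound_summable; rewrite ?normc_ge0 ?sqr_ge0// scale_bound.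
  eexists; last exact: H.
  (* Nonnegativity of the bound is read off from the instance eps = x = 0. *)
  by apply: le_trans (normc_ge0 _) (H 0 0 _ _ _); rewrite ?mul0r ?normr0 ?invr_ge0 ?ler0n ?(ltW Z0).
have [B1 B10 H1] := cb _ ha.
have ha1 : - 2^-1 < a + 1 by lra.
have [B2 B20 H2] := cb _ ha1.
have a1 : 0 < 4 * (a + 1) by lra.
exists (B1 + ((4 * Z)^-1 * (2 * a + 1) + normc ('i * lam)) / (4 * (a + 1)) * (2 * Z * 2) * B2).
  rewrite addr_ge0// !mulr_ge0 ?addr_ge0 ?normc_ge0 ?mulr_ge0 ?invr_ge0 ?(ltW Z0) ?(ltW a1)//; lra.
move=> eps x e0 eZ xZ.
apply: le_trans (normc_triangle _ _) _; rewrite lerD ?H1//.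
rewrite !ComplexField.Normc.normcM ler_pM ?H2 ?mulr_ge0 ?normc_ge0//.
rewrite ler_pM ?mulr_ge0 ?normc_ge0//.
  rewrite ComplexField.Normc.normcV normc_real (gtr0_norm a1) ler_pM2r ?invr_gt0//.
  apply: le_trans (normc_triangle _ _) _.
  rewrite ComplexField.Normc.normcM lerD2r normc_real ger0_norm; last by rewrite mulr_ge0//; lra.
  by rewrite ler_wpM2r ?scale_le//; lra.
rewrite normc_real !normrM (gtr0_norm (sinhc_gt0 _)) (@ger0_norm _ 2)//.
rewrite ler_pM ?mulr_ge0 ?ler_wpM2l// ?(ltW (sinhc_gt0 _))//; apply: sinhc_le2.
rewrite !normrM (ger0_norm e0) (@ger0_norm _ 2)//.
have := @ler_wpM2l _ _ e0 _ _ xZ; lra.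
Qed.

End rescaled_opdam.

(** * Lebesgue integrals under affine maps and reflection *)

Section affine_change_of_variables.
Context {R : realType}.
Local Notation mu := (@lebesgue_measure R).
Local Open Scope ereal_scope.

Let aff (c b : R) : measurableTypeR R -> measurableTypeR R := fun z => (c * z + b)%R.

Let measurable_aff (c b : R) : measurable_fun setT (aff c b).
Proof. by apply: measurable_funD => //; apply: measurable_funM. Qed.

Let aff_preimage (c b u v : R) : (0 < c)%R ->
  aff c b @^-1` `]u, v]%classic = `]((u - b) / c)%R, ((v - b) / c)%R]%classic.
Proof.
move=> c0; apply/seteqP; split => z /=;
 by rewrite !in_itv/= ltr_pdivrMr// ler_pdivlMr// ltrBlDr lerBrDr mulrC.
Qed.

Let pf (c b : R) : {measure set (measurableTypeR R) -> \bar R} :=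
  measure_function_pushforward__canonical__measure_function_Measure mu (measurable_aff c b).

(** The preimage of a half-open interval under z -> c z + b has its length divided by [c], so the
    two measures agree on such intervals, and uniqueness of Lebesgue measure extends this to all
    measurable sets. *)
Let lebesgue_aff (c b : R) (c0 : (0 < c)%R) (A : set R) : measurable A ->
  mscale (NngNum (ltW c0)) (pf c b) A = mu A.
Proof.
move=> mA; apply/esym/lebesgue_measure_unique => //= _ [[u v]] _ <-.
rewrite /mscale /= /pushforward aff_preimage// !lebesgue_measure_itv/= !lte_fin.
rewrite ltr_pM2r ?invr_gt0// ltrD2r; case: ifPn => // _; last by rewrite mule0.
by rewrite -!EFinD -EFinM; congr EFin; field; rewrite gt_eqF.
Qed.

Lemma ge0_integral_affine (f : R -> \bar R) (c b : R) : (0 < c)%R ->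
  measurable_fun setT f -> (forall z, 0 <= f z) ->
  \int[mu]_z f z = c%:E * \int[mu]_z f (c * z + b)%R.
Proof.
move=> c0 mf f0.
rewrite (eq_measure_integral (mscale (NngNum (ltW c0)) (pf c b))) => [|A mA _]; last by apply/esym; exact: lebesgue_aff.
rewrite ge0_integral_mscale//; congr (_ * _).
by rewrite [LHS]ge0_integral_pushforward// preimage_setT.
Qed.

(** Integrability passes from the rescaled function to the original one, because bounds are
    available for the rescaled one. *)
Lemma integrable_affine (f : R -> R) (c b : R) : (0 < c)%R ->
  measurable_fun setT f ->
  mu.-integrable setT (EFin \o (fun z => f (c * z + b)%R)) ->
  mu.-integrable setT (EFin \o f).
Proof.
move=> c0 mf /integrableP[_ h]; apply/integrableP; split; first exact/measurable_EFinP.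
rewrite (ge0_integral_affine b c0)//; last by do 2 apply: measurableT_comp => //.
by rewrite lte_mul_pinfty// lee_fin ltW.
Qed.

Lemma Rintegral_affine (f : R -> R) (c b : R) : (0 < c)%R ->
  measurable_fun setT f ->
  mu.-integrable setT (EFin \o (fun z => f (c * z + b)%R)) ->
  (\int[mu]_z f z = c * \int[mu]_z f (c * z + b))%R.
Proof.
move=> c0 mf h.
have mc : measurable_fun setT (fun z : R => c * z + b)%R by exact: measurable_aff.
have fc : measurable_fun setT (EFin \o (fun z => f (c * z + b)%R)).
  by apply/measurable_EFinP; apply: measurableT_comp mf mc.
have mEf : measurable_fun setT (EFin \o f) by exact/measurable_EFinP.
have fp := integrable_pos_fin_num measurableT h.
have fn := integrable_neg_fin_num measurableT h.
rewrite /Rintegral [in LHS]integralE [in RHS]integralE.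
rewrite (ge0_integral_affine b c0)//; last exact: measurable_funepos.
rewrite (@ge0_integral_affine (EFin \o f)^\- c b)//; last exact: measurable_funeneg.
have -> : \int[mu]_z (EFin \o f)^\+ (c * z + b)%R =
  \int[mu]_z (EFin \o (fun z => f (c * z + b)%R))^\+ z by apply: eq_integral => z _; rewrite !funeposE.
have -> : \int[mu]_z (EFin \o f)^\- (c * z + b)%R =
  \int[mu]_z (EFin \o (fun z => f (c * z + b)%R))^\- z by apply: eq_integral => z _; rewrite !funenegE.
by rewrite -(fineK fp) -(fineK fn) -!EFinM -!EFinB /= mulrBr.
Qed.

(** Slope -1, which the affine lemmas exclude; the pushforward under negation is again Lebesgue
    measure. *)
Lemma ge0_integral_reflect (f : R -> \bar R) :
  measurable_fun setT f -> (forall z, 0 <= f z) ->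
  \int[mu]_z f z = \int[mu]_z f (- z)%R.
Proof.
move=> mf f0.
have mN : measurable_fun setT (-%R : measurableTypeR R -> measurableTypeR R) by [].
pose pN : {measure set (measurableTypeR R) -> \bar R} :=
  measure_function_pushforward__canonical__measure_function_Measure mu mN.
rewrite (eq_measure_integral pN) => [|A mA _]; last by apply/esym; exact: lebesgue_measureN.
by rewrite [LHS]ge0_integral_pushforward// preimage_setT.
Qed.

Lemma integrable_reflect (f : R -> R) : mu.-integrable setT (EFin \o f) ->
  mu.-integrable setT (EFin \o (fun z => f (- z)%R)).
Proof.
move=> /integrableP[/measurable_EFinP mf h]; apply/integrableP; split.
  by apply/measurable_EFinP; exact: (measurableT_comp mf).
by move: h; rewrite ge0_integral_reflect//; do 2 apply: measurableT_comp => //.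
Qed.

Lemma Rintegral_reflect (f : R -> R) : mu.-integrable setT (EFin \o f) ->
  (\int[mu]_z f z = \int[mu]_z f (- z))%R.
Proof.
move=> /integrableP[mf _]; rewrite /Rintegral integralE [in RHS]integralE; congr (fine (_ - _)).
  rewrite ge0_integral_reflect//; last exact: measurable_funepos.
  by apply: eq_integral => z _; rewrite !funeposE.
rewrite ge0_integral_reflect//; last exact: measurable_funeneg.
by apply: eq_integral => z _; rewrite !funenegE.
Qed.

End affine_change_of_variables.

(** * Integration on open intervals for densities unbounded at the ends *)

Section open_interval_exhaustion.
Context {R : realType}.
Local Notation mu := (@lebesgue_measure R).
Implicit Types (a b : R).

(** Denominators start at 3 so that all these closed intervals are nondegenerate; with 2 the first
    one would be the midpoint alone. *)
Lemma bigcup_shrink a b : a < b ->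
  `]a, b[%classic = \bigcup_n `[a + (b - a) / n.+3%:R, b - (b - a) / n.+3%:R]%classic.
Proof.
move=> ab; have ba : 0 < b - a by rewrite subr_gt0.
apply/seteqP; split => z /=.
  rewrite in_itv/= => /andP[az zb].
  pose m := Num.min (z - a) (b - z).
  have m0 : 0 < m by rewrite lt_min !subr_gt0 az zb.
  exists (Num.truncn ((b - a) / m)) => //=; rewrite in_itv/=.
  set n := Num.truncn _.
  have H : (b - a) / n.+3%:R <= m.
    rewrite ler_pdivrMr ?ltr0n// mulrC -ler_pdivrMr//.
    by apply: ltW; apply: lt_le_trans (truncnS_gt _) _; rewrite ler_nat ltnS -addn2 leq_addr.
  move: H; rewrite le_min; set u := _ / _ => /andP[h1 h2].
  by apply/andP; split; lra.
move=> [n _] /=; rewrite !in_itv/= => /andP[h1 h2].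
have : 0 < (b - a) / n.+3%:R by rewrite divr_gt0// ltr0n.
by move: h1 h2; set u := _ / _ => h1 h2 h; apply/andP; split; lra.
Qed.

Lemma shrink_nondecreasing a b : a < b ->
  nondecreasing_seq (fun n => `[a + (b - a) / n.+3%:R, b - (b - a) / n.+3%:R]%classic).
Proof.
move=> ab n m nm; rewrite subsetEset => z /=; rewrite !in_itv/= => /andP[h1 h2].
have H : (b - a) / m.+3%:R <= (b - a) / n.+3%:R.
  by rewrite ler_pM2l ?subr_gt0// lef_pV2 ?posrE ?ltr0n// ler_nat.
move: H h1 h2; set u := _ / _; set v := _ / _ => H h1 h2.
by apply/andP; split; lra.
Qed.

Lemma shrink_cvg0 (c : R) : c / n.+3%:R @[n --> \oo] --> (0 : R).
Proof.
rewrite -[X in _ --> X](mulr0 c); apply: cvgM; first exact: cvg_cst.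
have := @cvg_harmonic R; rewrite -(cvg_shiftn 2) /=.
by apply: cvg_trans; apply: near_eq_cvg; apply: nearW => n; rewrite /= addn2.
Qed.

Lemma shrink_lt a b n : a < b -> a < a + (b - a) / n.+3%:R /\
  a + (b - a) / n.+3%:R < b - (b - a) / n.+3%:R /\ b - (b - a) / n.+3%:R < b.
Proof.
move=> ab; have ba : 0 < b - a by rewrite subr_gt0.
have h1 : 0 < (b - a) / n.+3%:R by rewrite divr_gt0// ltr0n.
have h2 : (b - a) / n.+3%:R <= (b - a) / 3.
  by rewrite ler_pM2l// lef_pV2 ?posrE ?ltr0n// ler_nat.
by move: h1 h2; set u := _ / _; set v := _ / _ => h1 h2; split; [|split]; rewrite /v in h2; lra.
Qed.

(** Since [f] may blow up at the endpoints, the fundamental theorem is applied on the closed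
    intervals of the exhaustion. Monotone convergence handles the integrals, the one-sided limits of
    [F] the boundary values. *)
Lemma ge0_FTC_oo (F f : R -> R) a b : a < b ->
  {in `]a, b[, continuous f} -> (forall z, a < z < b -> 0 <= f z) ->
  (forall z, a < z < b -> is_derive z (1 : R) F (f z)) ->
  F z @[z --> a^'+] --> F a -> F z @[z --> b^'-] --> F b ->
  (\int[mu]_(z in `]a, b[) (f z)%:E = (F b - F a)%:E)%E.
Proof.
move=> ab cf f0 dF Fa Fb.
have mf : measurable_fun `]a, b[ f.
  by apply: open_continuous_measurable_fun => // z; rewrite inE => zab; exact: cf.
rewrite bigcup_shrink//.
have sub n : `[a + (b - a) / n.+3%:R, b - (b - a) / n.+3%:R]%classic `<=` `]a, b[%classic.
  by move=> z zn; rewrite bigcup_shrink//; exists n.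
have c : (\int[mu]_(x in `[(a + (b - a) / n.+3%:R)%R, (b - (b - a) / n.+3%:R)%R]) (f x)%:E @[n --> \oo] -->
  \int[mu]_(x in \bigcup_n `[(a + (b - a) / n.+3%:R)%R, (b - (b - a) / n.+3%:R)%R]%classic) (f x)%:E)%E.
  apply: ge0_nondecreasing_set_cvg_integral => //; first exact: shrink_nondecreasing.
    move=> n.
    by apply/measurable_EFinP; apply: measurable_funS mf => //; exact: sub.
  by move=> n z /sub; rewrite /= in_itv/= lee_fin => /f0.
apply: (cvg_unique _ c) => //.
have E n : (\int[mu]_(x in `[(a + (b - a) / n.+3%:R)%R, (b - (b - a) / n.+3%:R)%R]) (f x)%:E =
   (F (b - (b - a) / n.+3%:R) - F (a + (b - a) / n.+3%:R))%:E)%E.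
  have [h1 [h2 h3]] := shrink_lt n ab.
  have inab z : z \in `[a + (b - a) / n.+3%:R, b - (b - a) / n.+3%:R] -> a < z < b.
    by rewrite in_itv/= => /andP[u v]; rewrite (lt_le_trans h1 u) (le_lt_trans v h3).
  rewrite (continuous_FTC2 (F := F) h2) ?EFinB//.
  - apply: continuous_in_subspaceT => z; rewrite inE /= => /inab zab.
    by apply: cf; rewrite in_itv.
  - split.
    + by move=> z /subset_itv_oo_cc/inab/dF; case.
    + apply: cvg_at_right_filter; apply: differentiable_continuous.
      by apply/derivable1_diffP; case: (dF (a + (b - a) / n.+3%:R) _) => //; rewrite h1/= (lt_trans h2).
    + apply: cvg_at_left_filter; apply: differentiable_continuous.
      by apply/derivable1_diffP; case: (dF (b - (b - a) / n.+3%:R) _) => //; rewrite h3 (lt_trans h1).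
  - by move=> z /subset_itv_oo_cc/inab/dF ?; rewrite derive1E derive_val.
rewrite (funext E).
apply: cvg_EFin; first exact: nearW.
rewrite /=; apply: cvgB.
- move/cvg_at_leftP : Fb; apply; split; first by move=> n; have [? []] := shrink_lt n ab.
  by rewrite -[X in _ --> X]subr0; apply: cvgB; [exact: cvg_cst|exact: shrink_cvg0].
- move/cvg_at_rightP : Fa; apply; split; first by move=> n; have [? []] := shrink_lt n ab.
  by rewrite -[X in _ --> X]addr0; apply: cvgD; [exact: cvg_cst|exact: shrink_cvg0].
Qed.

(** Here [G] may blow up at the endpoints. The intermediate value theorem and monotonicity show that
    the images under [F] of the closed intervals exhaust the image interval; substitution on each of
    them and monotone convergence on both sides conclude. *)
Lemma ge0_substitution_oo (F f G : R -> R) a b : a < b ->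
  {in `[a, b] &, {homo F : x y / x < y}} ->
  continuous f -> (forall z, is_derive z (1 : R) F (f z)) ->
  {in `]F a, F b[, continuous G} -> (forall t, F a < t < F b -> 0 <= G t) ->
  (forall z, a < z < b -> 0 <= f z) ->
  (\int[mu]_(t in `]F a, F b[) (G t)%:E = \int[mu]_(z in `]a, b[) (G (F z) * f z)%:E)%E.
Proof.
move=> ab incF cf dF cG G0 f0.
have cF : continuous F.
  by move=> z; apply: differentiable_continuous; apply/derivable1_diffP; case: (dF z).
have Fab : F a < F b by apply: incF; rewrite // in_itv/= ?lexx ltW.
pose an n := a + (b - a) / n.+3%:R; pose bn n := b - (b - a) / n.+3%:R.
have sub n : `[an n, bn n]%classic `<=` `]a, b[%classic.
  by move=> z zn; rewrite bigcup_shrink//; exists n.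
have FI z : a < z < b -> F a < F z < F b.
  by move=> /andP[az zb]; apply/andP; split; apply: incF; rewrite // in_itv/= ?lexx ?ltW//= ltW.
have FE : `]F a, F b[%classic = \bigcup_n `[F (an n), F (bn n)]%classic.
  apply/seteqP; split => t /=.
    rewrite in_itv/= => /andP[at_ tb].
    have cab : {within `[a, b], continuous F} by exact: continuous_subspaceT.
    have [|z zab Fz] := IVT (v := t) (ltW ab) cab.
      by rewrite (min_idPl (ltW Fab)) (max_idPr (ltW Fab)) !ltW.
    have : z \in `]a, b[.
      move: zab; rewrite !in_itv/= !le_eqVlt => /andP[/predU1P[az|az] /predU1P[zb|zb]];
      rewrite ?az ?zb ?andbT//; by move: at_ tb; rewrite -Fz ?az ?zb ltxx.
    move=> zab'; have : `]a, b[%classic z by [].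
    rewrite bigcup_shrink// => -[n _ /=].
    rewrite in_itv/= => /andP[h1 h2]; exists n => //=; rewrite in_itv/= -Fz.
    have [k1 [k2 k3]] := shrink_lt n ab.
    have mono u v : a <= u -> v <= b -> u <= v -> F u <= F v.
      rewrite [u <= v]le_eqVlt => au vb /predU1P[->//|uv]; apply/ltW/incF => //; rewrite in_itv/= ?au ?vb ?andbT/=.
        by rewrite ltW// (lt_le_trans uv).
      by rewrite (le_trans au)// ltW.
    move: h1 h2 k1 k2 k3; rewrite -/(an n) -/(bn n); move: (an n) (bn n) => u v h1 h2 k1 k2 k3.
    by apply/andP; split; apply: mono => //; lra.
  move=> [n _] /=; rewrite !in_itv/= => /andP[h1 h2].
  have [k1 [k2 k3]] := shrink_lt n ab.
  have /andP[u1 _] : F a < F (an n) < F b by apply: FI; rewrite k1/= (lt_trans k2).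
  have /andP[_ u2] : F a < F (bn n) < F b by apply: FI; rewrite k3 andbT (lt_trans k1).
  by rewrite (lt_le_trans u1 h1) (le_lt_trans h2 u2).
have mG : measurable_fun `]F a, F b[ G.
  by apply: open_continuous_measurable_fun => // z; rewrite inE => zab; exact: cG.
have cGF : {in `]a, b[, continuous (fun z => G (F z) * f z)}.
  move=> z zab; apply: cvgM; last exact: cf.
  apply: (@continuous_comp _ _ _ F G); first exact: cF.
  by apply: cG; rewrite in_itv/=; apply: FI; rewrite in_itv/= in zab.
have mGF : measurable_fun `]a, b[ (fun z => G (F z) * f z).
  by apply: open_continuous_measurable_fun => // z; rewrite inE => zab; exact: cGF.
have subF n : `[F (an n), F (bn n)]%classic `<=` `]F a, F b[%classic.
  by move=> z zn; rewrite FE; exists n.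
have ndF : nondecreasing_seq (fun n => `[F (an n), F (bn n)]%classic).
  move=> n m nm; rewrite subsetEset => z /=; rewrite !in_itv/= => /andP[h1 h2].
  have := shrink_nondecreasing ab nm; rewrite subsetEset => S.
  have [k1 [k2 k3]] := shrink_lt n ab; have [l1 [l2 l3]] := shrink_lt m ab.
  have [p1 p2] : an m <= an n /\ bn n <= bn m.
    have := S (an n); have := S (bn n); rewrite /= !in_itv/= lexx (ltW k2) lexx /=.
    by move=> /(_ isT)/andP[_ q] /(_ isT)/andP[r _].
  have mono u v : a <= u -> v <= b -> u <= v -> F u <= F v.
    rewrite [u <= v]le_eqVlt => au vb /predU1P[->//|uv]; apply/ltW/incF => //; rewrite in_itv/= ?au ?vb ?andbT/=.
      by rewrite ltW// (lt_le_trans uv).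
    by rewrite (le_trans au)// ltW.
  move: h1 h2 k1 k2 k3 l1 l2 l3 p1 p2; rewrite -/(an n) -/(bn n) -/(an m) -/(bn m).
  move: (an n) (bn n) (an m) (bn m) => u v u' v' h1 h2 k1 k2 k3 l1 l2 l3 p1 p2.
  by apply/andP; split; [apply: le_trans h1|apply: (le_trans h2)]; apply: mono => //; lra.
have cl : (\int[mu]_(x in `[F (an n), F (bn n)]) (G x)%:E @[n --> \oo] -->
  \int[mu]_(x in \bigcup_n `[F (an n), F (bn n)]%classic) (G x)%:E)%E.
  apply: ge0_nondecreasing_set_cvg_integral => //.
    move=> n.
    by apply/measurable_EFinP; apply: measurable_funS mG => //; exact: subF.
  by move=> n z /subF; rewrite /= in_itv/= lee_fin => /G0.
have cr : (\int[mu]_(x in `[an n, bn n]) (G (F x) * f x)%:E @[n --> \oo] -->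
  \int[mu]_(x in \bigcup_n `[an n, bn n]%classic) (G (F x) * f x)%:E)%E.
  apply: ge0_nondecreasing_set_cvg_integral => //; first exact: shrink_nondecreasing.
    move=> n.
    by apply/measurable_EFinP; apply: measurable_funS mGF => //; exact: sub.
  by move=> n z /sub; rewrite /= in_itv/= lee_fin => zab; rewrite mulr_ge0 ?f0 ?G0 ?FI.
rewrite FE [in RHS]bigcup_shrink//.
apply: (cvg_unique _ cl) => //.
suff -> : (fun n => \int[mu]_(x in `[F (an n), F (bn n)]) (G x)%:E)%E =
    (fun n => \int[mu]_(x in `[an n, bn n]) (G (F x) * f x)%:E)%E by exact: cr.
apply/funext => n.
have [k1 [k2 k3]] := shrink_lt n ab.
have dE z : derive1 F z = f z by rewrite derive1E; have := dF z => ?; rewrite derive_val.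
have dEf : derive1 F = f by apply/funext.
rewrite integration_by_substitution_increasing ?dEf//.
- exact: ltW.
- have inab u : u \in `[an n, bn n] -> u \in `[a, b].
    by rewrite !in_itv/= => /andP[u1 u2]; rewrite (le_trans (ltW k1) u1) (le_trans u2 (ltW k3)).
  by move=> u v /inab uI /inab vI uv; exact: incF.
- by apply/cvg_ex; exists (f (an n)); apply: cvg_at_right_filter; exact: cf.
- by apply/cvg_ex; exists (f (bn n)); apply: cvg_at_left_filter; exact: cf.
- split.
  + by move=> z _; case: (dF z).
  + by apply: cvg_at_right_filter; exact: cF.
  + by apply: cvg_at_left_filter; exact: cF.
- by apply: continuous_in_subspaceT => z; rewrite inE => /subF ?; exact: cG.
Qed.

End open_interval_exhaustion.

(** * The Gamma function and one value of the Beta function *)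

Section gamma_function.
Context {R : realType}.
Local Notation mu := (@lebesgue_measure R).
Implicit Types (s r t u b : R).
Local Open Scope ereal_scope.

(** Euler's integral with values in the extended reals, so that Tonelli's theorem applies before
    finiteness is known; [Gamma] is its finite part. *)
Let eGamma s : \bar R := \int[mu]_(t in `]0%R, +oo[) (t `^ (s - 1) * expR (- t))%:E.

Let mpowR (b : R) : measurable_fun setT (fun t : R => t `^ b)%R := measurable_powR b.

Let mexpN : measurable_fun setT (fun t : R => expR (- t))%R.
Proof. exact: measurableT_comp. Qed.

Lemma integral_powR_oo s r : (0 < s)%R -> (0 < r)%R ->
  \int[mu]_(u in `]0%R, r[) (s * u `^ (s - 1))%:E = (r `^ s)%:E.
Proof.
move=> s0 r0.
have D (u : R) : (0 < u)%R -> is_derive u 1%R (@powR R ^~ s) (s * u `^ (s - 1))%R.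
  move=> u0; have uI : u \in `]0%R, +oo[%R by rewrite in_itv/= u0.
  apply: DeriveDef; first exact: derivable_powR.
  by rewrite -derive1E powR_derive1.
have cP (p u : R) : (0 < u)%R -> {for u, continuous (@powR R ^~ p)}.
  move=> u0; have uI : u \in `]0%R, +oo[%R by rewrite in_itv/= u0.
  by apply: differentiable_continuous; apply/derivable1_diffP; exact: derivable_powR.
transitivity (r `^ s - 0 `^ s)%:E; last by rewrite powR0 ?subr0// gt_eqF.
have dF (z : R) : (0 < z < r)%R -> is_derive z 1%R (@powR R ^~ s) (s * z `^ (s - 1))%R.
  by move=> /andP[z0 _]; exact: D.
apply: (ge0_FTC_oo r0 _ _ dF).
- move=> u; rewrite in_itv/= => /andP[u0 _]; apply: cvgM; first exact: cvg_cst.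
  exact: cP.
- by move=> z _; rewrite mulr_ge0 ?powR_ge0// ltW.
- by rewrite powR0 ?gt_eqF//; exact: powR_cvg0.
- by apply: cvg_at_left_filter; exact: cP.
Qed.

Lemma integral_expRN u : \int[mu]_(t in `]u, +oo[) (expR (- t))%:E = (expR (- u))%:E.
Proof.
rewrite integral_itv_obnd_cbnd; last exact/measurable_EFinP/measurable_funTS.
have D (t : R) : is_derive t 1%R (fun x => - expR (- x))%R (expR (- t)).
  by apply: trigger_derive; rewrite /= mulrN1 opprK.
have c : continuous (fun t : R => expR (- t))%R.
  by move=> t; apply: continuous_comp; [exact: opp_continuous|exact: continuous_expR].
rewrite (@ge0_continuous_FTC2y R (fun t => expR (- t))%R (fun x => - expR (- x))%R u 0%R).
- by rewrite sub0e -EFinN opprK.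
- by move=> t _; exact: expR_ge0.
- exact: continuous_subspaceT.
- by rewrite -oppr0; apply: cvgN; exact: cvgr_expR.
- by move=> t _; case: (D t).
- by apply: cvg_at_right_filter; apply: cvgN; exact: c.
- by move=> t _; rewrite derive1E; have := D t => ?; rewrite derive_val.
Qed.

Let eGamma_ge0 s : 0 <= eGamma s.
Proof. by apply: integral_ge0 => t _; rewrite lee_fin mulr_ge0 ?powR_ge0 ?expR_ge0. Qed.

Let gamma_measurable b : measurable_fun setT (fun t : R => (t `^ b * expR (- t))%:E).
Proof. by apply/measurable_EFinP; apply: measurable_funM. Qed.

(* Tonelli's theorem on the region [0 < u < t], with [t `^ s] the integral of
   [s * u `^ (s - 1)] on [0 < u < t]. *)
Let eGammaS s : (0 < s)%R -> eGamma (s + 1) = s%:E * eGamma s.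
Proof.
move=> s0.
pose f (p : R * R) := (if (0 < p.1) && (p.1 < p.2) then s * p.1 `^ (s - 1) * expR (- p.2) else 0)%R.
have mf : measurable_fun setT (EFin \o f).
  apply/measurable_EFinP; apply: measurable_fun_ifT => //.
    by apply: measurable_and; apply: measurable_fun_ltr.
  apply: measurable_funM; last exact: measurableT_comp mexpN _.
  by apply: measurable_funM => //; exact: measurableT_comp (mpowR _) _.
have f0 p : 0 <= (EFin \o f) p.
  rewrite /f /= lee_fin; case: ifPn => // _.
  by rewrite !mulr_ge0 ?expR_ge0 ?powR_ge0// ltW.
have := @fubini_tonelli _ _ _ _ R mu mu (EFin \o f) mf f0.
have -> : \int[mu]_x \int[mu]_y (EFin \o f) (x, y) = s%:E * eGamma s.
  rewrite /eGamma -ge0_integralZl//; last 3 first.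
  - by apply: measurable_funTS; exact: gamma_measurable.
  - by move=> x _; rewrite lee_fin mulr_ge0 ?powR_ge0 ?expR_ge0.
  - by rewrite lee_fin ltW.
  rewrite [RHS]integral_mkcond; apply: eq_integral => u _; rewrite patchE mem_setE in_itv/= andbT.
  case: ltP => u0; last by rewrite integral0_eq// => t _; rewrite /f /= ltNge u0.
  transitivity (\int[mu]_(t in `]u, +oo[) ((s * u `^ (s - 1))%:E * (expR (- t))%:E)).
    rewrite [RHS]integral_mkcond; apply: eq_integral => t _; rewrite patchE mem_setE in_itv/= andbT.
    by rewrite /f /= u0 /=; case: ltP.
  rewrite ge0_integralZl//; last 2 first.
  - by apply/measurable_EFinP; exact: measurable_funTS.
  - by rewrite lee_fin mulr_ge0 ?powR_ge0// ltW.
  by rewrite integral_expRN -!EFinM mulrA.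
move=> ->; rewrite /eGamma [LHS]integral_mkcond; apply: eq_integral => t _.
rewrite patchE mem_setE in_itv/= andbT.
case: ltP => t0; last first.
  rewrite integral0_eq// => u _; rewrite /f /=; case: ifP => // /andP[u0 ut].
  by move: (lt_le_trans (lt_trans u0 ut) t0); rewrite ltxx.
transitivity (\int[mu]_(u in `]0%R, t[) ((expR (- t))%:E * (s * u `^ (s - 1))%:E)).
  rewrite ge0_integralZl//; last 2 first.
  - apply/measurable_EFinP/measurable_funTS; exact: measurable_funM.
  - by move=> u _; rewrite lee_fin mulr_ge0 ?powR_ge0// ltW.
  by rewrite integral_powR_oo// -EFinM addrK mulrC.
rewrite [LHS]integral_mkcond; apply: eq_integral => u _; rewrite patchE mem_setE in_itv/=.
by rewrite /f /=; case: ifP => // _; rewrite -EFinM mulrC.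
Qed.

Let eGamma1 : eGamma 1 = 1.
Proof.
rewrite /eGamma; under eq_integral do rewrite subrr powRr0 mul1r.
by rewrite integral_expRN oppr0 expR0.
Qed.

Let eGamma_nat n : eGamma n.+1%:R < +oo.
Proof.
elim: n => [|n IH]; first by rewrite eGamma1 ltry.
by rewrite -natr1 eGammaS ?ltr0n// lte_mul_pinfty ?lee_fin.
Qed.

(** The power t^(s - 1) is at most t^0 for t <= 1 and at most t^n for t > 1, where n >= s - 1; this
    reduces finiteness to positive integers. *)
Let eGamma_ge1_lty s : (1 <= s)%R -> eGamma s < +oo.
Proof.
move=> s1; pose n := (Num.truncn s).+1.
have sn : (s - 1 <= n%:R)%R.
  by have := ltW (truncnS_gt s); rewrite -/n => h; lra.
apply: (@le_lt_trans _ _ (eGamma 1 + eGamma n.+1%:R)); last first.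
  by rewrite lte_add_pinfty// eGamma1 ltry.
rewrite /eGamma -ge0_integralD//; last 4 first.
- by move=> t _; rewrite lee_fin mulr_ge0 ?powR_ge0 ?expR_ge0.
- by apply: measurable_funTS; exact: gamma_measurable.
- by move=> t _; rewrite lee_fin mulr_ge0 ?powR_ge0 ?expR_ge0.
- by apply: measurable_funTS; exact: gamma_measurable.
apply: ge0_le_integral => //.
- by move=> t _; rewrite lee_fin mulr_ge0 ?powR_ge0 ?expR_ge0.
- by apply: measurable_funTS; exact: gamma_measurable.
- by apply: measurable_funTS; apply: emeasurable_funD; exact: gamma_measurable.
move=> t /=; rewrite in_itv/= andbT => t0.
rewrite -EFinD lee_fin -mulrDl ler_wpM2r ?expR_ge0// subrr powRr0 -natr1 addrK.
case: (leP t 1%R) => t1; last first.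
  by rewrite (le_trans (ler_powR (ltW t1) sn))// lerDr.
have : (t `^ (s - 1) <= t `^ 0)%R by apply: ger_powR; rewrite ?t0//; lra.
by rewrite powRr0 => h; rewrite (le_trans h)// lerDl powR_ge0.
Qed.

(** For s < 1 the singularity at 0 is handled by the recursion: s times the integral at [s] is the
    integral at s + 1, which is finite, and s > 0. *)
Let eGamma_lty s : (0 < s)%R -> eGamma s < +oo.
Proof.
move=> s0; have h : eGamma (s + 1) < +oo by apply: eGamma_ge1_lty; rewrite lerDr ltW.
rewrite ltey; apply/eqP => E; move: h.
by rewrite eGammaS// E mulry gtr0_sg// mul1e ltxx.
Qed.

Lemma EFin_Gamma s : (0 < s)%R -> (Gamma s)%:E = eGamma s.
Proof.
move=> s0; rewrite /Gamma /Rintegral fineK// ge0_fin_numE; first exact: eGamma_lty.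
exact: eGamma_ge0.
Qed.

Lemma GammaS s : (0 < s)%R -> Gamma (s + 1) = (s * Gamma s)%R.
Proof.
move=> s0; apply: EFin_inj; rewrite EFinM !EFin_Gamma ?eGammaS//.
by rewrite addr_gt0.
Qed.

(** On ]0, 1[ the exponential is at least e^(-1), while s t^(s - 1) has integral 1 there. *)
Lemma Gamma_gt0 s : (0 < s)%R -> (0 < Gamma s)%R.
Proof.
move=> s0; rewrite -lte_fin EFin_Gamma// lt0e eGamma_ge0 andbT; apply/eqP => E.
have : (expR (- 1))%:E <= s%:E * eGamma s; last first.
  by rewrite E mule0 lee_fin leNgt expR_gt0.
rewrite /eGamma -ge0_integralZl//; last 3 first.
- by apply: measurable_funTS; exact: gamma_measurable.
- by move=> x _; rewrite lee_fin mulr_ge0 ?powR_ge0 ?expR_ge0.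
- by rewrite lee_fin ltW.
apply: (@le_trans _ _ (\int[mu]_(x in `]0%R, 1%R[) (s%:E * (x `^ (s - 1) * expR (- x))%:E))); last first.
  apply: ge0_subset_integral => //.
  - by apply: measurable_funTS; apply: measurable_funeM; exact: gamma_measurable.
  - by move=> x _; rewrite -EFinM lee_fin !mulr_ge0 ?powR_ge0 ?expR_ge0// ltW.
  - by move=> x /=; rewrite !in_itv/= => /andP[-> _].
have -> : (expR (- 1))%:E = \int[mu]_(x in `]0%R, 1%R[) ((expR (- 1))%:E * (s * x `^ (s - 1))%:E).
  rewrite ge0_integralZl//; last 2 first.
  - apply/measurable_EFinP/measurable_funTS; exact: measurable_funM.
  - by move=> u _; rewrite lee_fin mulr_ge0 ?powR_ge0// ltW.
  by rewrite integral_powR_oo// powR1 mule1.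
apply: ge0_le_integral => //.
- by move=> x _; rewrite -EFinM lee_fin !mulr_ge0 ?powR_ge0 ?expR_ge0// ltW.
- by apply: measurable_funTS; apply: measurable_funeM; apply/measurable_EFinP; exact: measurable_funM.
- by apply: measurable_funTS; apply: measurable_funeM; exact: gamma_measurable.
move=> x /=; rewrite in_itv/= => /andP[x0 x1].
rewrite -!EFinM lee_fin mulrC -!mulrA ler_wpM2l// ?(ltW s0)// ler_wpM2l ?powR_ge0//.
by rewrite ler_expR lerN2 ltW.
Qed.

Lemma Gamma_poch s n : (0 < s)%R -> Gamma (s + n%:R) = (Gamma s * poch s n)%R.
Proof.
move=> s0; elim: n => [|n IH]; first by rewrite addr0 poch0 mulr1.
by rewrite pochS mulrA -IH -natr1 addrA GammaS 1?mulrC// ltr_wpDr.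
Qed.

(* Tonelli's theorem for [expR (- q ^+ 2) * expR (- u) * u `^ b], after the
   substitutions [u = r - q ^+ 2] and [q = Num.sqrt r * t]. *)
Lemma beta_half b : (-1 < b)%R ->
  \int[mu]_(t in `](-1)%R, 1%R[) ((1 - t ^+ 2) `^ b)%:E =
  (Num.sqrt pi * Gamma (b + 1) / Gamma (b + 1 + 2^-1))%:E.
Proof.
move=> b1; set J := LHS.
have J0 : 0 <= J by apply: integral_ge0 => t _; rewrite lee_fin powR_ge0.
have msq : measurable_fun setT (fun p : R * R => p.1 ^+ 2)%R.
  exact: measurable_funX.
have mJ : measurable_fun setT (fun t : R => if (t ^+ 2 < 1) then (1 - t ^+ 2) `^ b else 0)%R.
  apply: measurable_fun_ifT => //; first by apply: measurable_fun_ltr.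
  by apply: measurableT_comp (mpowR b) _; apply: measurable_funB.
pose h (p : R * R) := (if p.1 ^+ 2 < p.2 then expR (- p.2) * (p.2 - p.1 ^+ 2) `^ b else 0)%R.
have mh : measurable_fun setT (EFin \o h).
  apply/measurable_EFinP; apply: measurable_fun_ifT => //.
    by apply: measurable_fun_ltr.
  apply: measurable_funM; first exact: measurableT_comp mexpN _.
  by apply: measurableT_comp (mpowR b) _; apply: measurable_funB.
have h0 p : 0 <= (EFin \o h) p.
  by rewrite /h /= lee_fin; case: ifPn => // _; rewrite mulr_ge0 ?expR_ge0 ?powR_ge0.
have := @fubini_tonelli _ _ _ _ R mu mu (EFin \o h) mh h0.
have -> : \int[mu]_q \int[mu]_r (EFin \o h) (q, r) = (Num.sqrt pi)%:E * eGamma (b + 1).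
  rewrite -integralT_gauss muleC -ge0_integralZl//; last 2 first.
  - by apply/measurable_EFinP; exact: measurable_gauss_fun.
  - by move=> q _; rewrite lee_fin gauss_fun_ge0.
  apply: eq_integral => q _.
  rewrite muleC /eGamma -ge0_integralZl//; last 3 first.
  - by apply: measurable_funTS; exact: gamma_measurable.
  - by move=> x _; rewrite lee_fin mulr_ge0 ?powR_ge0 ?expR_ge0.
  - by rewrite lee_fin gauss_fun_ge0.
  rewrite [RHS]integral_mkcond addrK.
  rewrite [RHS](@ge0_integral_affine R _ 1 (- q ^+ 2))//; last 2 first.
  - by apply/(measurable_restrictT _ _).1 => //; apply: measurable_funTS; apply: measurable_funeM; exact: gamma_measurable.
  - by move=> z; apply: erestrict_ge0 => t _; rewrite -EFinM lee_fin !mulr_ge0 ?powR_ge0 ?expR_ge0 ?gauss_fun_ge0.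
  rewrite mul1e; apply: eq_integral => r _; rewrite patchE mem_setE in_itv/= andbT mul1r subr_gt0 /h /=.
  case: ifP => // qr; rewrite -EFinM; congr EFin.
  rewrite /gauss_fun mulrCA -expRD mulrC; congr (_ * expR _)%R; ring.
have -> : \int[mu]_r \int[mu]_q (EFin \o h) (q, r) = J * eGamma (b + 1 + 2^-1).
  rewrite muleC /eGamma -ge0_integralZr//; last 2 first.
  - by apply: measurable_funTS; exact: gamma_measurable.
  - by move=> x _; rewrite lee_fin mulr_ge0 ?powR_ge0 ?expR_ge0.
  rewrite [RHS]integral_mkcond; apply: eq_integral => r _.
  rewrite patchE mem_setE in_itv/= andbT.
  case: ltP => r0; last first.
    rewrite integral0_eq// => q _; rewrite /h /= ltNge (le_trans r0) ?sqr_ge0//.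
  have sr0 : (0 < Num.sqrt r)%R by rewrite sqrtr_gt0.
  have mhr : measurable_fun setT (fun q => (EFin \o h) (q, r)).
    by apply: measurableT_comp mh _.
  rewrite (@ge0_integral_affine R _ (Num.sqrt r) 0)//; last by move=> z; exact: h0.
  have -> : \int[mu]_z (EFin \o h) ((Num.sqrt r * z + 0)%R, r) =
    (expR (- r) * r `^ b)%:E * \int[mu]_z (if (z ^+ 2 < 1) then (1 - z ^+ 2) `^ b else 0)%:E.
    rewrite -ge0_integralZl//; last 3 first.
    - exact/measurable_EFinP.
    - by move=> z _; rewrite lee_fin; case: ifP => // _; rewrite powR_ge0.
    - by rewrite lee_fin mulr_ge0 ?expR_ge0 ?powR_ge0.
    apply: eq_integral => z _; rewrite /h /= addr0 exprMn sqr_sqrtr ?(ltW r0)//.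
    rewrite -{2}[r]mulr1 ltr_pM2l//; case: ifP => z1; last by rewrite mule0.
    rewrite -EFinM; congr EFin; rewrite -mulrA -powRM ?(ltW r0) ?subr_ge0 ?(ltW z1)//.
    by rewrite mulrBr mulr1.
  have -> : \int[mu]_z (if (z ^+ 2 < 1) then (1 - z ^+ 2) `^ b else 0)%:E = J.
    rewrite /J [RHS]integral_mkcond; apply: eq_integral => z _; rewrite patchE mem_setE in_itv/=.
    by rewrite -ltr_norml -[(`|z| < 1)%R](@expr_lt1 _ 2)// real_normK ?num_real//; case: ifP.
  rewrite muleA -EFinM; congr (_%:E * _); rewrite -powR12_sqrt ?(ltW r0)//.
  rewrite mulrCA [RHS]mulrC; congr (_ * _)%R.
  rewrite -powRD; last by rewrite (gt_eqF r0) implybT.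
  by congr (_ `^ _)%R; field.
have g1 : (0 < b + 1)%R by lra.
have g2 : (0 < b + 1 + 2^-1)%R by lra.
move=> E; have {}E : (Num.sqrt pi)%:E * eGamma (b + 1) = J * eGamma (b + 1 + 2^-1) := E.
rewrite -(EFin_Gamma g1) -(EFin_Gamma g2) -EFinM in E.
have G2 := Gamma_gt0 g2.
(* Finiteness of [J] is a by-product: multiplied by a positive number it gives a finite one. *)
have Jfin : J \is a fin_num.
  rewrite ge0_fin_numE// ltey; apply/eqP => JE; move: E.
  by rewrite JE mulyr gtr0_sg// mul1e.
move: E; rewrite -(fineK Jfin) -EFinM => -[->].
by rewrite mulfK// gt_eqF.
Qed.

End gamma_function.

(** * The Dunkl kernel as the value of the rescaled Opdam function at 0 *)

Section dunkl_kernel_as_limit.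
Context {R : realType}.
Implicit Types (a x : R) (lam : R[i]).

Lemma csumZ (k : R[i]) (u : nat -> R[i]) : csummable u ->
  csum (fun n => k * u n) = k * csum u.
Proof.
move=> su; apply: (@cvg_lim R[i]^o); first exact: norm_hausdorff.
have -> : series (fun n => k * u n : R[i]^o) = (fun n => k * series (u : nat -> R[i]^o) n).
  by apply/funext => n; rewrite /series /= mulr_sumr.
apply: (@ccvgM R _ _ _ (fun=> k) (series (u : nat -> R[i]^o))); first exact: ccvg_cst.
exact: csum_cvg.
Qed.

Lemma jacobi_coef0 a lam n : jacobi_coef a lam 0 n = (- (lam ^+ 2 / 4)) ^+ n / (poch (a + 1) n * n`!%:R)%:C.
Proof.
rewrite /jacobi_coef; congr (_ / _); under eq_bigr do rewrite mul0r expr0n rmorph0 add0r.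
by rewrite prodr_const card_ord [RHS]exprNn.
Qed.

Lemma jacobi_coef0_summable a lam s : - 2^-1 < a ->
  csummable (fun n => jacobi_coef a lam 0 n * (s ^+ n)%:C).
Proof.
move=> ha; apply: (csummable_le (M := fun n => jacobi_coef_bound a (normc (lam ^+ 2 / 4)) 0 n * `|s| ^+ n)).
  by move=> n; apply: normc_cpseries_term_le => //; exact: normc_jacobi_coef_le.
by apply: jacobi_coef_bound_summable; rewrite ?normc_ge0// expr0n mul0r invr_ge0.
Qed.

(** By [Gamma_poch], Gamma (a + 1 + n) is Gamma (a + 1) times a Pochhammer symbol, and the prefactor
    of [bessel_j] cancels Gamma (a + 1). *)
Lemma bessel_jE a lam x : - 2^-1 < a ->
  bessel_j a (lam * x%:C) = cpseries (jacobi_coef a lam 0) (x ^+ 2).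
Proof.
move=> ha; have a1 : 0 < a + 1 by lra.
have G0 := Gamma_gt0 a1.
have GC0 : (Gamma (a + 1))%:C != 0 :> R[i] by rewrite -(rmorph0 (real_complex R)) (inj_eq (@complexI R)) gt_eqF.
rewrite /bessel_j /cpseries.
have -> : (fun m => (-1) ^+ m / (m`!%:R * (Gamma (a + 1 + m%:R))%:C) * (lam * x%:C / 2) ^+ (2 * m)) =
    (fun n => (Gamma (a + 1))%:C^-1 * (jacobi_coef a lam 0 n * ((x ^+ 2) ^+ n)%:C)).
  apply/funext => n; rewrite Gamma_poch// jacobi_coef0.
  have h1 : (poch (a + 1) n)%:C != 0 :> R[i].
    by rewrite -(rmorph0 (real_complex R)) (inj_eq (@complexI R)) gt_eqF// poch_gt0.
  have h2 : (n`!%:R : R[i]) != 0 by rewrite pnatr_eq0 -lt0n fact_gt0.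
  rewrite !rmorphM /= !rmorphXn /= rmorph_nat [(- (lam ^+ 2 / 4)) ^+ n]exprNn exprM.
  have -> : (lam * x%:C / 2) ^+ 2 = (lam ^+ 2 / 4) * x%:C ^+ 2 by field; rewrite ?pnatr_eq0.
  rewrite [(_ * x%:C ^+ 2) ^+ n]exprMn.
  set p := (lam ^+ 2 / 4) ^+ n; set q := (x%:C ^+ 2) ^+ n; set s := (-1) ^+ n.
  move: (n`!%:R) h2 => f h2; move: (poch _ _)%:C h1 => P h1; move: (Gamma _)%:C GC0 => G GC0.
  by field; rewrite ?h1 ?h2 ?GC0.
by rewrite csumZ ?mulVKf//; exact: jacobi_coef0_summable.
Qed.

(** At [eps = 0] every [sinhc] factor is 1, and 2 / (4 (a + 1)) is the constant 1 / (2 (a + 1)) of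
    the Dunkl kernel. *)
Lemma dunkl_EE a lam x : - 2^-1 < a -> dunkl_E a lam x = opdam_scaled a lam 0 x.
Proof.
move=> ha; have ha1 : - 2^-1 < a + 1 by lra.
rewrite /dunkl_E !bessel_jE// /opdam_scaled !mul0r !mulr0 !mul0r {1}rmorph0 add0r.
have -> : sinhc 0 = 1 :> R by rewrite /sinhc eqxx.
rewrite !mulr1; congr (_ + _ * _).
have h : (a + 1)%:C != 0 :> R[i].
  by rewrite -(rmorph0 (real_complex R)) (inj_eq (@complexI R)) gt_eqF//; lra.
rewrite [(2 * (a + 1))%:C]rmorphM [(4 * (a + 1))%:C]rmorphM [(2 * x)%:C]rmorphM /=.
rewrite !rmorph_nat; move: (a + 1)%:C h => c h.
by field; rewrite ?h ?pnatr_eq0.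
Qed.

End dunkl_kernel_as_limit.

(** * Recursions for Cauchy products of 0F1 series *)

Section convolution.
Context {R : realType}.
Implicit Types (c d X Y : R).

Definition term0F1 c X n : R := X ^+ n / (n`!%:R * poch c n).

Definition conv0F1 c d X Y n : R := \sum_(i < n.+1) term0F1 c X i * term0F1 d Y (n - i)%N.

Let factn0 n : (n`!%:R : R) != 0. Proof. by rewrite pnatr_eq0 -lt0n fact_gt0. Qed.

(** Termwise form of the derivative: X d/dX maps 0F1(c; X) to X / c times 0F1(c + 1; X). *)
Lemma term0F1S c X n : 0 < c -> n.+1%:R * term0F1 c X n.+1 = X / c * term0F1 (c + 1) X n.
Proof.
move=> c0; rewrite /term0F1 pochSl factS natrM exprS.
have h1 : poch (c + 1) n != 0 by rewrite gt_eqF// poch_gt0// addr_gt0.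
have h2 : (n.+1%:R : R) != 0 by rewrite pnatr_eq0.
have h3 : c != 0 by rewrite gt_eqF.
have h4 := factn0 n.
by move: (n.+1%:R) h2 => m h2; field; rewrite ?h1 ?h2 ?h3 ?h4.
Qed.

(** Termwise form of the differential equation D (D + c - 1) F = X F of F = 0F1(c; X), where D = X
    d/dX. *)
Lemma term0F1_rec c X n : 0 < c -> n.+1%:R * (c + n%:R) * term0F1 c X n.+1 = X * term0F1 c X n.
Proof.
move=> c0; rewrite /term0F1 pochS factS natrM exprS.
have h1 : poch c n != 0 by rewrite gt_eqF// poch_gt0.
have h2 : (n.+1%:R : R) != 0 by rewrite pnatr_eq0.
have h3 : c + n%:R != 0 by rewrite gt_eqF// ltr_wpDr.
have h4 := factn0 n.
by move: (n.+1%:R) h2 => m h2; field; rewrite ?h1 ?h2 ?h3 ?h4.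
Qed.

(** Termwise form of (D + c) 0F1(c + 1; X) = c 0F1(c; X), where D = X d/dX. *)
Lemma term0F1_shift c X n : 0 < c -> (c + n%:R) * term0F1 (c + 1) X n = c * term0F1 c X n.
Proof.
move=> c0; rewrite /term0F1.
have E : c * poch (c + 1) n = poch c n * (c + n%:R) by rewrite -pochSl pochS.
have h1 : poch c n != 0 by rewrite gt_eqF// poch_gt0.
have h2 : poch (c + 1) n != 0 by rewrite gt_eqF// poch_gt0// addr_gt0.
have h4 := factn0 n.
apply: (mulIf h1); apply: (mulIf h2); apply: (mulIf h4).
transitivity (X ^+ n * (poch c n * (c + n%:R))).
  by field; rewrite ?h1 ?h2 ?h4.
by rewrite -E; field; rewrite ?h1 ?h2 ?h4.
Qed.

Lemma conv0F1C c d X Y n : conv0F1 c d X Y n = conv0F1 d c Y X n.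
Proof.
rewrite /conv0F1 (reindex_inj rev_ord_inj) /=; apply: eq_bigr => i _.
by rewrite subSS subKn 1?mulrC// -ltnS.
Qed.

Lemma conv0F1_weight_left c d X Y n : 0 < c ->
  \sum_(i < n.+2) i%:R * (term0F1 c X i * term0F1 d Y (n.+1 - i)%N) = X / c * conv0F1 (c + 1) d X Y n.
Proof.
move=> c0; rewrite big_ord_recl mul0r add0r /conv0F1 mulr_sumr; apply: eq_bigr => i _.
by rewrite lift0 subSS mulrA term0F1S// mulrA.
Qed.

Lemma conv0F1_weight_right c d X Y n : 0 < d ->
  \sum_(i < n.+2) (n.+1 - i)%N%:R * (term0F1 c X i * term0F1 d Y (n.+1 - i)%N) = Y / d * conv0F1 c (d + 1) X Y n.
Proof.
move=> d0; rewrite conv0F1C -conv0F1_weight_left// (reindex_inj rev_ord_inj) /=; apply: eq_bigr => i _.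
by rewrite subSS subKn 1?[term0F1 c X _ * _]mulrC// -ltnS.
Qed.

(** For indices i + j = n + 2 the prefactor is i (c + i - 1) + j (c + j - 1) + 2 i j. The first two
    summands reproduce [X] and [Y] by the differential equation; in the cross term each index lowers
    the degree by one and raises the parameter by one. *)
Lemma conv0F1_rec c X Y n : 0 < c ->
  n.+2%:R * (c + n.+1%:R) * conv0F1 c c X Y n.+2 =
  (X + Y) * conv0F1 c c X Y n.+1 + 2 * X * Y / c ^+ 2 * conv0F1 (c + 1) (c + 1) X Y n.
Proof.
move=> c0.
pose A U V := \sum_(i < n.+3) i%:R * (c + i%:R - 1) * (term0F1 c U i * term0F1 c V (n.+2 - i)%N).
pose B := \sum_(i < n.+3) (n.+2 - i)%N%:R * (c + (n.+2 - i)%N%:R - 1) * (term0F1 c X i * term0F1 c Y (n.+2 - i)%N).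
pose D := \sum_(i < n.+3) i%:R * (n.+2 - i)%N%:R * (term0F1 c X i * term0F1 c Y (n.+2 - i)%N).
have hA U V : A U V = U * conv0F1 c c U V n.+1.
  rewrite /A big_ord_recl !mul0r add0r /conv0F1 mulr_sumr; apply: eq_bigr => i _.
  rewrite lift0 subSS mulrA [RHS]mulrA -term0F1_rec//; congr (_ * _ * _ * _).
  by rewrite -natr1; ring.
have hB : B = Y * conv0F1 c c X Y n.+1.
  rewrite conv0F1C -hA /A /B (reindex_inj rev_ord_inj) /=; apply: eq_bigr => i _.
  by rewrite subSS subKn 1?[term0F1 c X _ * _]mulrC// -ltnS.
have hD : D = X * Y / c ^+ 2 * conv0F1 (c + 1) (c + 1) X Y n.
  rewrite /D big_ord_recl !mul0r add0r.
  rewrite big_ord_recr /= /bump /= ?add1n subnn mulr0 !mul0r addr0 /conv0F1 mulr_sumr; apply: eq_bigr => i _.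
  rewrite /bump /= ?add1n subSS subSn; last by rewrite -ltnS.
  rewrite mulrACA term0F1S// term0F1S//; field; rewrite gt_eqF//.
have -> : n.+2%:R * (c + n.+1%:R) * conv0F1 c c X Y n.+2 = A X Y + B + 2 * D.
  rewrite /A /B /D /conv0F1 !mulr_sumr -!big_split /=; apply: eq_bigr => i _.
  have iN : (i <= n.+2)%N by rewrite -ltnS.
  rewrite natrB// -[n.+2%:R]natr1; ring.
by rewrite hA hB hD; field; rewrite gt_eqF.
Qed.

Lemma term0F1_0 c X : term0F1 c X 0 = 1.
Proof. by rewrite /term0F1 poch0 expr0 fact0 mulr1 divr1. Qed.

Lemma term0F1_1 c X : term0F1 c X 1 = X / c.
Proof. by rewrite /term0F1 pochS poch0 expr1 mul1r addr0 factS fact0 mul1r. Qed.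

Lemma conv0F1_0 c d X Y : conv0F1 c d X Y 0 = 1.
Proof. by rewrite /conv0F1 big_ord1 !term0F1_0 mulr1. Qed.

Lemma conv0F1_1 c X Y : conv0F1 c c X Y 1 = (X + Y) / c.
Proof.
by rewrite /conv0F1 big_ord_recl big_ord1 lift0 /= subn0 subnn !term0F1_0 !term0F1_1 mul1r mulr1 -mulrDl addrC.
Qed.

(** This combines the two mixed products in the odd part of a product of Dunkl kernels. For i + j =
    n + 1, write c + n + 1 = (c + i) + j: the first summand lowers the parameter c + 1 to [c], the
    second raises the other one. Then x y^2 + y x^2 = x y (x + y) brings out the common factor x +
    y. *)
Lemma conv0F1_odd c x y n : 0 < c ->
  (c + n.+1%:R) * (x * conv0F1 (c + 1) c (x ^+ 2) (y ^+ 2) n.+1 + y * conv0F1 c (c + 1) (x ^+ 2) (y ^+ 2) n.+1) =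
  c * (x + y) * (conv0F1 c c (x ^+ 2) (y ^+ 2) n.+1
     + x * y / c ^+ 2 * conv0F1 (c + 1) (c + 1) (x ^+ 2) (y ^+ 2) n).
Proof.
move=> c0; set X := x ^+ 2; set Y := y ^+ 2.
have h1 : (c + n.+1%:R) * conv0F1 (c + 1) c X Y n.+1 = c * conv0F1 c c X Y n.+1 + Y / c * conv0F1 (c + 1) (c + 1) X Y n.
  rewrite -conv0F1_weight_right// /conv0F1 !mulr_sumr -big_split /=; apply: eq_bigr => i _.
  have iN : (i <= n.+1)%N by rewrite -ltnS.
  rewrite [c * (_ * _)]mulrA -term0F1_shift// natrB//; ring.
have h2 : (c + n.+1%:R) * conv0F1 c (c + 1) X Y n.+1 = c * conv0F1 c c X Y n.+1 + X / c * conv0F1 (c + 1) (c + 1) X Y n.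
  rewrite -conv0F1_weight_left// /conv0F1 !mulr_sumr -big_split /=; apply: eq_bigr => i _.
  have iN : (i <= n.+1)%N by rewrite -ltnS.
  rewrite [c * (_ * _)]mulrCA -term0F1_shift// natrB//; ring.
rewrite mulrDr ![(c + _) * (_ * _)]mulrCA h1 h2 /X /Y; field; rewrite gt_eqF//.
Qed.

End convolution.

(** * Moments of the ultraspherical weight *)

Section ultraspherical_moments.
Context {R : realType}.
Local Notation mu := (@lebesgue_measure R).
Implicit Types (a b t : R) (p q : {poly R}).

Definition ultra_weight a t : R := (1 - t ^+ 2) `^ (a - 2^-1).

Definition ultra_mean a p : R := M_const a * \int[mu]_(t in `]-1, 1[) (p.[t] * ultra_weight a t).

Lemma ultra_weight_ge0 a t : 0 <= ultra_weight a t. Proof. exact: powR_ge0. Qed.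

Lemma measurable_ultra_weight a : measurable_fun setT (ultra_weight a).
Proof.
apply: measurableT_comp (measurable_powR _) _.
by apply: measurable_funB => //; exact: measurable_funX.
Qed.

Lemma integral_ultra_weight a : - 2^-1 < a ->
  (\int[mu]_(t in `](-1)%R, 1%R[) (ultra_weight a t)%:E = (M_const a)^-1%:E)%E.
Proof.
move=> ha; rewrite /ultra_weight beta_half; last by lra.
have -> : a - 2^-1 + 1 + 2^-1 = a + 1 by ring.
have -> : a - 2^-1 + 1 = a + 2^-1 by field.
by rewrite /M_const invf_div.
Qed.

Lemma M_const_gt0 a : - 2^-1 < a -> 0 < M_const a.
Proof.
move=> ha; rewrite /M_const divr_gt0 ?mulr_gt0 ?sqrtr_gt0 ?pi_gt0 ?Gamma_gt0//; lra.
Qed.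

Lemma M_constS a : - 2^-1 < a -> M_const a = (a + 2^-1) / (a + 1) * M_const (a + 1).
Proof.
move=> ha; rewrite /M_const.
have h1 : 0 < a + 1 by lra.
have h2 : 0 < a + 2^-1 by lra.
rewrite (GammaS h1).
have -> : a + 1 + 2^-1 = a + 2^-1 + 1 by ring.
rewrite (GammaS h2).
have g1 : Gamma (a + 2^-1) != 0 by rewrite gt_eqF// Gamma_gt0.
have p0 : Num.sqrt pi != 0 :> R by rewrite gt_eqF// sqrtr_gt0 pi_gt0.
by field; rewrite ?g1 ?p0 ?andbT/=; apply/andP; split; lra.
Qed.

Lemma horner_bounded p : exists2 B, 0 <= B & forall t, -1 < t < 1 -> `|p.[t]| <= B.
Proof.
elim/poly_ind: p => [|p c [B B0 HB]]; first by exists 0 => // t _; rewrite horner0 normr0.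
exists (B + `|c|); first by rewrite addr_ge0.
move=> t t1; rewrite hornerMXaddC (le_trans (ler_normD _ _))// lerD2r normrM.
rewrite -[B]mulr1 ler_pM ?HB// ltW// ltr_norml//.
Qed.

Lemma measurable_horner p : measurable_fun setT (horner p).
Proof.
elim/poly_ind: p => [|p c IH].
  by rewrite (_ : horner 0 = cst 0)//; apply/funext => t; rewrite horner0.
rewrite (_ : horner _ = fun t => p.[t] * t + c); last by apply/funext => t; rewrite hornerMXaddC.
by apply: measurable_funD => //; apply: measurable_funM.
Qed.

Lemma integrable_ultra_weight a : - 2^-1 < a -> mu.-integrable `]-1, 1[ (EFin \o ultra_weight a).
Proof.
move=> ha; apply/integrableP; split.
  by apply/measurable_EFinP/measurable_funTS; exact: measurable_ultra_weight.
under eq_integral do rewrite /= ger0_norm ?ultra_weight_ge0//.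
by rewrite integral_ultra_weight// ltry.
Qed.

Lemma integrable_horner_ultra_weight a p : - 2^-1 < a ->
  mu.-integrable `]-1, 1[ (EFin \o (fun t => p.[t] * ultra_weight a t)).
Proof.
move=> ha; have [B B0 HB] := horner_bounded p.
have iB : mu.-integrable `]-1, 1[ (EFin \o (fun t => B * ultra_weight a t)).
  by apply: (integrableZl _ B (integrable_ultra_weight ha)).
apply: (le_integrable _ _ _ iB) => //.
  apply/measurable_EFinP/measurable_funTS; apply: measurable_funM; [exact: measurable_horner|exact: measurable_ultra_weight].
move=> t /=; rewrite in_itv/= => /HB tB.
rewrite /= lee_fin !normrM [X in _ <= _ * X]ger0_norm ?ultra_weight_ge0// [X in _ * X <= _]ger0_norm ?ultra_weight_ge0//.
by rewrite ler_wpM2r ?ultra_weight_ge0// (ger0_norm B0).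
Qed.

Lemma ultra_meanD a p q : - 2^-1 < a -> ultra_mean a (p + q) = ultra_mean a p + ultra_mean a q.
Proof.
move=> ha; rewrite /ultra_mean -mulrDr -RintegralD//; last 2 first.
- exact: integrable_horner_ultra_weight.
- exact: integrable_horner_ultra_weight.
by congr (_ * _); apply: eq_Rintegral => t _; rewrite hornerD mulrDl.
Qed.

Lemma ultra_meanZ a k p : - 2^-1 < a -> ultra_mean a (k *: p) = k * ultra_mean a p.
Proof.
move=> ha; rewrite /ultra_mean [RHS]mulrCA; congr (_ * _).
rewrite -RintegralZl//; last exact: integrable_horner_ultra_weight.
by apply: eq_Rintegral => t _; rewrite hornerZ mulrA.
Qed.

Lemma ultra_mean0 a : - 2^-1 < a -> ultra_mean a 0 = 0.
Proof. by move=> ha; rewrite -(scale0r (0 : {poly R})) ultra_meanZ// mul0r. Qed.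

Lemma ultra_mean1 a : - 2^-1 < a -> ultra_mean a 1 = 1.
Proof.
move=> ha; rewrite /ultra_mean (_ : \int[mu]_(t in `]-1, 1[) _ = \int[mu]_(t in `]-1, 1[) ultra_weight a t); last first.
  by apply: eq_Rintegral => t _; rewrite hornerC mul1r.
by rewrite /Rintegral integral_ultra_weight//= mulfV// gt_eqF// M_const_gt0.
Qed.

Lemma ultra_meanX a : - 2^-1 < a -> ultra_mean a 'X = 0.
Proof.
move=> ha; apply/eqP; rewrite /ultra_mean mulf_eq0 (gt_eqF (M_const_gt0 ha))/=.
suff : \int[mu]_(t in `]-1, 1[) ('X.[t] * ultra_weight a t) = - \int[mu]_(t in `]-1, 1[) ('X.[t] * ultra_weight a t).
  by move=> /eqP; rewrite -addr_eq0 -mulr2n mulrn_eq0.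
have i := integrable_horner_ultra_weight 'X ha.
rewrite [LHS]Rintegral_mkcond [in RHS]Rintegral_mkcond.
have ir : mu.-integrable setT (EFin \o ((fun t => 'X.[t] * ultra_weight a t) \_ `]-1, 1[)).
  by rewrite -restrict_EFin; apply/(integrable_mkcond _ _).1.
rewrite [LHS](Rintegral_reflect ir) -[RHS]mulN1r -RintegralZl//.
apply: eq_Rintegral => t _; rewrite !patchE !mem_setE !in_itv/= ltrNl opprK ltrNl andbC.
by case: ifP; rewrite ?mulr0// !hornerX /ultra_weight sqrrN mulN1r mulNr.
Qed.

(** Write t^2 = 1 - (1 - t^2): the factor 1 - t^2 raises the parameter of the weight by one, and
    [M_constS] accounts for the change of normalization. *)
Lemma ultra_meanXX a p : - 2^-1 < a ->
  ultra_mean a ('X ^+ 2 * p) = ultra_mean a p - (a + 2^-1) / (a + 1) * ultra_mean (a + 1) p.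
Proof.
move=> ha; have ha1 : - 2^-1 < a + 1 by lra.
rewrite /ultra_mean {1 2}(M_constS ha) -!mulrA -!mulrBr -RintegralB//; last 2 first.
- exact: integrable_horner_ultra_weight.
- exact: integrable_horner_ultra_weight.
do 4 congr (_ * _); apply: eq_Rintegral => t; rewrite inE /= in_itv/= => t1.
rewrite !hornerM hornerX.
have t2 : 0 < 1 - t ^+ 2.
  by rewrite subr_gt0 -real_normK ?num_real// expr_lt1// ltr_norml.
have -> : ultra_weight (a + 1) t = (1 - t ^+ 2) * ultra_weight a t.
  rewrite /ultra_weight; have -> : a + 1 - 2^-1 = 1 + (a - 2^-1) by ring.
  have c : (1 + (a - 2^-1) == 0) ==> (1 - t ^+ 2 != 0) by rewrite (gt_eqF t2) implybT.
  by rewrite (powRD c) (powRr1 (ltW t2)).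
ring.
Qed.

(** This is integration by parts, t (1 - t^2)^(a - 1/2) being the derivative of - (1 - t^2)^(a +
    1/2) / (2 a + 1). It is obtained without boundary terms by induction on the degree, in steps of
    two from 1 and X. The induction treats all parameters at once, because [ultra_meanXX] links [a]
    with a + 1. *)
Lemma ultra_meanX_deriv a p : - 2^-1 < a -> ultra_mean a ('X * p) = ultra_mean (a + 1) p^`() / (2 * (a + 1)).
Proof.
pose P q := forall a, - 2^-1 < a -> ultra_mean a ('X * q) = ultra_mean (a + 1) q^`() / (2 * (a + 1)).
have PD q r : P q -> P r -> P (q + r).
  move=> hq hr b hb; have hb1 : - 2^-1 < b + 1 by lra.
  by rewrite mulrDr derivD !ultra_meanD// hq// hr// [RHS]mulrDl.
have PZ k q : P q -> P (k *: q).
  move=> hq b hb; have hb1 : - 2^-1 < b + 1 by lra.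
  by rewrite -scalerAr derivZ !ultra_meanZ// hq// mulrA.
have P0 : P 1.
  move=> b hb; have hb1 : - 2^-1 < b + 1 by lra.
  by rewrite mulr1 derivC ultra_meanX// ultra_mean0// mul0r.
have P1 : P 'X.
  move=> b hb; have hb1 : - 2^-1 < b + 1 by lra.
  rewrite -expr2 -[_ ^+ 2]mulr1 ultra_meanXX// derivX !ultra_mean1//; field; lra.
have PXX q : P q -> P ('X ^+ 2 * q).
  move=> hq b hb; have hb1 : - 2^-1 < b + 1 by lra.
  have hb2 : - 2^-1 < b + 1 + 1 by lra.
  have E : ('X ^+ 2 * q)^`() = 2 *: ('X * q) + 'X ^+ 2 * q^`().
    by rewrite derivM derivXn /= expr1 mulrnAl -scaler_nat.
  rewrite mulrCA ultra_meanXX// !hq// E ultra_meanD// ultra_meanZ// ultra_meanXX// hq//.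
  field; apply/andP; split; lra.
have PXn n : P ('X ^+ n) /\ P ('X ^+ n.+1).
  elim: n => [|n [IH1 IH2]]; first by rewrite expr0 expr1.
  by split=> //; rewrite -addn2 exprD mulrC; exact: PXX.
have : P p.
  rewrite -[p]coefK poly_def; elim/big_ind: _ => //; last by move=> i _; apply: PZ; case: (PXn i).
  move=> b hb; have hb1 : - 2^-1 < b + 1 by lra.
  by rewrite mulr0 -{2}polyC0 derivC !ultra_mean0// mul0r.
exact.
Qed.

(* [x ^+ 2 + y ^+ 2 + 2 * x * y * t] is the square [z ^+ 2] of the third side
   of the triangle. *)
Definition z2poly x y : {poly R} := (x ^+ 2 + y ^+ 2)%:P + (2 * x * y) *: 'X.

Lemma deriv_z2polyX x y n :
  ((z2poly x y) ^+ n.+1)^`() = (n.+1%:R * (2 * x * y)) *: (z2poly x y) ^+ n.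
Proof.
rewrite deriv_exp /= /z2poly derivD derivC derivZ derivX add0r.
by rewrite -scalerAl mul1r -scaler_nat scalerA.
Qed.

Lemma ultra_meanX_z2poly a x y n : - 2^-1 < a ->
  ultra_mean a ('X * z2poly x y ^+ n.+1) = n.+1%:R * (x * y) / (a + 1) * ultra_mean (a + 1) (z2poly x y ^+ n).
Proof.
move=> ha; have ha1 : - 2^-1 < a + 1 by lra.
rewrite ultra_meanX_deriv// deriv_z2polyX ultra_meanZ//; field; lra.
Qed.

(** Coefficient form of Gegenbauer's product formula for j_a. Splitting off one factor x^2 + y^2 + 2
    x y t leaves a mean containing t, which [ultra_meanX_z2poly] trades for a lower degree at
    parameter a + 1, as in [conv0F1_rec]. *)
Lemma ultra_mean_z2poly a x y n : - 2^-1 < a ->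
  ultra_mean a (z2poly x y ^+ n) = n`!%:R * poch (a + 1) n * conv0F1 (a + 1) (a + 1) (x ^+ 2) (y ^+ 2) n.
Proof.
elim/ltn_ind: n a => -[|[|n]] IH a ha.
- by rewrite expr0 ultra_mean1// poch0 conv0F1_0 !mulr1.
- rewrite expr1 /z2poly ultra_meanD// ultra_meanZ// ultra_meanX// -[_%:P]alg_polyC ultra_meanZ// ultra_mean1//.
  rewrite pochS poch0 conv0F1_1 mulr1 mulr0 !addr0 !mul1r mulrC divfK//; lra.
have ha1 : - 2^-1 < a + 1 by lra.
have c0 : 0 < a + 1 by lra.
rewrite exprS {1}/z2poly mulrDl ultra_meanD// -scalerAl ultra_meanZ// ultra_meanX_z2poly// mul_polyC ultra_meanZ//.
rewrite !IH//.
have h1 : poch (a + 1) n.+1 = (a + 1) * poch (a + 1 + 1) n by rewrite pochSl.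
have h2 : poch (a + 1) n.+2 = (a + 1) * poch (a + 1 + 1) n * (a + 1 + n.+1%:R) by rewrite pochS h1.
rewrite h2 h1 !factS !natrM.
transitivity (n`!%:R * n.+1%:R * ((a + 1) * poch (a + 1 + 1) n) *
  (n.+2%:R * (a + 1 + n.+1%:R) * conv0F1 (a + 1) (a + 1) (x ^+ 2) (y ^+ 2) n.+2)); last by ring.
rewrite conv0F1_rec//; field; lra.
Qed.

(** It will turn out to be the moment of order 2 n in z of [dweight a x y] and, up to the factor x +
    y, the one of order 2 n + 1; the factor 1 + t comes from the kernel. *)
Definition dunkl_moment a x y n : R := ultra_mean a (z2poly x y ^+ n * (1 + 'X)).

Lemma dunkl_momentS a x y n : - 2^-1 < a ->
  dunkl_moment a x y n.+1 = n.+1`!%:R * poch (a + 1) n.+1 * (conv0F1 (a + 1) (a + 1) (x ^+ 2) (y ^+ 2) n.+1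
    + x * y / (a + 1) ^+ 2 * conv0F1 (a + 1 + 1) (a + 1 + 1) (x ^+ 2) (y ^+ 2) n).
Proof.
move=> ha; have ha1 : - 2^-1 < a + 1 by lra.
rewrite /dunkl_moment mulrDr mulr1 ultra_meanD// [_ * 'X]mulrC ultra_meanX_z2poly// !ultra_mean_z2poly//.
rewrite pochSl factS natrM; field; lra.
Qed.

Lemma dunkl_moment0 a x y : - 2^-1 < a -> dunkl_moment a x y 0 = 1.
Proof. by move=> ha; rewrite /dunkl_moment expr0 mul1r ultra_meanD// ultra_mean1// ultra_meanX// addr0. Qed.

End ultraspherical_moments.

(** * Cauchy products of absolutely convergent complex series *)

Section cauchy_product.
Context {R : realType}.

Lemma sum_triangle (V : nmodType) (F : nat -> nat -> V) N :
  \sum_(0 <= n < N) \sum_(i < n.+1) F i (n - i)%N =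
  \sum_(0 <= i < N) \sum_(0 <= j < N - i) F i j.
Proof.
elim: N => [|N IH]; first by rewrite !big_nil.
rewrite big_nat_recr//= IH [RHS]big_nat_recr//= subSnn big_nat1.
have -> : \sum_(0 <= i < N) \sum_(0 <= j < N.+1 - i) F i j =
    \sum_(0 <= i < N) (\sum_(0 <= j < N - i) F i j + F i (N - i)%N).
  by apply: eq_big_nat => i /andP[_ iN]; rewrite subSn ?(ltnW iN)// big_nat_recr.
rewrite big_split /= -addrA; congr (_ + _).
by rewrite big_ord_recr /= subnn big_mkord.
Qed.

Lemma ccvg0 (D : nat -> R[i]) (d : nat -> R) : (forall n, normc (D n) <= d n) ->
  d @ \oo --> (0 : R) -> D @ \oo --> (0 : R[i]^o).
Proof.
move=> Dd d0; have dN0 : - d n @[n --> \oo] --> (0 : R) by rewrite -oppr0; exact: cvgN.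
apply: cvg_complex.
  apply: (squeeze_cvgr _ dN0 d0); apply: nearW => n.
  by rewrite -ler_norml (le_trans (normc_Re _)).
apply: (squeeze_cvgr _ dN0 d0); apply: nearW => n.
by rewrite -ler_norml (le_trans (normc_Im _)).
Qed.

Lemma normc_sum (u : nat -> R[i]) m n :
  normc (\sum_(m <= i < n) u i) <= \sum_(m <= i < n) normc (u i).
Proof.
elim/big_ind2: _ => [|z r w s zr ws|//]; first by rewrite ComplexField.Normc.normc0.
by apply: le_trans (normc_triangle _ _) _; exact: lerD.
Qed.

(** The triangle of size N lies in the square of size N, which lies in the triangle of size 2 N. So
    the nondecreasing triangular sums are bounded by the limit of the square sums and converge to
    it. *)
Lemma cauchy_product_ge0 (a b : nat -> R) : (forall n, 0 <= a n) -> (forall n, 0 <= b n) ->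
  cvgn (series a) -> cvgn (series b) ->
  (series a N * series b N - \sum_(0 <= i < N) \sum_(0 <= j < N - i) a i * b j) @[N --> \oo] --> (0 : R).
Proof.
move=> a0 b0 ca cb.
pose P N := \sum_(0 <= i < N) \sum_(0 <= j < N - i) a i * b j.
have ab0 i j : 0 <= a i * b j by rewrite mulr_ge0.
have mono (F : nat -> R) m n : (forall i, 0 <= F i) -> (m <= n)%N ->
    \sum_(0 <= i < m) F i <= \sum_(0 <= i < n) F i.
  by move=> F0 mn; rewrite [leRHS](@big_cat_nat _ _ _ m)//= lerDl sumr_ge0.
have SE N : series a N * series b N = \sum_(0 <= i < N) \sum_(0 <= j < N) a i * b j.
  by rewrite /series /= mulr_suml; apply: eq_bigr => i _; rewrite mulr_sumr.
have PS N : P N <= series a N * series b N.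
  by rewrite SE; apply: ler_sum => i _; apply: mono => //; exact: leq_subr.
have SP N : series a N * series b N <= P (N + N)%N.
  rewrite SE; apply: (@le_trans _ _ (\sum_(0 <= i < N) \sum_(0 <= j < N + N - i) a i * b j)).
    rewrite !big_mkord; apply: ler_sum => i _; apply: mono => //.
    by rewrite -addnBA ?leq_addr// ltnW.
  by apply: mono (leq_addl _ _) => i; exact: sumr_ge0.
have ndP : nondecreasing_seq P.
  move=> m n mn; rewrite /P; apply: (@le_trans _ _ (\sum_(0 <= i < m) \sum_(0 <= j < n - i) a i * b j)).
    by apply: ler_sum => i _; apply: mono => //; exact: leq_sub2r.
  by apply: mono mn => i; exact: sumr_ge0.
have cab : series a N * series b N @[N --> \oo] --> limn (series a) * limn (series b) by exact: cvgM.
have Pub N : P N <= limn (series a) * limn (series b).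
  apply: le_trans (PS N) _; apply: ler_pM; rewrite ?sumr_ge0//;
    by apply: nondecreasing_cvgn_le => //; apply: nondecreasing_series.
have cP : cvgn P by apply: nondecreasing_is_cvgn => //; exists (limn (series a) * limn (series b)) => _ [n _ <-].
have PE : limn P = limn (series a) * limn (series b).
  apply/eqP; rewrite eq_le; apply/andP; split.
    by apply: limr_le => //; exact: nearW.
  apply: (cvgr_to_le cab); apply: nearW => N; apply: le_trans (SP N) _.
  exact: nondecreasing_cvgn_le.
by have := cvgB cab cP; rewrite PE subrr; exact.
Qed.

(* For nonnegative terms the partial sums over the triangle [i + j < N] and
   over the square have the same limit; the difference for complex terms is
   dominated by the difference for their moduli. *)
Lemma cauchy_product (u v : nat -> R[i]) : csummable u -> csummable v ->
  series (fun n => \sum_(i < n.+1) u i * v (n - i)%N : R[i]^o) @ \oo --> (csum u * csum v : R[i]^o).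
Proof.
move=> su sv.
pose a n := normc (u n); pose b n := normc (v n).
pose T N : R[i] := \sum_(0 <= i < N) \sum_(0 <= j < N - i) u i * v j.
have sE N : series (fun n => \sum_(i < n.+1) u i * v (n - i)%N : R[i]^o) N = T N.
  by rewrite /series /= (sum_triangle (fun i j => u i * v j)).
rewrite (funext sE).
pose S N : R[i] := series (u : nat -> R[i]^o) N * series (v : nat -> R[i]^o) N.
have cS : S @ \oo --> (csum u * csum v : R[i]^o) by apply: ccvgM; exact: csum_cvg.
have cD : (fun N => T N - S N) @ \oo --> (0 : R[i]^o).
  apply: (ccvg0 _ (cauchy_product_ge0 (a := a) (b := b) _ _ su sv)) => [N|n|n]; last 2 first.
  - exact: normc_ge0.
  - exact: normc_ge0.
  have split (V : nmodType) (F : nat -> nat -> V) : \sum_(0 <= i < N) \sum_(0 <= j < N) F i j =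
     \sum_(0 <= i < N) \sum_(0 <= j < N - i) F i j + \sum_(0 <= i < N) \sum_(N - i <= j < N) F i j.
    by rewrite -big_split /=; apply: eq_bigr => i _; rewrite -big_cat_nat// leq_subr.
  have -> : S N = \sum_(0 <= i < N) \sum_(0 <= j < N) u i * v j.
    by rewrite /S /series /= mulr_suml; apply: eq_bigr => i _; rewrite mulr_sumr.
  have -> : series a N * series b N = \sum_(0 <= i < N) \sum_(0 <= j < N) a i * b j.
    by rewrite /series /= mulr_suml; apply: eq_bigr => i _; rewrite mulr_sumr.
  rewrite !split opprD addrA subrr sub0r [leRHS]addrAC subrr add0r normcN.
  apply: le_trans (normc_sum _ _ _) _; apply: ler_sum => i _.
  apply: le_trans (normc_sum _ _ _) _; apply: ler_sum => j _.
  by rewrite ComplexField.Normc.normcM.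
have -> : T = (fun N => (T N - S N) + S N) by apply/funext => N; rewrite subrK.
by rewrite -[csum u * csum v]add0r; apply: ccvgD.
Qed.

End cauchy_product.

(** * The Dunkl weight in the variable t, its envelope and its moments *)

Section dunkl_weight.
Context {R : realType}.
Local Notation mu := (@lebesgue_measure R).
Implicit Types (a x y z t : R).

Lemma powRE (u e : R) : 0 < u -> u `^ e = expR (e * ln u).
Proof. by move=> u0; rewrite /powR gt_eqF. Qed.

Definition lo x y : R := `| `|x| - `|y| |.
Definition hi x y : R := `|x| + `|y|.

(* Cosine of the angle opposite to [z], up to sign. *)
Definition cosz x y z : R := (z ^+ 2 - (x ^+ 2 + y ^+ 2)) / (2 * x * y).

Lemma lo_sqr x y : lo x y ^+ 2 = x ^+ 2 + y ^+ 2 - 2 * `|x * y|.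
Proof. by rewrite /lo real_normK ?num_real// sqrrB !real_normK ?num_real// normrM -mulr_natl; ring. Qed.

Lemma hi_sqr x y : hi x y ^+ 2 = x ^+ 2 + y ^+ 2 + 2 * `|x * y|.
Proof. by rewrite /hi sqrrD !real_normK ?num_real// normrM -mulr_natl; ring. Qed.

Lemma lo_ge0 x y : 0 <= lo x y. Proof. exact: normr_ge0. Qed.

Lemma lo_lt_hi x y : x != 0 -> y != 0 -> lo x y < hi x y.
Proof.
move=> x0 y0; have q0 : 0 < `|x * y| by rewrite normr_gt0 mulf_neq0.
rewrite -(@ltr_pXn2r _ 2)// ?nnegrE ?lo_ge0 ?addr_ge0// lo_sqr hi_sqr; lra.
Qed.

Lemma cosz_norm_lt1 x y z : x != 0 -> y != 0 -> lo x y < `|z| < hi x y -> -1 < cosz x y z < 1.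
Proof.
move=> x0 y0 /andP[h1 h2]; have q0 : 0 < `|x * y| by rewrite normr_gt0 mulf_neq0.
have e1 : lo x y ^+ 2 < z ^+ 2.
  by rewrite -[z ^+ 2]real_normK ?num_real// ltr_pXn2r ?nnegrE ?lo_ge0.
have e2 : z ^+ 2 < hi x y ^+ 2.
  by rewrite -[z ^+ 2]real_normK ?num_real// ltr_pXn2r ?nnegrE// addr_ge0.
rewrite lo_sqr in e1; rewrite hi_sqr in e2.
rewrite -ltr_norml /cosz normrM normfV ltr_pdivrMr ?mul1r; last by rewrite normr_gt0 !mulf_neq0.
rewrite -mulrA [`|2 * _|]normrM (@ger0_norm _ 2)// ltr_norml; lra.
Qed.

Lemma one_minus_cosz2_gt0 x y z : x != 0 -> y != 0 -> lo x y < `|z| < hi x y ->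
  0 < 1 - cosz x y z ^+ 2.
Proof.
move=> x0 y0 h; have := cosz_norm_lt1 x0 y0 h => T1.
by rewrite subr_gt0 -real_normK ?num_real// expr_lt1// ltr_norml.
Qed.

(** Heron's formula: on the support, both sides are 16 times the squared area of the triangle with
    sides |x|, |y|, |z|. It turns the bracket of the kernel into a multiple of 1 - t^2. *)
Lemma heron x y z : x != 0 -> y != 0 ->
  (x + y + z) * (- x + y + z) * (x - y + z) * (x + y - z) =
  (2 * `|x * y|) ^+ 2 * (1 - cosz x y z ^+ 2).
Proof.
by move=> x0 y0; rewrite exprMn real_normK ?num_real// /cosz; field; rewrite ?x0 ?y0.
Qed.

(** The last two factors multiply to z^2 - (x - y)^2 = 2 x y (1 + t). *)
Lemma heron3 x y z : x != 0 -> y != 0 ->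
  (x + y + z) * (- x + y + z) * (x - y + z) = (x + y + z) * (2 * x * y * (1 + cosz x y z)).
Proof. by move=> x0 y0; rewrite /cosz; field; rewrite ?x0 ?y0. Qed.

Definition dweight a x y z : R := dunkl_kernel a x y z * `|z| `^ (2 * a + 1).

Let sgz z : R := if 0 < z then 1 else -1.

Let sgzE z : z != 0 -> z = sgz z * `|z|.
Proof.
rewrite /sgz => z0; case: ltP => h; first by rewrite mul1r gtr0_norm.
by rewrite ler0_norm// mulrNN mul1r.
Qed.

Let sgz2 z : sgz z * sgz z = 1.
Proof. by rewrite /sgz; case: ifP => _; rewrite ?mulr1// mulrNN mulr1. Qed.

(** With t = [cosz x y z], the real powers reduce to the ultraspherical weight. The first factor
    splits into an even part |z|, ready for the substitution since |z| dz is a multiple of dt, and a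
    part that is odd in z. *)
Lemma dweightE a x y z : x != 0 -> y != 0 -> dweight a x y z =
  if lo x y < `|z| < hi x y then
    (`|z| + (if 0 < z then 1 else -1) * (x + y)) * (M_const a / (2 * `|x * y|))
     * ((1 + cosz x y z) * ultra_weight a (cosz x y z))
  else 0.
Proof.
move=> x0 y0; rewrite /dweight /dunkl_kernel /kernel_support x0 y0 /=.
case: (boolP (lo x y < `|z| < hi x y)) => h; last first.
  by rewrite andbF mul0r.
have z0 : z != 0.
  by move: h => /andP[h _]; rewrite -normr_gt0; apply: le_lt_trans h; exact: lo_ge0.
rewrite z0 /=.
rewrite heron// heron3// -/(sgz z).
set q := `|x * y|; have q0 : 0 < q by rewrite normr_gt0 mulf_neq0.
have w0 : 0 < `|z| by rewrite normr_gt0.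
rewrite (powRM _ (sqr_ge0 _)) ?(ltW (one_minus_cosz2_gt0 x0 y0 h))//.
rewrite -[(1 - _) `^ _]/(ultra_weight a (cosz x y z)) [`|x * y * z|]normrM -/q.
set w := `|z| in w0 *.
(* All powers become exponentials, so that exponents are compared linearly: those of 2, [q] and [w]
   add up to -2, -1 and 1. *)
have E : 2 `^ (- 2 * a - 1) * ((2 * q) ^+ 2) `^ (a - 2^-1) / (q * w) `^ (2 * a) * w `^ (2 * a + 1) = w / (4 * q).
  have q2 : 0 < 2 * q by rewrite mulr_gt0.
  rewrite !powRE ?exprn_gt0 ?mulr_gt0// lnXn// !lnM ?posrE//.
  have -> : w / (4 * q) = expR (ln w) / (expR (ln 2) * expR (ln 2) * expR (ln q)).
    by rewrite !lnK ?posrE//; field; rewrite gt_eqF.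
  rewrite -!expRD -!expRN -!expRD; congr expR; rewrite -mulr_natl; by field.
have -> : (x + y + z) * (2 * x * y * (1 + cosz x y z)) / (x * y * z) =
    2 * (1 + cosz x y z) * (w + sgz z * (x + y)) / w.
  rewrite {1}(sgzE z0) -/w [in X in _ / X](sgzE z0) -/w.
  have -> : x + y + sgz z * w = sgz z * (w + sgz z * (x + y)) by rewrite mulrDr mulrA sgz2 mul1r addrC.
  have s0 : sgz z != 0 by rewrite /sgz; case: ifP => _; rewrite ?oppr_eq0 oner_eq0.
  by field; rewrite ?x0 ?y0 ?s0 ?(gt_eqF w0).
transitivity (M_const a * ultra_weight a (cosz x y z) * (2 * (1 + cosz x y z) * (w + sgz z * (x + y)) / w)
  * (2 `^ (- 2 * a - 1) * ((2 * q) ^+ 2) `^ (a - 2^-1) / (q * w) `^ (2 * a) * w `^ (2 * a + 1))).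
  by ring.
by rewrite E; field; rewrite ?(gt_eqF w0) ?(gt_eqF q0).
Qed.

Lemma measurable_if (P : R -> bool) (f : R -> R) : measurable_fun setT P -> measurable_fun setT f ->
  measurable_fun setT (fun z => if P z then f z else 0).
Proof. by move=> mP mf; apply: measurable_fun_ifT. Qed.

Lemma measurable_support x y : measurable_fun setT (fun z : R => lo x y < `|z| < hi x y).
Proof.
apply: measurable_and; apply: measurable_fun_ltr => //; exact: measurableT_comp.
Qed.

Lemma measurable_cosz x y : measurable_fun setT (cosz x y).
Proof.
apply: measurable_funM => //; apply: measurable_funB => //; exact: measurable_funX.
Qed.

Lemma measurable_ultra_weight_cosz a x y : measurable_fun setT (fun z => ultra_weight a (cosz x y z)).
Proof. exact: measurableT_comp (measurable_ultra_weight a) (measurable_cosz x y). Qed.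

Lemma measurable_dweight a x y : x != 0 -> y != 0 -> measurable_fun setT (dweight a x y).
Proof.
move=> x0 y0; rewrite (funext (fun z => dweightE a z x0 y0)).
apply: measurable_if; first exact: measurable_support.
apply: measurable_funM; last first.
  apply: measurable_funM; last exact: measurable_ultra_weight_cosz.
  by apply: measurable_funD => //; exact: measurable_cosz.
apply: measurable_funM => //; apply: measurable_funD; first exact: normr_measurable.
apply: measurable_funM => //; apply: measurable_fun_ifT => //; exact: measurable_fun_ltr.
Qed.

(** Envelope of [dweight] up to a constant: it retains the factor |z| needed for the substitution
    and the singular weight, and drops what is bounded. *)
Definition dmajorant a x y z : R :=
  if lo x y < `|z| < hi x y then `|z| * ultra_weight a (cosz x y z) else 0.

Lemma measurable_dmajorant a x y : measurable_fun setT (dmajorant a x y).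
Proof.
apply: measurable_if; first exact: measurable_support.
by apply: measurable_funM; [exact: normr_measurable|exact: measurable_ultra_weight_cosz].
Qed.

Lemma dmajorant_ge0 a x y z : 0 <= dmajorant a x y z.
Proof. by rewrite /dmajorant; case: ifP => // _; rewrite mulr_ge0 ?ultra_weight_ge0. Qed.

(** The critical term is |x + y| (1 + t), which has no visible factor |z|. If x y > 0, then 2 |x y|
    (1 + t) = z^2 - (x - y)^2 is at most z^2, hence at most |z| times [hi x y]; if x y < 0, then |x
    + y| = [lo x y] is below |z|. *)
Lemma dweight_le a x y : - 2^-1 < a -> x != 0 -> y != 0 ->
  exists2 B, 0 <= B & forall z, `|dweight a x y z| <= B * dmajorant a x y z.
Proof.
move=> ha x0 y0; set q := `|x * y|; have q0 : 0 < q by rewrite normr_gt0 mulf_neq0.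
pose m := M_const a / (2 * q).
have m0 : 0 < m by rewrite divr_gt0 ?M_const_gt0// mulr_gt0.
exists ((4 + hi x y ^+ 2 / (2 * q)) * m).
  by rewrite mulr_ge0 ?(ltW m0)// addr_ge0// divr_ge0 ?sqr_ge0// mulr_ge0// ltW.
move=> z; rewrite dweightE// /dmajorant; case: ifP => h; last by rewrite normr0 mulr0.
have /andP[T1 T2] := cosz_norm_lt1 x0 y0 h; have /andP[h1 h2] := h.
set T := cosz x y z in T1 T2 *; rewrite -/(sgz z) -/q -/m.
have xyh : `|x + y| <= hi x y by exact: ler_normD.
have w0 : 0 <= `|z| by [].
have key : `|x + y| * (1 + T) <= (2 + hi x y ^+ 2 / (2 * q)) * `|z|.
  have [xy|xy] := leP 0 (x * y).
    have qE : q = x * y by rewrite /q ger0_norm.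
    have TE : (1 + T) * (2 * q) <= `|z| ^+ 2.
      have -> : (1 + T) * (2 * q) = z ^+ 2 - (x - y) ^+ 2.
        by rewrite qE /T /cosz; field; rewrite ?x0 ?y0.
      by rewrite real_normK ?num_real// gerBl sqr_ge0.
    have TE' : 1 + T <= `|z| ^+ 2 / (2 * q) by rewrite ler_pdivlMr// mulr_gt0.
    have hz : `|z| ^+ 2 / (2 * q) <= `|z| * hi x y / (2 * q).
      by rewrite ler_pM2r ?invr_gt0 ?mulr_gt0// expr2 ler_wpM2l// ltW.
    have : `|x + y| * (1 + T) <= hi x y * (`|z| * hi x y / (2 * q)).
      by rewrite ler_pM// ?(le_trans TE')//; lra.
    move=> k; apply: le_trans k _.
    have -> : hi x y * (`|z| * hi x y / (2 * q)) = hi x y ^+ 2 / (2 * q) * `|z| by ring.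
    by rewrite ler_wpM2r// lerDr.
  have xyl : `|x + y| = lo x y.
    apply/eqP; rewrite -(@eqrXn2 _ 2)// ?lo_ge0//.
    by rewrite lo_sqr real_normK ?num_real// (ltr0_norm xy); apply/eqP; ring.
  apply: (@le_trans _ _ (`|z| * 2)); first by rewrite xyl ler_pM ?lo_ge0 ?(ltW h1)//; lra.
  rewrite mulrC ler_wpM2r// lerDl divr_ge0 ?sqr_ge0// mulr_ge0// ltW//.
(* The 4 is the 2 of [key] plus the bound |z| (1 + t) <= 2 |z| for the even part. *)
have k2 : `|(`|z| + sgz z * (x + y)) * (1 + T)| <= (4 + hi x y ^+ 2 / (2 * q)) * `|z|.
  rewrite normrM (@ger0_norm _ (1 + T)); last by lra.
  have n1 : `| `|z| + sgz z * (x + y)| <= `|z| + `|x + y|.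
    apply: le_trans (ler_normD _ _) _; rewrite normr_id lerD2l normrM.
    by rewrite /sgz; case: ifP => _; rewrite ?normrN normr1 mul1r.
  have : `| `|z| + sgz z * (x + y)| * (1 + T) <= (`|z| + `|x + y|) * (1 + T).
    by rewrite ler_wpM2r//; lra.
  move=> k; apply: le_trans k _; rewrite mulrDl.
  have : `|z| * (1 + T) <= `|z| * 2 by rewrite ler_wpM2l//; lra.
  by move: key; rewrite !mulrDl; lra.
have -> : (`|z| + sgz z * (x + y)) * m * ((1 + T) * ultra_weight a T) =
   ((`|z| + sgz z * (x + y)) * (1 + T)) * (m * ultra_weight a T) by ring.
have -> : (4 + hi x y ^+ 2 / (2 * q)) * m * (`|z| * ultra_weight a T) =
   (4 + hi x y ^+ 2 / (2 * q)) * `|z| * (m * ultra_weight a T) by ring.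
rewrite normrM [`|m * _|]ger0_norm; last by rewrite mulr_ge0 ?ultra_weight_ge0// ltW.
by rewrite ler_wpM2r// mulr_ge0 ?ultra_weight_ge0// ltW.
Qed.

Lemma ge0_integral_even_support (h : R -> R) (l u : R) : 0 <= l ->
  measurable_fun setT h -> (forall z, l < z < u -> 0 <= h z) ->
  (\int[mu]_z (if l < `|z| < u then h `|z| else 0)%:E = 2%:E * \int[mu]_(z in `]l, u[) (h z)%:E)%E.
Proof.
move=> l0 mh h0.
pose g z : R := if l < z < u then h z else 0.
have g0 z : (0 <= (g z)%:E)%E by rewrite lee_fin /g; case: ifP => // /h0.
have mg : measurable_fun setT (EFin \o g).
  apply/measurable_EFinP; apply: measurable_if => //.
  by apply: measurable_and; apply: measurable_fun_ltr.
have mgN : measurable_fun setT (fun z => (g (- z))%:E).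
  by apply: (measurableT_comp mg).
have gE : (\int[mu]_(z in `]l, u[) (h z)%:E = \int[mu]_z (g z)%:E)%E.
  rewrite integral_mkcond; apply: eq_integral => z _; rewrite patchE mem_setE in_itv/= /g.
  by case: ifP.
rewrite gE; transitivity (\int[mu]_z ((g z)%:E + (g (- z))%:E))%E.
  apply: eq_integral => z _; rewrite -EFinD /g; congr EFin.
  case: (leP 0 z) => z0.
    rewrite (ger0_norm z0) [X in _ + X](_ : _ = 0) ?addr0//.
    by rewrite ifF//; apply/negbTE; rewrite negb_and -leNgt; apply/orP; left; lra.
  rewrite (ltr0_norm z0) [X in X + _](_ : _ = 0) ?add0r//.
  by rewrite ifF//; apply/negbTE; rewrite negb_and -leNgt; apply/orP; left; lra.
rewrite ge0_integralD//.
rewrite -(ge0_integral_reflect mg)//.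
have -> : 2%:E = (1%:E + 1%:E)%E :> \bar R by rewrite -EFinD.
by rewrite ge0_muleDl ?lee_fin// mul1e.
Qed.

Lemma is_derive_quadratic (A q z : R) : q != 0 ->
  is_derive z (1 : R) (fun u : R => (u ^+ 2 - A) / (2 * q)) (z / q).
Proof. by move=> q0; apply: is_derive_eq; rewrite /GRing.scale /=; field. Qed.

(** Using |x y| where [cosz] has x y makes t increase from -1 at [lo x y] to 1 at [hi x y], whatever
    the signs. Then |z| dz is |x y| dt, and the factor 2 counts the two signs of z. *)
Lemma ge0_integral_support x y (G : R -> R) : x != 0 -> y != 0 ->
  measurable_fun setT G -> {in `]-1, 1[, continuous G} -> (forall t, -1 < t < 1 -> 0 <= G t) ->
  (\int[mu]_z (if (lo x y < `|z| < hi x y)%R then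
      G ((z ^+ 2 - (x ^+ 2 + y ^+ 2)) / (2 * `|x * y|)) * `|z| else 0)%:E =
   (2 * `|x * y|)%:E * \int[mu]_(t in `](-1)%R, 1%R[) (G t)%:E)%E.
Proof.
move=> x0 y0 mG cG G0; set q := `|x * y|; have q0 : 0 < q by rewrite normr_gt0 mulf_neq0.
have q2 : 2 * q != 0 by rewrite mulf_neq0// gt_eqF.
pose F z := (z ^+ 2 - (x ^+ 2 + y ^+ 2)) / (2 * q).
pose f z := z / q.
have Flo : F (lo x y) = -1 by rewrite /F lo_sqr -/q; field; rewrite gt_eqF.
have Fhi : F (hi x y) = 1 by rewrite /F hi_sqr -/q; field; rewrite gt_eqF.
have incF : {in `[lo x y, hi x y] &, {homo F : u v / u < v}}.
  move=> u v; rewrite !in_itv/= => /andP[u1 _] /andP[v1 _] uv.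
  rewrite /F ltr_pM2r ?invr_gt0 ?mulr_gt0// ltrD2r ltr_pXn2r ?nnegrE//.
    exact: le_trans (lo_ge0 _ _) u1.
  exact: le_trans (lo_ge0 _ _) v1.
have cf : continuous f by move=> z; apply: cvgM; [exact: cvg_id|exact: cvg_cst].
have dF z : is_derive z (1 : R) F (f z).
  by apply: is_derive_quadratic; rewrite gt_eqF.
have F1 z : lo x y < z < hi x y -> -1 < F z < 1.
  move=> /andP[z1 z2]; have l := ltW (lo_lt_hi x0 y0).
  by rewrite -Flo -Fhi; apply/andP; split; apply: incF => //; rewrite in_itv/= ?lexx ?l ?(ltW z1) ?(ltW z2).
have FN z : F `|z| = F z by rewrite /F real_normK ?num_real.
transitivity (\int[mu]_z (if lo x y < `|z| < hi x y then G (F `|z|) * `|z| else 0)%:E)%E.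
  by apply: eq_integral => z _; rewrite FN.
have mGF : measurable_fun setT (fun z => G (F z) * z).
  apply: measurable_funM => //; apply: (measurableT_comp mG).
  by apply: measurable_funM => //; apply: measurable_funB => //; exact: measurable_funX.
rewrite (ge0_integral_even_support (lo_ge0 x y) mGF); last first.
  move=> z /[dup] zz /andP[z1 _]; rewrite mulr_ge0 ?G0 ?F1//.
  exact: le_trans (lo_ge0 _ _) (ltW z1).
have -> : (\int[mu]_(t in `](-1)%R, 1%R[) (G t)%:E = \int[mu]_(t in `]F (lo x y), F (hi x y)[) (G t)%:E)%E.
  by rewrite Flo Fhi.
rewrite (@ge0_substitution_oo _ F f G)//; last 4 first.
- exact: lo_lt_hi.
- by rewrite Flo Fhi.
- by rewrite Flo Fhi.
- by move=> z /andP[z1 _]; rewrite divr_ge0 ?(ltW q0)// (le_trans (lo_ge0 _ _) (ltW z1)).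
rewrite EFinM -muleA; congr (_ * _)%E; rewrite -ge0_integralZl//; last 3 first.
- apply/measurable_EFinP/measurable_funTS; rewrite (_ : (fun z => _) = fun z => (G (F z) * z) * q^-1).
    exact: measurable_funM.
  by apply/funext => z; rewrite /f mulrA.
- move=> z /=; rewrite in_itv/= => zz; rewrite lee_fin mulr_ge0 ?G0 ?F1// /f divr_ge0 ?(ltW q0)//.
  by move: zz => /andP[z1 _]; exact: le_trans (lo_ge0 _ _) (ltW z1).
- by rewrite lee_fin ltW.
by apply: eq_integral => z _; rewrite -EFinM /f; congr EFin; field; rewrite gt_eqF.
Qed.

Lemma continuous_ultra_weight a : {in `]-1, 1[, continuous (ultra_weight a)}.
Proof.
move=> t; rewrite in_itv/= => t1.
have t2 : 0 < 1 - t ^+ 2 by rewrite subr_gt0 -real_normK ?num_real// expr_lt1// ltr_norml.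
rewrite /ultra_weight; apply: (@continuous_comp _ _ _ (fun t : R => 1 - t ^+ 2) (fun u => u `^ (a - 2^-1))).
  by apply: cvgB; [exact: cvg_cst|exact: exprn_continuous].
apply: differentiable_continuous; apply/derivable1_diffP; apply: derivable_powR.
by rewrite in_itv/= t2.
Qed.

Lemma ultra_weight_cosz a x y z : x != 0 -> y != 0 ->
  ultra_weight a ((z ^+ 2 - (x ^+ 2 + y ^+ 2)) / (2 * `|x * y|)) = ultra_weight a (cosz x y z).
Proof.
move=> x0 y0; rewrite /ultra_weight /cosz; congr ((1 - _) `^ _).
by rewrite !exprMn !exprVn !exprMn real_normK ?num_real// exprMn mulrA.
Qed.

Lemma integrable_dmajorant a x y : - 2^-1 < a -> x != 0 -> y != 0 ->
  mu.-integrable setT (EFin \o dmajorant a x y).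
Proof.
move=> ha x0 y0; apply/integrableP; split; first by apply/measurable_EFinP; exact: measurable_dmajorant.
have -> : (\int[mu]_z `|(EFin \o dmajorant a x y) z| =
   \int[mu]_z (if (lo x y < `|z| < hi x y)%R then
      ultra_weight a ((z ^+ 2 - (x ^+ 2 + y ^+ 2)) / (2 * `|x * y|)) * `|z| else 0)%:E)%E.
  apply: eq_integral => z _ /=; rewrite ger0_norm ?dmajorant_ge0// ultra_weight_cosz// /dmajorant mulrC.
  by case: ifP.
rewrite ge0_integral_support//.
- by rewrite integral_ultra_weight// -EFinM ltry.
- exact: measurable_ultra_weight.
- exact: continuous_ultra_weight.
- by move=> t _; exact: ultra_weight_ge0.
Qed.

Lemma integrable_dweight a x y n : - 2^-1 < a -> x != 0 -> y != 0 ->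
  mu.-integrable setT (EFin \o (fun z => z ^+ n * dweight a x y z)).
Proof.
move=> ha x0 y0; have [B B0 HB] := dweight_le ha x0 y0.
have hi0 : 0 <= hi x y by rewrite addr_ge0.
have iB : mu.-integrable setT (EFin \o (fun z => (hi x y ^+ n * B) * dmajorant a x y z)).
  by apply: (integrableZl _ _ (integrable_dmajorant ha x0 y0)).
apply: (le_integrable _ _ _ iB) => //.
  apply/measurable_EFinP; apply: measurable_funM; [exact: measurable_funX|exact: measurable_dweight].
move=> z _ /=; rewrite lee_fin normrM [leRHS]ger0_norm ?mulr_ge0 ?exprn_ge0 ?dmajorant_ge0//.
have [h|h] := boolP (lo x y < `|z| < hi x y).
  rewrite -mulrA ler_pM ?HB// normrX lerXn2r ?nnegrE//; by case/andP: h => _ /ltW.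
by rewrite dweightE// (negbTE h) normr0 mulr0 mulr_ge0 ?mulr_ge0 ?exprn_ge0 ?dmajorant_ge0.
Qed.

Lemma z2poly_ge0 x y t : -1 < t < 1 -> 0 <= x ^+ 2 + y ^+ 2 + 2 * `|x * y| * t.
Proof.
move=> t1; have q0 := normr_ge0 (x * y).
have : lo x y ^+ 2 >= 0 by exact: sqr_ge0.
rewrite lo_sqr => h; nra.
Qed.

Lemma horner_dunkl_moment x y n t :
  (z2poly x y ^+ n * (1 + 'X)).[t] = (x ^+ 2 + y ^+ 2 + 2 * x * y * t) ^+ n * (1 + t).
Proof. by rewrite hornerM horner_exp /z2poly !hornerD hornerZ !hornerC hornerX. Qed.

(** The substitution uses |x y|, so [cosz] becomes s t with [s] the sign of x y. If s = -1, the
    reflection t -> - t restores the polynomial in 2 x y t, the weight being even. *)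
Lemma even_moment a x y n : - 2^-1 < a -> x != 0 -> y != 0 ->
  \int[mu]_z (if lo x y < `|z| < hi x y then
     z ^+ (2 * n) * ((1 + cosz x y z) * ultra_weight a (cosz x y z)) * `|z| else 0) =
  2 * `|x * y| / M_const a * dunkl_moment a x y n.
Proof.
move=> ha x0 y0; set q := `|x * y|; have q0 : 0 < q by rewrite normr_gt0 mulf_neq0.
pose s : R := if 0 < x * y then 1 else -1.
have s2 : s * s = 1 by rewrite /s; case: ifP => _; rewrite ?mulr1// mulrNN mulr1.
have sE : x * y = s * q.
  rewrite /s /q; case: ltP => h; first by rewrite mul1r gtr0_norm.
  by rewrite ler0_norm// mulrNN mul1r.
pose G t := (x ^+ 2 + y ^+ 2 + 2 * q * t) ^+ n * (1 + s * t) * ultra_weight a t.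
have s1 t : -1 < t < 1 -> 0 < 1 + s * t.
  by rewrite /s => /andP[t1 t2]; case: ifP => _; lra.
have G0 t : -1 < t < 1 -> 0 <= G t.
  move=> t1; rewrite /G !mulr_ge0 ?ultra_weight_ge0 ?exprn_ge0 ?z2poly_ge0//; exact/ltW/s1.
have cG0 : continuous (fun t => (x ^+ 2 + y ^+ 2 + 2 * q * t) ^+ n * (1 + s * t)).
  move=> t; apply: cvgM.
    apply: (@continuous_comp _ _ _ (fun t : R => x ^+ 2 + y ^+ 2 + 2 * q * t) (fun u => u ^+ n)).
      by apply: cvgD; [exact: cvg_cst|apply: cvgM; [exact: cvg_cst|exact: cvg_id]].
    exact: exprn_continuous.
  by apply: cvgD; [exact: cvg_cst|apply: cvgM; [exact: cvg_cst|exact: cvg_id]].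
have cG : {in `]-1, 1[, continuous G}.
  by move=> t t1; apply: cvgM; [exact: cG0|exact: continuous_ultra_weight].
have mG : measurable_fun setT G.
  by apply: measurable_funM; [exact: continuous_measurable_fun|exact: measurable_ultra_weight].
have GE : (\int[mu]_(t in `](-1)%R, 1%R[) (G t)%:E =
  \int[mu]_(t in `](-1)%R, 1%R[) ((z2poly x y ^+ n * (1 + 'X)).[t] * ultra_weight a t)%:E)%E.
  have H t : G (s * t) = (z2poly x y ^+ n * (1 + 'X)).[t] * ultra_weight a t.
    rewrite /G horner_dunkl_moment -[2 * x * y]mulrA sE [s * (s * t)]mulrA s2 mul1r.
    have -> : ultra_weight a (s * t) = ultra_weight a t by rewrite /ultra_weight exprMn [s ^+ 2]expr2 s2 mul1r.
    by congr ((_ + _) ^+ _ * _ * _); ring.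
  have [s_1|s_1] := boolP (0 < x * y).
    by apply: eq_integral => t _; rewrite -H /s s_1 mul1r.
  rewrite [LHS]integral_mkcond [RHS]integral_mkcond.
  rewrite [LHS]ge0_integral_reflect.
  - apply: eq_integral => t _; rewrite !patchE !mem_setE !in_itv/= ltrNl opprK ltrNl andbC.
    by rewrite -H /s (negbTE s_1) mulN1r.
  - by apply/(measurable_restrictT _ _).1 => //; apply/measurable_EFinP/measurable_funTS.
  - by move=> z; apply: erestrict_ge0 => t /=; rewrite in_itv/= => /G0.
rewrite /Rintegral.
have -> : (\int[mu]_z (if (lo x y < `|z| < hi x y)%R then
     z ^+ (2 * n) * ((1 + cosz x y z) * ultra_weight a (cosz x y z)) * `|z| else 0)%:E =
   \int[mu]_z (if (lo x y < `|z| < hi x y)%R then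
      G ((z ^+ 2 - (x ^+ 2 + y ^+ 2)) / (2 * q)) * `|z| else 0)%:E)%E.
  apply: eq_integral => z _; case: ifP => // _; congr (_ * _)%:E.
  rewrite /G ultra_weight_cosz// mulrA; congr (_ * _ * _).
    by rewrite exprM; congr (_ ^+ _); field; rewrite gt_eqF.
  congr (1 + _); rewrite /cosz -[2 * x * y]mulrA sE invfM.
  have -> : (s * q)^-1 = s / q by rewrite invfM; congr (_ / _); apply: (mulfI (x := s)); rewrite ?s2 ?mulfV//; apply/eqP => s00; move: s2; rewrite s00 mul0r => /eqP; rewrite eq_sym oner_eq0.
  by field; rewrite gt_eqF.
rewrite ge0_integral_support// GE /dunkl_moment /ultra_mean.
have i := integrable_horner_ultra_weight (z2poly x y ^+ n * (1 + 'X)) ha.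
rewrite /Rintegral fineM//; last exact: (integrable_fin_num _ i).
rewrite /= mulrA divfK// gt_eqF// M_const_gt0//.
Qed.

(** Averaging over z and - z: against an even power only the even part |z| of the first factor of
    [dweight] survives, against an odd power only the part with x + y. As z times its sign is |z|,
    both leave the same integrand [W]. *)
Lemma Rintegral_dweight a x y n : - 2^-1 < a -> x != 0 -> y != 0 ->
  \int[mu]_z (z ^+ (2 * n) * dweight a x y z) = dunkl_moment a x y n /\
  \int[mu]_z (z ^+ (2 * n).+1 * dweight a x y z) = (x + y) * dunkl_moment a x y n.
Proof.
move=> ha x0 y0; set q := `|x * y|; have q0 : 0 < q by rewrite normr_gt0 mulf_neq0.
have M0 := M_const_gt0 ha.
pose W z := if lo x y < `|z| < hi x y then
     z ^+ (2 * n) * ((1 + cosz x y z) * ultra_weight a (cosz x y z)) * `|z| else 0.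
have iW : mu.-integrable setT (EFin \o W).
  have iB : mu.-integrable setT (EFin \o (fun z => (hi x y ^+ (2 * n) * 2) * dmajorant a x y z)).
    by apply: (integrableZl _ _ (integrable_dmajorant ha x0 y0)).
  have hi0 : 0 <= hi x y by rewrite addr_ge0.
  apply: (le_integrable _ _ _ iB) => //.
    apply/measurable_EFinP; apply: measurable_if; first exact: measurable_support.
    apply: measurable_funM; last exact: normr_measurable.
    apply: measurable_funM; first exact: measurable_funX.
    apply: measurable_funM; last exact: measurable_ultra_weight_cosz.
    by apply: measurable_funD => //; exact: measurable_cosz.
  move=> z _ /=; rewrite lee_fin [leRHS]ger0_norm ?mulr_ge0 ?exprn_ge0 ?dmajorant_ge0//.
  rewrite /W /dmajorant; case: ifP => h; last by rewrite normr0 mulr0.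
  have /andP[T1 T2] := cosz_norm_lt1 x0 y0 h; have /andP[_ h2] := h.
  rewrite 3!normrM normr_id (ger0_norm (ultra_weight_ge0 _ _)) (@ger0_norm _ (1 + _)); last by lra.
  have -> : hi x y ^+ (2 * n) * 2 * (`|z| * ultra_weight a (cosz x y z)) =
    hi x y ^+ (2 * n) * (2 * ultra_weight a (cosz x y z)) * `|z| by ring.
  rewrite ler_wpM2r// ler_pM ?mulr_ge0 ?ultra_weight_ge0//; first by lra.
    by rewrite normrX lerXn2r ?nnegrE// ltW.
  by rewrite ler_wpM2r ?ultra_weight_ge0//; lra.
have EW : \int[mu]_z W z = 2 * q / M_const a * dunkl_moment a x y n by exact: even_moment.
have sym (f : R -> R) k : mu.-integrable setT (EFin \o f) ->
   (forall z, f z + f (- z) = k * W z) -> \int[mu]_z f z = k / 2 * \int[mu]_z W z.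
  move=> fi fW; have fiN := integrable_reflect fi.
  have h : \int[mu]_z f z + \int[mu]_z f z = k * \int[mu]_z W z.
    rewrite {2}(Rintegral_reflect fi) -RintegralD// -RintegralZl//.
    by apply: eq_Rintegral => z _; rewrite fW.
  by rewrite mulrAC -h; field.
have oddN (z : R) : (- z) ^+ (2 * n) = z ^+ (2 * n) by rewrite exprM sqrrN -exprM.
have coszN (z : R) : cosz x y (- z) = cosz x y z by rewrite /cosz sqrrN.
have W0 : W 0 = 0 by rewrite /W normr0 mulr0; case: ifP.
split.
  rewrite (sym _ (M_const a / q)) ?EW; first by field; rewrite (gt_eqF q0) (gt_eqF M0).
    exact: integrable_dweight.
  move=> z; rewrite !dweightE// normrN coszN oddN /W; case: ifP => h; last by rewrite !mulr0 addr0.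
  have z0 : z != 0.
    by move: h => /andP[h _]; rewrite -normr_gt0; apply: le_lt_trans h; exact: lo_ge0.
  rewrite -/q oppr_gt0.
  by case: (ltgtP z 0) z0 => // zz _; field; rewrite (gt_eqF q0).
rewrite (sym _ (M_const a / q * (x + y))) ?EW; first by field; rewrite (gt_eqF q0) (gt_eqF M0).
  exact: integrable_dweight.
move=> z; rewrite !dweightE// normrN coszN exprS [(- z) ^+ _]exprS oddN /W; case: ifP => h; last by rewrite !mulr0 addr0.
have z0 : z != 0.
  by move: h => /andP[h _]; rewrite -normr_gt0; apply: le_lt_trans h; exact: lo_ge0.
rewrite -/q oppr_gt0.
case: (ltgtP z 0) z0 => // zz _; first by rewrite (ltr0_norm zz); field; rewrite (gt_eqF q0).
by rewrite (gtr0_norm zz); field; rewrite (gt_eqF q0).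
Qed.

End dunkl_weight.

(** * Measurability, integrals and dominated convergence for complex functions *)

Section complex_integral.
Context {R : realType}.
Local Notation mu := (@lebesgue_measure R).
Implicit Types (f : R -> R[i]) (r g : R -> R).

Lemma Rdominated (f_ : nat -> R -> R) (f g : R -> R) :
  (forall n, measurable_fun setT (f_ n)) ->
  (forall z, f_ n z @[n --> \oo] --> f z) ->
  mu.-integrable setT (EFin \o g) ->
  (forall n z, `|f_ n z| <= g z) ->
  [/\ mu.-integrable setT (EFin \o f), forall n, mu.-integrable setT (EFin \o f_ n) &
   \int[mu]_z f_ n z @[n --> \oo] --> \int[mu]_z f z].
Proof.
move=> mf_ ff ig fg.
have mE n : measurable_fun setT (EFin \o f_ n) by exact/measurable_EFinP.
have cE z : (EFin \o f_ n) z @[n --> \oo] --> (EFin \o f) z.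
  by apply: cvg_EFin; [exact: nearW|exact: ff].
have mf : measurable_fun setT (EFin \o f).
  by apply: (emeasurable_fun_cvg (fun n => EFin \o f_ n)) => // z _; exact: cE.
have [|||if1 _ c] := @dominated_convergence _ _ _ mu setT measurableT (fun n => EFin \o f_ n) (EFin \o f) (EFin \o g) mE mf.
- by apply: aeW => z _; exact: cE.
- exact: ig.
- by apply: aeW => z n _ /=; rewrite lee_fin.
split => //.
  move=> n; apply: (le_integrable _ _ _ ig) => //; first by apply/measurable_EFinP; exact: mf_.
  move=> z _ /=; by rewrite lee_fin (le_trans (fg n z))// ler_norm.
rewrite /Rintegral; apply: fine_cvg; rewrite fineK; [exact: c|exact: integrable_fin_num].
Qed.

Definition cmeasurable f :=
  measurable_fun setT (fun z => Re (f z)) /\ measurable_fun setT (fun z => Im (f z)).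

Lemma cmeasurable_cst (c : R[i]) : cmeasurable (fun=> c).
Proof. by split; exact: measurable_cst. Qed.

Lemma cmeasurable_real r : measurable_fun setT r -> cmeasurable (fun z => (r z)%:C).
Proof. by move=> mr; split; [exact: mr|exact: measurable_cst]. Qed.

Lemma cmeasurableD f1 f2 : cmeasurable f1 -> cmeasurable f2 -> cmeasurable (fun z => f1 z + f2 z).
Proof.
move=> [r1 i1] [r2 i2]; split.
  have -> : (fun z => Re (f1 z + f2 z)) = (fun z => Re (f1 z) + Re (f2 z)).
    by apply/funext => z; rewrite ReD.
  exact: measurable_funD.
have -> : (fun z => Im (f1 z + f2 z)) = (fun z => Im (f1 z) + Im (f2 z)).
  by apply/funext => z; rewrite ImD.
exact: measurable_funD.
Qed.

Lemma cmeasurableM f1 f2 : cmeasurable f1 -> cmeasurable f2 -> cmeasurable (fun z => f1 z * f2 z).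
Proof.
move=> [r1 i1] [r2 i2]; split.
  have -> : (fun z => Re (f1 z * f2 z)) = (fun z => Re (f1 z) * Re (f2 z) - Im (f1 z) * Im (f2 z)).
    by apply/funext => z; rewrite ReM.
  by apply: measurable_funB; apply: measurable_funM.
have -> : (fun z => Im (f1 z * f2 z)) = (fun z => Re (f1 z) * Im (f2 z) + Im (f1 z) * Re (f2 z)).
  by apply/funext => z; rewrite ImM.
by apply: measurable_funD; apply: measurable_funM.
Qed.

Lemma cmeasurable_sum (f_ : nat -> R -> R[i]) n : (forall k, cmeasurable (f_ k)) ->
  cmeasurable (fun z => \sum_(0 <= k < n) f_ k z).
Proof.
move=> mf; elim: n => [|n IH].
  by rewrite (_ : (fun z => _) = fun=> 0); [exact: cmeasurable_cst|apply/funext => z; rewrite big_nil].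
rewrite (_ : (fun z => _) = fun z => \sum_(0 <= k < n) f_ k z + f_ n z).
  exact: cmeasurableD.
by apply/funext => z; rewrite big_nat_recr.
Qed.

Lemma measurable_fun_rcvg (f_ : nat -> R -> R) (f : R -> R) :
  (forall n, measurable_fun setT (f_ n)) -> (forall z, f_ n z @[n --> \oo] --> f z) ->
  measurable_fun setT f.
Proof.
move=> mf cf; apply/measurable_EFinP.
apply: (emeasurable_fun_cvg (fun n => EFin \o f_ n)) => [n|z _]; first exact/measurable_EFinP.
by apply: cvg_EFin; [exact: nearW|exact: cf].
Qed.

Lemma cmeasurable_cvg (f_ : nat -> R -> R[i]) f : (forall n, cmeasurable (f_ n)) ->
  (forall z, f_ n z @[n --> \oo] --> (f z : R[i]^o)) -> cmeasurable f.
Proof.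
move=> mf cf; split.
  apply: (@measurable_fun_rcvg (fun n z => Re (f_ n z))) => [n|z]; first by case: (mf n).
  by have [] := cvg_ReIm (cf z).
apply: (@measurable_fun_rcvg (fun n z => Im (f_ n z))) => [n|z]; first by case: (mf n).
by have [] := cvg_ReIm (cf z).
Qed.

Lemma cintegrable_le f g : cmeasurable f -> mu.-integrable setT (EFin \o g) ->
  (forall z, normc (f z) <= g z) -> cintegrable f.
Proof.
move=> [mR mI] ig fg; split.
  apply: (le_integrable _ _ _ ig) => //; first exact/measurable_EFinP.
  move=> z _ /=; rewrite lee_fin (le_trans (normc_Re _))// (le_trans (fg z))// ler_norm//.
apply: (le_integrable _ _ _ ig) => //; first exact/measurable_EFinP.
by move=> z _ /=; rewrite lee_fin (le_trans (normc_Im _))// (le_trans (fg z))// ler_norm.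
Qed.

Lemma cdominated (f_ : nat -> R -> R[i]) f g :
  (forall n, cmeasurable (f_ n)) ->
  (forall z, f_ n z @[n --> \oo] --> (f z : R[i]^o)) ->
  mu.-integrable setT (EFin \o g) ->
  (forall n z, normc (f_ n z) <= g z) ->
  cintegrable f /\ cintegral (f_ n) @[n --> \oo] --> (cintegral f : R[i]^o).
Proof.
move=> mf cf ig fg.
have [||||iR _ cR] := @Rdominated (fun n z => Re (f_ n z)) (fun z => Re (f z)) g.
- by move=> n; case: (mf n).
- by move=> z; have [] := cvg_ReIm (cf z).
- exact: ig.
- by move=> n z; apply: le_trans (fg n z); exact: normc_Re.
have [||||iI _ cI] := @Rdominated (fun n z => Im (f_ n z)) (fun z => Im (f z)) g.
- by move=> n; case: (mf n).
- by move=> z; have [] := cvg_ReIm (cf z).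
- exact: ig.
- by move=> n z; apply: le_trans (fg n z); exact: normc_Im.
by split; [split|exact: cvg_complex].
Qed.

Lemma cintegrableD f1 f2 : cintegrable f1 -> cintegrable f2 -> cintegrable (fun z => f1 z + f2 z).
Proof.
move=> [r1 i1] [r2 i2]; split.
  rewrite (_ : EFin \o _ = (EFin \o (fun z => Re (f1 z))) \+ (EFin \o (fun z => Re (f2 z))))%E.
    exact: integrableD.
  by apply/funext => z /=; rewrite ReD.
rewrite (_ : EFin \o _ = (EFin \o (fun z => Im (f1 z))) \+ (EFin \o (fun z => Im (f2 z))))%E.
  exact: integrableD.
by apply/funext => z /=; rewrite ImD.
Qed.

Lemma cintegralD f1 f2 : cintegrable f1 -> cintegrable f2 ->
  cintegral (fun z => f1 z + f2 z) = cintegral f1 + cintegral f2.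
Proof.
move=> [r1 i1] [r2 i2]; apply/eqP; rewrite eq_complex; apply/andP; split; apply/eqP.
  rewrite ReD /cintegral /= -RintegralD//; apply: eq_Rintegral => z _; exact: ReD.
rewrite ImD /cintegral /= -RintegralD//; apply: eq_Rintegral => z _; exact: ImD.
Qed.

Lemma cintegrableZ (c : R[i]) r : mu.-integrable setT (EFin \o r) ->
  cintegrable (fun z => c * (r z)%:C).
Proof.
move=> ir; split.
  rewrite (_ : EFin \o _ = EFin \o (fun z => Re c * r z)); first by apply: (integrableZl _ _ ir).
  by apply/funext => z /=; rewrite ReMr.
rewrite (_ : EFin \o _ = EFin \o (fun z => Im c * r z)); first by apply: (integrableZl _ _ ir).
by apply/funext => z /=; rewrite ImMr.
Qed.

Lemma cintegralZ (c : R[i]) r : mu.-integrable setT (EFin \o r) ->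
  cintegral (fun z => c * (r z)%:C) = c * (\int[mu]_z r z)%:C.
Proof.
move=> ir; apply/eqP; rewrite eq_complex; apply/andP; split; apply/eqP.
  rewrite ReMr /cintegral /= -RintegralZl//; apply: eq_Rintegral => z _; exact: ReMr.
rewrite ImMr /cintegral /= -RintegralZl//; apply: eq_Rintegral => z _; exact: ImMr.
Qed.

Lemma cintegral0 : cintegral (fun=> 0 : R[i]) = 0.
Proof.
by rewrite /cintegral /Rintegral /= integral0.
Qed.

Lemma cintegral_sum (f_ : nat -> R -> R[i]) n : (forall k, cintegrable (f_ k)) ->
  cintegrable (fun z => \sum_(0 <= k < n) f_ k z) /\
  cintegral (fun z => \sum_(0 <= k < n) f_ k z) = \sum_(0 <= k < n) cintegral (f_ k).
Proof.
move=> fi; elim: n => [|n [IH1 IH2]].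
  rewrite (_ : (fun z => _) = fun=> 0); last by apply/funext => z; rewrite big_nil.
  by rewrite big_nil cintegral0; split => //; split; exact: integrable0.
have E : (fun z => \sum_(0 <= k < n.+1) f_ k z) = (fun z => \sum_(0 <= k < n) f_ k z + f_ n z).
  by apply/funext => z; rewrite big_nat_recr.
rewrite E; split; first exact: cintegrableD.
by rewrite cintegralD// IH2 big_nat_recr.
Qed.

End complex_integral.

(** * The Dunkl product formula *)

Section dunkl_product_formula.
Context {R : realType}.
Local Notation mu := (@lebesgue_measure R).
Implicit Types (a x y z : R) (lam : R[i]).

Let realC_neq0 (r : R) : r != 0 -> r%:C != 0 :> R[i].
Proof. by move=> r0; rewrite -(rmorph0 (real_complex R)) (inj_eq (@complexI R)). Qed.

Let divC_mulC (k : R[i]) (d v w : R) : d^-1 * v = w -> k / d%:C * v%:C = k * w%:C.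
Proof. by move=> <-; rewrite (rmorphM (real_complex R)) (fmorphV (real_complex R)) mulrA. Qed.

Lemma jacobi_coef0_term0F1 a lam X n :
  jacobi_coef a lam 0 n * (X ^+ n)%:C = (- (lam ^+ 2 / 4)) ^+ n * (term0F1 (a + 1) X n)%:C.
Proof.
by rewrite jacobi_coef0 /term0F1 -mulrA; congr (_ * _); rewrite [in RHS]rmorphM fmorphV /= mulrC [poch _ _ * _]mulrC.
Qed.

Lemma jacobi_coef0_conv a b lam X Y n :
  \sum_(i < n.+1) (jacobi_coef a lam 0 i * (X ^+ i)%:C) * (jacobi_coef b lam 0 (n - i) * (Y ^+ (n - i))%:C) =
  (- (lam ^+ 2 / 4)) ^+ n * (conv0F1 (a + 1) (b + 1) X Y n)%:C.
Proof.
rewrite /conv0F1 rmorph_sum mulr_sumr; apply: eq_bigr => i _.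
have iN : (i <= n)%N by rewrite -ltnS.
rewrite (jacobi_coef0_term0F1 a lam X i) (jacobi_coef0_term0F1 b lam Y (n - i)%N).
have -> : (- (lam ^+ 2 / 4)) ^+ n = (- (lam ^+ 2 / 4)) ^+ i * (- (lam ^+ 2 / 4)) ^+ (n - i).
  by rewrite -exprD subnKC.
by rewrite mulrACA -(rmorphM (real_complex R)).
Qed.

Lemma conv0F1_cvg a b lam X Y : - 2^-1 < a -> - 2^-1 < b ->
  series (fun n => (- (lam ^+ 2 / 4)) ^+ n * (conv0F1 (a + 1) (b + 1) X Y n)%:C : R[i]^o) @ \oo
    --> (cpseries (jacobi_coef a lam 0) X * cpseries (jacobi_coef b lam 0) Y : R[i]^o).
Proof.
move=> ha hb; have := cauchy_product (@jacobi_coef0_summable R a lam X ha) (@jacobi_coef0_summable R b lam Y hb).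
by under eq_fun do rewrite jacobi_coef0_conv.
Qed.

(** Integral against [dweight a x y] of the terms of degree 2 n and 2 n + 1 in z of the Dunkl
    kernel. *)
Definition dunkl_term a lam x y n : R[i] :=
  jacobi_coef a lam 0 n * (dunkl_moment a x y n)%:C
  + 'i * lam / (2 * (a + 1))%:C * jacobi_coef (a + 1) lam 0 n * ((x + y) * dunkl_moment a x y n)%:C.

(** Writing the kernel as A(z^2) + k1 z B(z^2), the product consists of the Cauchy products of A A,
    B B, B A and A B. Since k1^2 = kap / (a + 1)^2, the product of the two odd parts carries an
    extra factor [kap] and lags by one index: [BB n] goes with [AA n.+1]. *)
Lemma dunkl_term_cvg a lam x y : - 2^-1 < a ->
  series (dunkl_term a lam x y : nat -> R[i]^o) @ \oo
    --> (dunkl_E a lam x * dunkl_E a lam y : R[i]^o).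
Proof.
move=> ha; have ha1 : - 2^-1 < a + 1 by lra.
have c0 : 0 < a + 1 by lra.
set X := x ^+ 2; set Y := y ^+ 2; set kap := - (lam ^+ 2 / 4).
pose k1 : R[i] := 'i * lam / (2 * (a + 1))%:C.
pose AA n : R[i] := kap ^+ n * (conv0F1 (a + 1) (a + 1) X Y n)%:C.
pose BB n : R[i] := kap ^+ n * (conv0F1 (a + 1 + 1) (a + 1 + 1) X Y n)%:C.
pose CA n : R[i] := kap ^+ n * (conv0F1 (a + 1 + 1) (a + 1) X Y n)%:C.
pose AC n : R[i] := kap ^+ n * (conv0F1 (a + 1) (a + 1 + 1) X Y n)%:C.
pose m : R := x * y / (a + 1) ^+ 2.
have term0 : dunkl_term a lam x y 0 = AA 0%N + k1 * (x%:C * CA 0%N + y%:C * AC 0%N).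
  rewrite /dunkl_term dunkl_moment0// /AA /CA /AC !conv0F1_0 !jacobi_coef0 !expr0 !poch0 fact0 mulr1 -/k1.
  by rewrite !(mulr1, mul1r) (rmorphD (real_complex R)) (rmorph1 (real_complex R)) invr1 !mulr1.
have termS n : dunkl_term a lam x y n.+1 = AA n.+1 + kap * m%:C * BB n +
    k1 * (x%:C * CA n.+1 + y%:C * AC n.+1).
  rewrite /dunkl_term -/k1; set V := dunkl_moment a x y n.+1.
  have f0 : n.+1`!%:R != 0 :> R by rewrite pnatr_eq0 -lt0n fact_gt0.
  have p0 : poch (a + 1) n.+1 != 0 by rewrite gt_eqF// poch_gt0.
  have p1 : poch (a + 1 + 1) n.+1 != 0 by rewrite gt_eqF// poch_gt0// addr_gt0.
  have cn : a + 1 + n.+1%:R != 0 by rewrite gt_eqF// ltr_wpDr.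
  have E1 : jacobi_coef a lam 0 n.+1 * V%:C = AA n.+1 + kap * m%:C * BB n.
    have E : (poch (a + 1) n.+1 * n.+1`!%:R)^-1 * V =
       conv0F1 (a + 1) (a + 1) X Y n.+1 + m * conv0F1 (a + 1 + 1) (a + 1 + 1) X Y n.
      rewrite /V dunkl_momentS// -/X -/Y -/m; move: (poch _ n.+1) p0 (n.+1`!%:R) f0 => P p0 f f0.
      by field; rewrite ?f0 ?p0.
    rewrite jacobi_coef0 -/kap (divC_mulC _ E) (rmorphD (real_complex R)) (rmorphM (real_complex R)).
    by rewrite /AA /BB exprS /=; ring.
  have E2 : jacobi_coef (a + 1) lam 0 n.+1 * ((x + y) * V)%:C = x%:C * CA n.+1 + y%:C * AC n.+1.
    have E : (poch (a + 1 + 1) n.+1 * n.+1`!%:R)^-1 * ((x + y) * V) =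
       x * conv0F1 (a + 1 + 1) (a + 1) X Y n.+1 + y * conv0F1 (a + 1) (a + 1 + 1) X Y n.+1.
      (* The factor a + 1 + (n + 1) is the one in [conv0F1_odd]; by [PE] it also exchanges the
         Pochhammer symbols of a + 1 and a + 2. *)
      apply: (mulfI cn); rewrite conv0F1_odd// -/X -/Y -/m.
      have PE : (a + 1) * poch (a + 1 + 1) n.+1 = poch (a + 1) n.+1 * (a + 1 + n.+1%:R).
        by rewrite -pochSl pochS.
      rewrite /V dunkl_momentS// -/X -/Y -/m; set K := conv0F1 _ _ _ _ _ + _.
      have -> : (a + 1 + n.+1%:R) * ((poch (a + 1 + 1) n.+1 * n.+1`!%:R)^-1 *
        ((x + y) * (n.+1`!%:R * poch (a + 1) n.+1 * K))) =
        (poch (a + 1) n.+1 * (a + 1 + n.+1%:R)) * ((poch (a + 1 + 1) n.+1 * n.+1`!%:R)^-1 * ((x + y) * (n.+1`!%:R * K))).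
        by ring.
      rewrite -PE; move: (poch (a + 1 + 1) n.+1) p1 (n.+1`!%:R) f0 => P p1 f f0.
      by field; rewrite ?f0 ?p1.
    rewrite jacobi_coef0 -/kap (divC_mulC _ E) (rmorphD (real_complex R)) !(rmorphM (real_complex R)).
    by rewrite /CA /AC /=; ring.
  by rewrite E1 -[k1 * jacobi_coef _ _ _ _ * _]mulrA E2.
have serE N : series (dunkl_term a lam x y : nat -> R[i]^o) N.+1 =
   series (AA : nat -> R[i]^o) N.+1 + kap * m%:C * series (BB : nat -> R[i]^o) N +
   k1 * (x%:C * series (CA : nat -> R[i]^o) N.+1 + y%:C * series (AC : nat -> R[i]^o) N.+1).
  elim: N => [|N IH].
    by rewrite /series /= !big_nat1 big_nil mulr0 addr0 term0.
  rewrite !seriesSr in IH *; rewrite IH termS.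
  by ring.
have cAA := @conv0F1_cvg a a lam X Y ha ha; have cBB := @conv0F1_cvg (a + 1) (a + 1) lam X Y ha1 ha1.
have cCA := @conv0F1_cvg (a + 1) a lam X Y ha1 ha; have cAC := @conv0F1_cvg a (a + 1) lam X Y ha ha1.
have shift (u : nat -> R[i]^o) (l : R[i]^o) : series u @ \oo --> l -> series u N.+1 @[N --> \oo] --> l.
  by move=> h; rewrite cvg_shiftS.
rewrite -(cvg_shiftS (series (dunkl_term a lam x y : nat -> R[i]^o))) /=.
rewrite (funext serE).
set A := cpseries (jacobi_coef a lam 0); set B := cpseries (jacobi_coef (a + 1) lam 0).
have -> : dunkl_E a lam x * dunkl_E a lam y =
   A X * A Y + kap * m%:C * (B X * B Y) + k1 * (x%:C * (B X * A Y) + y%:C * (A X * B Y)).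
  rewrite /dunkl_E !bessel_jE// -/X -/Y -/A -/B.
  have k1x (t : R) : 'i * lam * t%:C / (2 * (a + 1))%:C = k1 * t%:C by rewrite /k1; ring.
  rewrite !k1x.
  have -> : kap * m%:C = k1 ^+ 2 * (x%:C * y%:C).
    have h : (a + 1)%:C != 0 :> R[i] by apply: realC_neq0; rewrite gt_eqF.
    rewrite /kap /k1 /m !exprMn sqr_i exprVn [(x * y / _)%:C]rmorphM fmorphV rmorphXn /= rmorphM.
    rewrite [(2 * (a + 1))%:C]rmorphM /= rmorph_nat; move: (a + 1)%:C h => c h.
    by field; rewrite ?h ?pnatr_eq0.
  ring.
apply: ccvgD.
  apply: ccvgD; first exact: shift cAA.
  by apply: ccvgM; [exact: ccvg_cst|exact: cBB].
apply: ccvgM; first exact: ccvg_cst.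
apply: ccvgD; (apply: ccvgM; first exact: ccvg_cst).
  exact: shift cCA.
exact: shift cAC.
Qed.

Definition dunkl_partial a lam N z : R[i] :=
  \sum_(0 <= n < N) jacobi_coef a lam 0 n * ((z ^+ 2) ^+ n)%:C
  + 'i * lam / (2 * (a + 1))%:C * z%:C *
    \sum_(0 <= n < N) jacobi_coef (a + 1) lam 0 n * ((z ^+ 2) ^+ n)%:C.

Lemma cmeasurable_dunkl_partial a lam N : cmeasurable (dunkl_partial a lam N).
Proof.
have h b : cmeasurable (fun z => \sum_(0 <= n < N) jacobi_coef b lam 0 n * ((z ^+ 2) ^+ n)%:C).
  apply: cmeasurable_sum => k; apply: cmeasurableM; first exact: cmeasurable_cst.
  by apply: cmeasurable_real; apply: measurable_funX; exact: measurable_funX.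
apply: cmeasurableD; first exact: h.
apply: cmeasurableM; last exact: h.
by apply: cmeasurableM; [exact: cmeasurable_cst|exact: cmeasurable_real].
Qed.

Lemma dunkl_partial_cvg a lam z : - 2^-1 < a ->
  dunkl_partial a lam N z @[N --> \oo] --> (dunkl_E a lam z : R[i]^o).
Proof.
move=> ha; have ha1 : - 2^-1 < a + 1 by lra.
rewrite /dunkl_E !bessel_jE// (_ : 'i * lam * z%:C / _ = 'i * lam / (2 * (a + 1))%:C * z%:C); last by ring.
apply: ccvgD; first exact: csum_cvg (@jacobi_coef0_summable R a lam (z ^+ 2) ha).
apply: ccvgM; first exact: ccvg_cst.
exact: csum_cvg (@jacobi_coef0_summable R (a + 1) lam (z ^+ 2) ha1).
Qed.

Lemma dunkl_partial_bounded a lam Z : - 2^-1 < a -> 0 <= Z ->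
  exists2 B, 0 <= B & forall N z, `|z| <= Z -> normc (dunkl_partial a lam N z) <= B.
Proof.
move=> ha Z0.
have hb b : - 2^-1 < b -> exists2 B, 0 <= B & forall N z, `|z| <= Z ->
    normc (\sum_(0 <= n < N) jacobi_coef b lam 0 n * ((z ^+ 2) ^+ n)%:C) <= B.
  move=> hb; pose M n := jacobi_coef_bound b (normc (lam ^+ 2 / 4)) 0 n * (Z ^+ 2) ^+ n.
  have M0 n : 0 <= M n by rewrite mulr_ge0 ?exprn_ge0 ?jacobi_coef_bound_ge0 ?normc_ge0.
  have cM : cvgn (series M).
    by apply: jacobi_coef_bound_summable; rewrite ?normc_ge0 ?sqr_ge0// expr0n mul0r invr_ge0.
  have sM N : series M N <= limn (series M).
    by apply: nondecreasing_cvgn_le => //; apply: nondecreasing_series.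
  exists (limn (series M)); first by apply: le_trans (sM 0%N); rewrite /series /= big_nil.
  move=> N z zZ; apply: le_trans (sM N); apply: le_trans (normc_sum _ _ _) _.
  apply: ler_sum => n _; apply: normc_cpseries_term_le; first exact: normc_jacobi_coef_le.
  by rewrite normrX lerXn2r ?nnegrE.
have [B1 B10 H1] := hb _ ha; have ha1 : - 2^-1 < a + 1 by lra.
have [B2 B20 H2] := hb _ ha1.
exists (B1 + normc ('i * lam / (2 * (a + 1))%:C) * Z * B2).
  by rewrite addr_ge0// !mulr_ge0 ?normc_ge0.
move=> N z zZ; apply: le_trans (normc_triangle _ _) _; apply: lerD; first exact: H1.
rewrite ComplexField.Normc.normcM ler_pM ?normc_ge0 ?H2//.
by rewrite ComplexField.Normc.normcM normc_real ler_wpM2l ?normc_ge0.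
Qed.

Lemma dunkl_partial_integral a lam x y N : - 2^-1 < a -> x != 0 -> y != 0 ->
  cintegral (fun z => dunkl_partial a lam N z * (dweight a x y z)%:C) =
  series (dunkl_term a lam x y : nat -> R[i]^o) N.
Proof.
move=> ha x0 y0.
pose f n z : R[i] := jacobi_coef a lam 0 n * (z ^+ (2 * n) * dweight a x y z)%:C +
  'i * lam / (2 * (a + 1))%:C * jacobi_coef (a + 1) lam 0 n * (z ^+ (2 * n).+1 * dweight a x y z)%:C.
have i1 n := integrable_dweight (2 * n) ha x0 y0.
have i2 n := integrable_dweight (2 * n).+1 ha x0 y0.
have fi n : cintegrable (f n) by apply: cintegrableD; exact: cintegrableZ.
have -> : (fun z => dunkl_partial a lam N z * (dweight a x y z)%:C) =
    (fun z => \sum_(0 <= n < N) f n z).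
  apply/funext => z; rewrite /dunkl_partial mulr_sumr -big_split /= mulr_suml; apply: eq_bigr => n _.
  rewrite /f; have -> : z ^+ (2 * n).+1 = z * (z ^+ 2) ^+ n by rewrite exprS exprM.
  have -> : z ^+ (2 * n) = (z ^+ 2) ^+ n by rewrite exprM.
  move: ((z ^+ 2) ^+ n) (dweight a x y z) => u w.
  have realM (p q : R) : (p * q)%:C = p%:C * q%:C :> R[i] by exact: rmorphM.
  by rewrite !realM; ring.
rewrite (cintegral_sum _ fi).2 /series /=; apply: eq_bigr => n _.
rewrite /f cintegralD ?cintegralZ//; try exact: cintegrableZ.
by have [-> ->] := Rintegral_dweight n ha x0 y0.
Qed.

(** The partial sums are bounded uniformly on the support, so a multiple of [dmajorant] dominates
    them against the weight. Their integrals are the partial sums of [dunkl_term], and uniqueness of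
    limits identifies the product with the integral. *)
Lemma dunkl_product_formula a lam x y : - 2^-1 < a -> x != 0 -> y != 0 ->
  cintegrable (dunkl_integrand a lam x y) /\
  dunkl_E a lam x * dunkl_E a lam y = cintegral (dunkl_integrand a lam x y).
Proof.
move=> ha x0 y0.
have hi0 : 0 <= hi x y by rewrite addr_ge0.
have [B B0 HB] := dunkl_partial_bounded lam ha hi0.
have [D D0 HD] := dweight_le ha x0 y0.
have ig : mu.-integrable setT (EFin \o (fun z => (B * D) * dmajorant a x y z)).
  by apply: (integrableZl _ _ (integrable_dmajorant ha x0 y0)).
have [||||i c] := @cdominated R (fun N z => dunkl_partial a lam N z * (dweight a x y z)%:C)
  (dunkl_integrand a lam x y) (fun z => (B * D) * dmajorant a x y z).
- move=> N; apply: cmeasurableM; first exact: cmeasurable_dunkl_partial.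
  by apply: cmeasurable_real; exact: measurable_dweight.
- by move=> z; apply: ccvgM; [exact: dunkl_partial_cvg|exact: ccvg_cst].
- exact: ig.
- move=> N z; rewrite ComplexField.Normc.normcM normc_real -mulrA.
  have [h|h] := boolP (lo x y < `|z| < hi x y).
    by rewrite ler_pM ?normc_ge0 ?HD// HB//; case/andP: h => _ /ltW.
  by rewrite dweightE// (negbTE h) normr0 mulr0 mulr_ge0// mulr_ge0 ?dmajorant_ge0.
split => //.
have E N := dunkl_partial_integral lam N ha x0 y0.
rewrite (funext E) in c.
have := cvg_unique (@norm_hausdorff _ R[i]^o) (@dunkl_term_cvg a lam x y ha) c.
exact.
Qed.

End dunkl_product_formula.

(** * The rescaled Opdam kernel compared with the Dunkl kernel *)

Section rescaled_kernel.
Context {R : realType}.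
Implicit Types (a x y z eps u e m p q : R).

Lemma cosh_norm u : cosh `|u| = cosh u.
Proof. by case: (ger0P u) => // _; rewrite /cosh opprK addrC. Qed.

Lemma sinhc_norm u : sinhc `|u| = sinhc u.
Proof. by case: (ger0P u) => // _; rewrite sinhcN. Qed.

Lemma cosh_gt0 u : 0 < cosh u.
Proof. by rewrite /cosh divr_gt0// addr_gt0// expR_gt0. Qed.

(** The functions [sinhc4], [sinhc3] and [sinhc2] divide the three products of hyperbolic sines in
    the Opdam kernel by the products of their arguments; the 2 refers to the doubled arguments 2x,
    2y, 2z. *)
Definition sinhc4 x y eps z : R := sinhc (eps * (x + y + z)) * sinhc (eps * (- x + y + z))
  * sinhc (eps * (x - y + z)) * sinhc (eps * (x + y - z)).
Definition sinhc3 x y eps z : R := sinhc (eps * (x + y + z)) * sinhc (eps * (- x + y + z))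
  * sinhc (eps * (x - y + z)).
Definition sinhc2 x y eps z : R :=
  sinhc (2 * (eps * x)) * sinhc (2 * (eps * y)) * sinhc (2 * (eps * z)).

Lemma sinhc4_gt0 x y eps z : 0 < sinhc4 x y eps z. Proof. by rewrite !mulr_gt0 ?sinhc_gt0. Qed.
Lemma sinhc3_gt0 x y eps z : 0 < sinhc3 x y eps z. Proof. by rewrite !mulr_gt0 ?sinhc_gt0. Qed.
Lemma sinhc2_gt0 x y eps z : 0 < sinhc2 x y eps z. Proof. by rewrite !mulr_gt0 ?sinhc_gt0. Qed.

(* The quotient of the rescaled Opdam weight by the Dunkl weight. *)
Definition weight_ratio a x y eps z : R :=
  expR (eps * (x + y - z)) * sinhc4 x y eps z `^ (a - 2^-1) * sinhc2 x y eps z `^ (- (2 * a))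
  * (sinhc3 x y eps z / sinhc2 x y eps z) * (sinhc (eps * z) * cosh (eps * z)) `^ (2 * a + 1).

Lemma kernel_support_scale x y z eps : 0 < eps ->
  kernel_support (eps * x) (eps * y) (eps * z) = kernel_support x y z.
Proof.
move=> e0; rewrite /kernel_support !mulf_eq0 (gt_eqF e0) /= !normrM (gtr0_norm e0).
by rewrite -mulrBr normrM (gtr0_norm e0) ltr_pM2l// -mulrDr ltr_pM2l.
Qed.

(** The last factor [eps] on the left is the Jacobian of z -> eps z. *)
Lemma opdam_kernel_scale a x y z eps : 0 < eps ->
  opdam_kernel a (eps * x) (eps * y) (eps * z) * jacobi_weight a `|eps * z| * eps =
  dweight a x y z * weight_ratio a x y eps z.
Proof.
move=> e0; rewrite /opdam_kernel /dweight /dunkl_kernel kernel_support_scale//.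
case: ifP => h; last by rewrite !mul0r.
have /and5P[x0 y0 z0 h1 h2] := h.
have hz : lo x y < `|z| < hi x y by rewrite /lo /hi h1 h2.
have s0 : 0 < (x + y + z) * (- x + y + z) * (x - y + z) * (x + y - z).
  by rewrite heron// mulr_gt0 ?one_minus_cosz2_gt0// exprn_gt0// mulr_gt0// normr_gt0 mulf_neq0.
have w0 : 0 < `|x * y * z| by rewrite normr_gt0 !mulf_neq0.
have z1 : 0 < `|z| by rewrite normr_gt0.
have c4 := sinhc4_gt0 x y eps z; have c2 := sinhc2_gt0 x y eps z.
have q0 : 0 < sinhc (eps * z) * cosh (eps * z) by rewrite mulr_gt0 ?sinhc_gt0 ?cosh_gt0.
have -> : eps * x + eps * y - eps * z = eps * (x + y - z) by ring.
have -> : eps * x + eps * y + eps * z = eps * (x + y + z) by ring.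
have -> : - (eps * x) + eps * y + eps * z = eps * (- x + y + z) by ring.
have -> : eps * x - eps * y + eps * z = eps * (x - y + z) by ring.
have -> : sinh (eps * (x + y + z)) * sinh (eps * (- x + y + z)) * sinh (eps * (x - y + z))
    * sinh (eps * (x + y - z)) =
    eps ^+ 4 * ((x + y + z) * (- x + y + z) * (x - y + z) * (x + y - z)) * sinhc4 x y eps z.
  by rewrite !sinhcE /sinhc4; ring.
have -> : sinh (eps * (x + y + z)) * sinh (eps * (- x + y + z)) * sinh (eps * (x - y + z)) =
    eps ^+ 3 * ((x + y + z) * (- x + y + z) * (x - y + z)) * sinhc3 x y eps z.
  by rewrite !sinhcE /sinhc3; ring.
have -> : sinh (2 * (eps * x)) * sinh (2 * (eps * y)) * sinh (2 * (eps * z)) =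
    8 * eps ^+ 3 * (x * y * z) * sinhc2 x y eps z.
  by rewrite !sinhcE /sinhc2; ring.
have -> : `|8 * eps ^+ 3 * (x * y * z) * sinhc2 x y eps z| =
    8 * eps ^+ 3 * `|x * y * z| * sinhc2 x y eps z.
  rewrite normrM (gtr0_norm c2) normrM; congr (_ * _ * _).
  by rewrite gtr0_norm// mulr_gt0// exprn_gt0.
have -> : jacobi_weight a `|eps * z| =
    eps `^ (2 * a + 1) * `|z| `^ (2 * a + 1) * (sinhc (eps * z) * cosh (eps * z)) `^ (2 * a + 1).
  rewrite /jacobi_weight sinhcE sinhc_norm cosh_norm normrM (gtr0_norm e0) -(mulrA (eps * `|z|)).
  rewrite (powRM _ _ (ltW q0)); last by rewrite mulr_ge0 ?ltW.
  by rewrite (powRM _ (ltW e0) (ltW z1)).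
have e4 : 0 < eps ^+ 4 by rewrite exprn_gt0.
have e3 : 0 < 8 * eps ^+ 3 by rewrite mulr_gt0// exprn_gt0.
move: ((x + y + z) * (- x + y + z) * (x - y + z) * (x + y - z)) s0 => s s0.
rewrite (powRM _ _ (ltW c4)); last by rewrite ltW// mulr_gt0.
rewrite (powRM _ (ltW e4) (ltW s0)).
rewrite (powRM _ _ (ltW c2)); last by rewrite ltW// mulr_gt0.
rewrite (powRM _ (ltW e3) (ltW w0)) /weight_ratio powRN.
(* Bracket, denominator, weight and Jacobian contribute the exponents 4 a - 2, - 6 a, 2 a + 1 and 1
   of [eps], with sum 0. Those of 2 are 4 a + 2, - 6 a and - 3, which sum to the exponent in
   [dunkl_kernel]. *)
have K : 2 `^ (4 * a + 2) * (eps ^+ 4) `^ (a - 2^-1) / (8 * eps ^+ 3) `^ (2 * a) * eps `^ (2 * a + 1) * eps / 8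
    = 2 `^ (- 2 * a - 1).
  have e_8 : (8 : R) = expR (ln 2 *+ 3).
    by rewrite -lnXn// lnK ?posrE ?exprn_gt0// -natrX.
  rewrite !powRE ?exprn_gt0// lnM ?posrE ?exprn_gt0// !lnXn// e_8 expRK.
  rewrite -[X in _ * X / _](@lnK _ eps) ?posrE//.
  by rewrite -!expRN -!expRD; congr expR; rewrite -!(mulr_natl (ln _)); by field.
rewrite -K.
move: ((x + y + z) * (- x + y + z) * (x - y + z)) => t3.
have P0 : (8 * eps ^+ 3) `^ (2 * a) != 0 by rewrite gt_eqF// powR_gt0.
have P1 : `|x * y * z| `^ (2 * a) != 0 by rewrite gt_eqF// powR_gt0.
have P2 : sinhc2 x y eps z `^ (2 * a) != 0 by rewrite gt_eqF// powR_gt0.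
have P3 : sinhc2 x y eps z != 0 by rewrite gt_eqF.
have P4 : eps != 0 by rewrite gt_eqF.
move: ((8 * eps ^+ 3) `^ (2 * a)) P0 => p0 P0.
move: (`|x * y * z| `^ (2 * a)) P1 => p1 P1.
move: (sinhc2 x y eps z `^ (2 * a)) P2 => p2 P2.
move: (sinhc2 x y eps z) P3 => p3 P3.
move: (sinhc3 x y eps z) (sinhc4 x y eps z `^ (a - 2^-1)) (s `^ (a - 2^-1))
  ((eps ^+ 4) `^ (a - 2^-1)) (eps `^ (2 * a + 1)) (`|z| `^ (2 * a + 1))
  ((sinhc (eps * z) * cosh (eps * z)) `^ (2 * a + 1)) (expR _) (2 `^ (4 * a + 2)) (M_const a).
move=> r1 r2 r3 r4 r5 r6 r7 r8 r9 r10.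
by field; rewrite ?P0 ?P1 ?P2 ?P3 ?P4 ?x0 ?y0 ?z0.
Qed.

Lemma powR_cvg1 (T : Type) (F : set_system T) {FF : Filter F} (f : T -> R) e :
  f @ F --> (1 : R) -> f t `^ e @[t --> F] --> (1 : R).
Proof.
move=> f1; have c : {for (1 : R), continuous (@powR R ^~ e)}.
  apply: differentiable_continuous; apply/derivable1_diffP; apply: derivable_powR.
  by rewrite in_itv/= ltr01.
have := continuous_cvg FF c f1.
by rewrite powR1.
Qed.

Lemma weight_ratio_cvg (a x y z : R) (T : Type) (F : set_system T) {FF : Filter F} (f : T -> R) :
  f @ F --> (0 : R) -> weight_ratio a x y (f t) z @[t --> F] --> (1 : R).
Proof.
move=> f0.
have fk k : f t * k @[t --> F] --> (0 : R).
  by rewrite -[X in _ --> X](mul0r k); apply: cvgM => //; exact: cvg_cst.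
have fk2 k : 2 * (f t * k) @[t --> F] --> (0 : R).
  by rewrite -[X in _ --> X](mulr0 2); apply: cvgM => //; exact: cvg_cst.
have one1 (g h : T -> R) : g @ F --> (1 : R) -> h @ F --> (1 : R) -> g t * h t @[t --> F] --> (1 : R).
  by move=> g1 h1; rewrite -[X in _ --> X](mulr1 1); exact: cvgM.
have e1 k : expR (f t * k) @[t --> F] --> (1 : R).
  by have := continuous_cvg FF (@continuous_expR R 0) (fk k); rewrite expR0.
have c2 : sinhc2 x y (f t) z @[t --> F] --> (1 : R).
  rewrite /sinhc2; apply: (one1); first by apply: (one1); apply: cvg_sinhc; apply: fk2.
  by apply: cvg_sinhc; apply: fk2.
have c3 : sinhc3 x y (f t) z @[t --> F] --> (1 : R).
  by do ![apply: (one1)]; apply: cvg_sinhc; exact: fk.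
have c4 : sinhc4 x y (f t) z @[t --> F] --> (1 : R).
  by do ![apply: (one1)]; apply: cvg_sinhc; exact: fk.
have ch : cosh (f t * z) @[t --> F] --> (1 : R).
  have -> : (1 : R) = (1 + 1) / 2 by field.
  apply: cvgM; last exact: cvg_cst.
  apply: cvgD; first exact: e1.
  by under eq_fun do rewrite -mulrN; exact: e1.
apply: (one1).
  apply: (one1).
    apply: (one1); last by apply: powR_cvg1.
    by apply: (one1); [exact: e1|apply: powR_cvg1].
  apply: (one1) => //; rewrite -[X in _ --> X]invr1; apply: cvgV => //.
apply: powR_cvg1; apply: (one1) => //.
by apply: cvg_sinhc; exact: fk.
Qed.

(** Bounds on both sides, because the exponents in [weight_ratio] can have either sign. *)
Definition within_factor m p := m^-1 <= p <= m.

Lemma within_factorM m k p q : 0 < m -> 0 < k -> within_factor m p -> within_factor k q ->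
  within_factor (m * k) (p * q).
Proof.
move=> m0 k0 /andP[p1 p2] /andP[q1 q2].
have pp : 0 < p by apply: lt_le_trans p1; rewrite invr_gt0.
have qp : 0 < q by apply: lt_le_trans q1; rewrite invr_gt0.
by rewrite /within_factor invfM !ler_pM ?invr_ge0 ?(ltW m0) ?(ltW k0) ?(ltW pp) ?(ltW qp).
Qed.

Lemma within_factor_powR m p e : 0 < m -> within_factor m p -> p `^ e <= m `^ `|e|.
Proof.
move=> m0 /andP[p1 p2].
have pp : 0 < p by apply: lt_le_trans p1; rewrite invr_gt0.
rewrite !powRE// ler_expR; apply: le_trans (ler_norm _) _; rewrite normrM ler_wpM2l//.
rewrite ler_norml -lnV ?posrE// !ler_ln ?posrE ?invr_gt0// p1 p2//.
Qed.

Lemma within_factor_sinhc u : `|u| <= 2^-1 -> within_factor 2 (sinhc u).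
Proof.
move=> u2; rewrite /within_factor sinhc_le2// andbT.
have /andP[h _] := sinhc_bounds u; apply: le_trans h.
rewrite expRN lef_pV2 ?posrE ?expR_gt0//.
by apply: le_trans expR_half; rewrite ler_expR.
Qed.

Lemma within_factor_cosh u : `|u| <= 2^-1 -> within_factor 2 (cosh u).
Proof.
rewrite -cosh_norm; set v := `|u| => u2; have v0 : 0 <= v by exact: normr_ge0.
have h1 : expR v <= 2 by apply: le_trans expR_half; rewrite ler_expR.
have h2 : 1 <= expR v by rewrite -expR0 ler_expR.
have h3 : expR (- v) <= 1 by rewrite -expR0 ler_expR; lra.
have h4 := expR_gt0 (- v).
by rewrite /within_factor /cosh; apply/andP; split; lra.
Qed.

Lemma weight_ratio_bounded a x y : exists2 B, 0 <= B & forall eps z, 0 <= eps -> eps * hi x y <= 4^-1 ->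
  `|z| <= hi x y -> `|weight_ratio a x y eps z| <= B.
Proof.
(* In order: the exponential, four factors of [sinhc4], three of [sinhc2], the quotient of [sinhc3]
   by [sinhc2], and sinhc times cosh, each elementary factor lying within 2 of 1
   multiplicatively. *)
exists (2 * 16 `^ `|a - 2^-1| * 8 `^ `|- (2 * a)| * (8 * 8) * 4 `^ `|2 * a + 1|).
  by rewrite !mulr_ge0 ?powR_ge0.
move=> eps z e0 eh zh.
have xy : `|x| + `|y| = hi x y by [].
(* No argument exceeds 2 * [hi x y] before scaling, so the threshold 1/4 becomes the 1/2 of the
   [sinhc] bounds. *)
have sm u : `|u| <= 2 * hi x y -> `|eps * u| <= 2^-1.
  move=> uh; rewrite normrM (ger0_norm e0); have := ler_wpM2l e0 uh; lra.
have x_hi : `|x| <= hi x y by rewrite /hi lerDl.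
have y_hi : `|y| <= hi x y by rewrite /hi lerDr.
have n3 u v w : `|u| <= `|x| -> `|v| <= `|y| -> `|w| <= hi x y -> `|u + v + w| <= 2 * hi x y.
  by move=> h1 h2 h3; have := ler_normD (u + v) w; have := ler_normD u v; lra.
have b1 : `|eps * (x + y + z)| <= 2^-1 by apply: sm; exact: n3.
have b2 : `|eps * (- x + y + z)| <= 2^-1 by apply: sm; apply: n3 => //; rewrite normrN.
have b3 : `|eps * (x - y + z)| <= 2^-1 by apply: sm; apply: n3 => //; rewrite normrN.
have b4 : `|eps * (x + y - z)| <= 2^-1 by apply: sm; apply: n3 => //; rewrite normrN.
have d2 u : `|u| <= hi x y -> `|2 * (eps * u)| <= 2^-1.
  by move=> uh; rewrite mulrCA; apply: sm; rewrite normrM (@ger0_norm _ 2)// ler_wpM2l.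
have ez : `|eps * z| <= 2^-1 by apply: sm; have := normr_ge0 z; lra.
have w4 : within_factor 16 (sinhc4 x y eps z).
  have -> : (16 : R) = 2 * 2 * 2 * 2 by ring.
  by rewrite /sinhc4 /sinhc3; repeat (apply: within_factorM; [lra|lra| |exact: within_factor_sinhc]); exact: within_factor_sinhc.
have w3 : within_factor 8 (sinhc3 x y eps z).
  have -> : (8 : R) = 2 * 2 * 2 by ring.
  by rewrite /sinhc4 /sinhc3; repeat (apply: within_factorM; [lra|lra| |exact: within_factor_sinhc]); exact: within_factor_sinhc.
have w2 : within_factor 8 (sinhc2 x y eps z).
  have -> : (8 : R) = 2 * 2 * 2 by ring.
  by rewrite /sinhc2; repeat (apply: within_factorM; [lra|lra| |apply: within_factor_sinhc; exact: d2]); apply: within_factor_sinhc; exact: d2.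
have wq : within_factor 4 (sinhc (eps * z) * cosh (eps * z)).
  have -> : (4 : R) = 2 * 2 by ring.
  by apply: within_factorM => //; [exact: within_factor_sinhc|exact: within_factor_cosh].
have c3 := sinhc3_gt0 x y eps z; have c2 := sinhc2_gt0 x y eps z.
have /andP[_ u3] := w3; have /andP[u2 _] := w2.
have r0 : 0 <= sinhc3 x y eps z / sinhc2 x y eps z by rewrite divr_ge0 ?ltW.
have l0 : 0 <= expR (eps * (x + y - z)) * sinhc4 x y eps z `^ (a - 2^-1)
    * sinhc2 x y eps z `^ (- (2 * a)) by rewrite !mulr_ge0 ?powR_ge0 ?expR_ge0.
rewrite /weight_ratio ger0_norm; last by rewrite mulr_ge0 ?powR_ge0// mulr_ge0.
have hE : expR (eps * (x + y - z)) <= 2.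
  by apply: le_trans expR_half; rewrite ler_expR; apply: le_trans (ler_norm _) b4.
have hr : sinhc3 x y eps z / sinhc2 x y eps z <= 8 * 8.
  rewrite ler_pM ?invr_ge0 ?(ltW c2) ?(ltW c3)//.
  by rewrite -[leRHS]invrK lef_pV2 ?posrE ?invr_gt0.
apply: ler_pM; [by rewrite mulr_ge0|exact: powR_ge0| |by apply: within_factor_powR].
apply: ler_pM => //; apply: ler_pM; rewrite ?mulr_ge0 ?powR_ge0 ?expR_ge0//; last by apply: within_factor_powR.
by apply: ler_pM; rewrite ?powR_ge0 ?expR_ge0//; apply: within_factor_powR.
Qed.

Lemma measurable_sinhc : measurable_fun setT (@sinhc R).
Proof.
rewrite /sinhc; apply: measurable_fun_ifT => //; first exact: measurable_fun_eqr.
(* Writing 1 / u as u (u^2)^(-1) reduces its measurability to that of a real power. *)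
rewrite (_ : (fun u => sinh u / u) = fun u => sinh u * (u * (u ^+ 2) `^ (-1))).
  apply: measurable_funM.
    apply: measurable_funM => //; apply: measurable_funB; first exact: measurable_expR.
    apply: (measurableT_comp (@measurable_expR R)).
    rewrite (_ : -%R = fun u => -1 * u); first exact: measurable_funM.
    by apply/funext => u; rewrite mulN1r.
  apply: measurable_funM => //; apply: (measurableT_comp (measurable_powR _)).
  exact: measurable_funX.
apply/funext => u; rewrite powR_inv1 ?sqr_ge0//; congr (_ * _).
have [->|u0] := eqVneq u 0; first by rewrite invr0 mul0r.
by field.
Qed.

Lemma measurable_weight_ratio a x y eps : measurable_fun setT (weight_ratio a x y eps).
Proof.
have ms (k c : R) : measurable_fun setT (fun z => sinhc (eps * (c + k * z))).
  apply: (measurableT_comp measurable_sinhc); apply: measurable_funM => //.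
  by apply: measurable_funD => //; exact: measurable_funM.
have m1 : measurable_fun setT (fun z => sinhc (eps * (x + y + z))).
  by have := ms 1 (x + y); under eq_fun do rewrite mul1r.
have m2 : measurable_fun setT (fun z => sinhc (eps * (- x + y + z))).
  by have := ms 1 (- x + y); under eq_fun do rewrite mul1r.
have m3 : measurable_fun setT (fun z => sinhc (eps * (x - y + z))).
  by have := ms 1 (x - y); under eq_fun do rewrite mul1r.
have m4 : measurable_fun setT (fun z => sinhc (eps * (x + y - z))).
  by have := ms (-1) (x + y); under eq_fun do rewrite mulN1r.
have m5 : measurable_fun setT (fun z => sinhc (eps * z)).
  by have := ms 1 0; under eq_fun do rewrite mul1r add0r.
have m6 : measurable_fun setT (fun z => sinhc (2 * (eps * z))).
  by have := ms 2 0; under eq_fun do rewrite add0r mulrCA.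
have me (k : R) : measurable_fun setT (fun z => expR (eps * (k - z))).
  apply: (measurableT_comp (@measurable_expR R)); apply: measurable_funM => //.
  exact: measurable_funB.
have mc : measurable_fun setT (fun z => cosh (eps * z)).
  apply: measurable_funM => //; apply: measurable_funD;
    apply: (measurableT_comp (@measurable_expR R)).
    exact: measurable_funM.
  by under eq_fun do rewrite -mulNr; exact: measurable_funM.
have m_4 : measurable_fun setT (sinhc4 x y eps).
  by apply: measurable_funM => //; apply: measurable_funM => //; exact: measurable_funM.
have m_3 : measurable_fun setT (sinhc3 x y eps).
  by apply: measurable_funM => //; exact: measurable_funM.
have m_2 : measurable_fun setT (sinhc2 x y eps).
  by apply: measurable_funM.
have mp (g : R -> R) e : measurable_fun setT g -> measurable_fun setT (fun z => g z `^ e).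
  by move=> mg; exact: (measurableT_comp (measurable_powR e)).
have -> : weight_ratio a x y eps = (fun z => expR (eps * (x + y - z)) * sinhc4 x y eps z `^ (a - 2^-1)
   * sinhc2 x y eps z `^ (- (2 * a)) * (sinhc3 x y eps z * sinhc2 x y eps z `^ (-1))
   * (sinhc (eps * z) * cosh (eps * z)) `^ (2 * a + 1)).
  by apply/funext => z; rewrite powR_inv1// ltW// sinhc2_gt0.
apply: measurable_funM; last by apply: mp; exact: measurable_funM.
apply: measurable_funM; last by apply: measurable_funM => //; exact: mp.
by apply: measurable_funM; [apply: measurable_funM; [exact: me|exact: mp]|exact: mp].
Qed.

End rescaled_kernel.

(** * Passage to the limit in the Opdam integral *)

Section rescaled_product_formula.
Context {R : realType}.
Local Notation mu := (@lebesgue_measure R).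
Implicit Types (a x y z eps : R) (lam : R[i]).

(** As f z = F (z / eps) / eps, measurability and integrability of [f] come from [F]; no direct
    study of the Opdam integrand is required. *)
Lemma cintegral_scale (f F : R -> R[i]) eps : 0 < eps ->
  (forall z, f (eps * z) * eps%:C = F z) -> cmeasurable F -> cintegrable F ->
  cintegrable f /\ cintegral f = cintegral F.
Proof.
move=> e0 fF [mR mI] [iR iI]; have en0 : eps != 0 by rewrite gt_eqF.
have key (P : R[i] -> R) : (forall w (r : R), P (w * r%:C) = P w * r) ->
    measurable_fun setT (fun z => P (F z)) -> mu.-integrable setT (EFin \o (fun z => P (F z))) ->
    mu.-integrable setT (EFin \o (fun z => P (f z))) /\
    \int[mu]_z P (f z) = \int[mu]_z P (F z).
  move=> PM mP iP.
  have fE z : P (f z) = P (F (eps^-1 * z)) * eps^-1.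
    by rewrite -fF PM mulfK// mulVKf.
  have mf : measurable_fun setT (fun z => P (f z)).
    rewrite (funext fE); apply: measurable_funM => //.
    by apply: (measurableT_comp mP); exact: measurable_funM.
  have gE z : P (f (eps * z + 0)) = eps^-1 * P (F z).
    by rewrite addr0 -fF PM [_ * eps]mulrC mulKf.
  have ig : mu.-integrable setT (EFin \o (fun z => P (f (eps * z + 0)))).
    by rewrite (funext gE); apply: (integrableZl _ _ iP).
  split; first exact: (integrable_affine e0 mf ig).
  rewrite (Rintegral_affine e0 mf ig) -RintegralZl//.
  by apply: eq_Rintegral => z _; rewrite gE mulVKf.
have [jR eR] := key (fun w => Re w) (@ReMr R) mR iR; have [jI eI] := key (fun w => Im w) (@ImMr R) mI iI.
by split; [split|rewrite /cintegral eR eI].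
Qed.

Definition opdam_scaled_integrand a lam x y eps z : R[i] :=
  opdam_scaled a lam eps z * (dweight a x y z * weight_ratio a x y eps z)%:C.

(** On the support |eps z| <= eps * [hi x y] <= 1/4, so [opdam_GE] applies; elsewhere both kernels
    are 0. *)
Lemma opdam_integrand_scale a lam x y eps z : 0 < eps -> eps * hi x y <= 4^-1 ->
  x != 0 -> y != 0 ->
  opdam_integrand a (lam / eps%:C) (eps * x) (eps * y) (eps * z) * eps%:C =
  opdam_scaled_integrand a lam x y eps z.
Proof.
move=> e0 eh x0 y0; rewrite /opdam_integrand /opdam_scaled_integrand -opdam_kernel_scale//.
rewrite -mulrA -(rmorphM (real_complex R)).
have [h|h] := boolP (kernel_support x y z); last first.
  by rewrite /opdam_kernel kernel_support_scale// (negbTE h) !mul0r !(rmorph0 (real_complex R)) !mulr0.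
congr (_ * _); apply: opdam_GE => //; rewrite normrM (gtr0_norm e0).
by have /and5P[_ _ _ _ /ltW h2] := h; apply: le_trans eh; rewrite ler_pM2l.
Qed.

(** A pointwise limit of partial sums multiplied by the weight. The weight is kept in the
    approximants because the estimates give convergence of the series only on the support; elsewhere
    the products are 0. *)
Lemma cmeasurable_opdam_scaled_integrand a lam x y eps : - 2^-1 < a -> x != 0 -> y != 0 ->
  0 <= eps -> eps * hi x y <= 4^-1 -> cmeasurable (opdam_scaled_integrand a lam x y eps).
Proof.
move=> ha x0 y0 e0 eh.
have ha1 : - 2^-1 < a + 1 by lra.
have hi0 : 0 < hi x y by apply: le_lt_trans (lo_lt_hi x0 y0); exact: lo_ge0.
pose s z := (z * sinhc (eps * z)) ^+ 2.
pose k1 : R[i] := ((eps * (2 * a + 1))%:C + 'i * lam) / (4 * (a + 1))%:C.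
pose w z : R[i] := (dweight a x y z * weight_ratio a x y eps z)%:C.
pose S b N z : R[i] := \sum_(0 <= n < N) jacobi_coef b lam eps n * ((s z) ^+ n)%:C.
have ms : measurable_fun setT s.
  apply: measurable_funX; apply: measurable_funM => //.
  by apply: (measurableT_comp measurable_sinhc); exact: measurable_funM.
have mt : measurable_fun setT (fun z => 2 * z * sinhc (2 * eps * z)).
  apply: measurable_funM; first exact: measurable_funM.
  by apply: (measurableT_comp measurable_sinhc); exact: measurable_funM.
have mS b N : cmeasurable (S b N).
  apply: cmeasurable_sum => n; apply: cmeasurableM; first exact: cmeasurable_cst.
  by apply: cmeasurable_real; exact: measurable_funX.
apply: (@cmeasurable_cvg R (fun N z => (S a N z + k1 * (2 * z * sinhc (2 * eps * z))%:C * S (a + 1) N z) * w z)).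
  move=> N; apply: cmeasurableM; last first.
    apply: cmeasurable_real; apply: measurable_funM; [exact: measurable_dweight|exact: measurable_weight_ratio].
  apply: cmeasurableD; first exact: mS.
  apply: cmeasurableM; last exact: mS.
  by apply: cmeasurableM; [exact: cmeasurable_cst|exact: cmeasurable_real].
move=> z; have [h|h] := boolP (lo x y < `|z| < hi x y); last first.
  have w0 : w z = 0 by rewrite /w dweightE// (negbTE h) mul0r.
  rewrite /opdam_scaled_integrand -/(w z) w0 mulr0.
  by under eq_fun do rewrite mulr0; exact: ccvg_cst.
have zh : `|z| <= hi x y by case/andP: h => _ /ltW.
have cs b : - 2^-1 < b -> S b N z @[N --> \oo] --> (cpseries (jacobi_coef b lam eps) (s z) : R[i]^o).
  move=> hb; apply: csum_cvg.
  apply: (csummable_le (M := fun n => jacobi_coef_bound b (normc (lam ^+ 2 / 4)) (4 * hi x y)^-1 n * ((2 * hi x y) ^+ 2) ^+ n)).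
    move=> n; apply: normc_cpseries_term_le; last exact: opdam_scaled_arg_le.
    by apply: normc_jacobi_coef_le => //; exact: scale_le.
  by apply: jacobi_coef_bound_summable; rewrite ?normc_ge0 ?sqr_ge0// scale_bound.
apply: ccvgM; last exact: ccvg_cst.
apply: ccvgD; first exact: cs.
by apply: ccvgM; [exact: ccvg_cst|exact: cs].
Qed.

Lemma opdam_scaled_integrand_le a lam x y : - 2^-1 < a -> x != 0 -> y != 0 ->
  exists2 B, 0 <= B & forall eps z, 0 <= eps -> eps * hi x y <= 4^-1 ->
    normc (opdam_scaled_integrand a lam x y eps z) <= B * dmajorant a x y z.
Proof.
move=> ha x0 y0.
have hi0 : 0 < hi x y by apply: le_lt_trans (lo_lt_hi x0 y0); exact: lo_ge0.
have [B B0 HB] := opdam_scaled_bounded lam ha hi0.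
have [D D0 HD] := dweight_le ha x0 y0.
have [E E0 HE] := weight_ratio_bounded a x y.
exists (B * (D * E)); first by rewrite !mulr_ge0.
move=> eps z e0 eh; rewrite /opdam_scaled_integrand ComplexField.Normc.normcM normc_real normrM.
have [h|h] := boolP (lo x y < `|z| < hi x y); last first.
  by rewrite dweightE// (negbTE h) normr0 mul0r mulr0 !mulr_ge0 ?dmajorant_ge0.
have zh : `|z| <= hi x y by case/andP: h => _ /ltW.
rewrite -mulrA; apply: ler_pM; rewrite ?normc_ge0 ?mulr_ge0 ?HB//.
by rewrite [leRHS]mulrAC; apply: ler_pM; rewrite ?HD ?HE.
Qed.

Lemma opdam_scaled_integrand_cvg a lam x y z : - 2^-1 < a ->
  opdam_scaled_integrand a lam x y eps z @[eps --> (0 : R)^'+] --> (dunkl_integrand a lam x y z : R[i]^o).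
Proof.
move=> ha; rewrite /dunkl_integrand dunkl_EE//; apply: ccvgM; first exact: opdam_scaled_cvg.
apply: cvg_real_complex; rewrite -/(dweight a x y z) -[X in _ --> X]mulr1.
apply: cvgM; first exact: cvg_cst.
by apply: weight_ratio_cvg; apply: cvg_at_right_filter; exact: cvg_id.
Qed.

Lemma near0_scaled_support x y : x != 0 -> y != 0 ->
  \forall eps \near (0 : R)^'+, 0 < eps /\ eps * hi x y <= 4^-1.
Proof.
move=> x0 y0; have hi0 : 0 < hi x y by apply: le_lt_trans (lo_lt_hi x0 y0); exact: lo_ge0.
have h : (0 : R) < 4^-1 / hi x y by rewrite divr_gt0.
near=> eps; split; first by near: eps; exact: nbhs_right_gt.
by rewrite -ler_pdivlMr//; near: eps; exact: nbhs_right_le.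
Unshelve. all: by end_near. Qed.

Lemma opdam_integral_scale a lam x y eps : - 2^-1 < a -> x != 0 -> y != 0 ->
  0 < eps -> eps * hi x y <= 4^-1 ->
  cintegrable (opdam_integrand a (lam / eps%:C) (eps * x) (eps * y)) /\
  cintegral (opdam_integrand a (lam / eps%:C) (eps * x) (eps * y)) =
  cintegral (opdam_scaled_integrand a lam x y eps).
Proof.
move=> ha x0 y0 e0 eh.
have m := cmeasurable_opdam_scaled_integrand lam ha x0 y0 (ltW e0) eh.
have [B B0 HB] := opdam_scaled_integrand_le lam ha x0 y0.
apply: (cintegral_scale e0) => //.
  by move=> z; exact: opdam_integrand_scale.
apply: (cintegrable_le (g := fun z => B * dmajorant a x y z)) => //.
  by apply: (integrableZl _ _ (integrable_dmajorant ha x0 y0)).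
by move=> z; apply: HB => //; exact: ltW.
Qed.

(** Dominated convergence concerns sequences, so the limit from the right is tested along positive
    sequences tending to 0. *)
Lemma opdam_integral_cvg a lam x y : - 2^-1 < a -> x != 0 -> y != 0 ->
  cintegral (opdam_integrand a (lam / eps%:C) (eps * x) (eps * y)) @[eps --> (0 : R)^'+]
    --> (cintegral (dunkl_integrand a lam x y) : R[i]^o).
Proof.
move=> ha x0 y0.
have hi0 : 0 < hi x y by apply: le_lt_trans (lo_lt_hi x0 y0); exact: lo_ge0.
have e1 : (0 : R) < 4^-1 / hi x y by rewrite divr_gt0.
have [B B0 HB] := opdam_scaled_integrand_le lam ha x0 y0.
pose J eps := cintegral (opdam_scaled_integrand a lam x y eps).
have E : \forall eps \near (0 : R)^'+,
    cintegral (opdam_integrand a (lam / eps%:C) (eps * x) (eps * y)) = J eps.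
  by apply: filterS (near0_scaled_support x0 y0) => eps [e0 eh]; rewrite (opdam_integral_scale _ _ _ _ e0 eh).2.
apply: (cvg_trans (near_eq_cvg _)); first by apply: filterS E => t ->; reflexivity.
have seqJ (u : nat -> R) : (forall n, u n > 0) /\ (u n @[n --> \oo] --> (0 : R)) ->
    J (u n) @[n --> \oo] --> (cintegral (dunkl_integrand a lam x y) : R[i]^o).
  move=> [u0 u_0].
  (* Truncation makes the uniform bounds valid for every [n] and alters only finitely many terms. *)
  pose v n := Num.min (u n) (4^-1 / hi x y).
  have v0 n : 0 < v n by rewrite lt_min u0.
  have vh n : v n * hi x y <= 4^-1 by rewrite -ler_pdivlMr// ge_min lexx orbT.
  have uv : \forall n \near \oo, J (u n) = J (v n).
    have /cvgrPdist_le/(_ _ e1) := u_0; apply: filterS => n.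
    rewrite sub0r normrN (gtr0_norm (u0 n)) => h; congr J.
    by rewrite /v min_l.
  have v_0 : v n @[n --> \oo] --> (0 : R).
    apply: (@squeeze_cvgr _ _ _ _ (fun=> 0) u) => //; last exact: cvg_cst.
    by apply: nearW => n; rewrite (ltW (v0 n)) ge_min lexx.
  apply: (cvg_trans (near_eq_cvg _)); first by apply: filterS uv => n ->; reflexivity.
  have ig : mu.-integrable setT (EFin \o (fun z => B * dmajorant a x y z)).
    by apply: (integrableZl _ _ (integrable_dmajorant ha x0 y0)).
  have [||||_ c] := @cdominated R (fun n => opdam_scaled_integrand a lam x y (v n))
      (dunkl_integrand a lam x y) (fun z => B * dmajorant a x y z).
  - by move=> n; apply: cmeasurable_opdam_scaled_integrand => //; exact: ltW.
  - move=> z; have [cR cI] := cvg_ReIm (@opdam_scaled_integrand_cvg a lam x y z ha).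
    apply: cvg_complex.
      by move/cvg_at_rightP : cR; apply; split.
    by move/cvg_at_rightP : cI; apply; split.
  - exact: ig.
  - by move=> n z; apply: HB => //; exact: ltW.
  exact: c.
apply: cvg_complex.
  by apply/cvg_at_rightP => u hu; have [] := cvg_ReIm (seqJ u hu).
by apply/cvg_at_rightP => u hu; have [] := cvg_ReIm (seqJ u hu).
Qed.

End rescaled_product_formula.


(** * Convergence of both sides and the limiting formula *)

Theorem corollary3p7 (R : realType) (alpha : R) (lambda : R[i]) (x y : R)
    (halpha : - 2^-1 < alpha) (hx : x != 0) (hy : y != 0) :
  [/\ (* the left-hand side converges *)
      opdam_G alpha (lambda / eps%:C) (eps * x)
        * opdam_G alpha (lambda / eps%:C) (eps * y)
        @[eps --> (0 : R)^'+]
        --> (dunkl_E alpha lambda x * dunkl_E alpha lambda y : R[i]^o),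
      (* the right-hand side converges; the integrals exist *)
      \forall eps \near (0 : R)^'+,
        cintegrable (opdam_integrand alpha (lambda / eps%:C)
                       (eps * x) (eps * y)),
      cintegrable (dunkl_integrand alpha lambda x y),
      cintegral (opdam_integrand alpha (lambda / eps%:C) (eps * x) (eps * y))
        @[eps --> (0 : R)^'+]
        --> (cintegral (dunkl_integrand alpha lambda x y) : R[i]^o)
    & (* the limiting product formula *)
      dunkl_E alpha lambda x * dunkl_E alpha lambda y
        = cintegral (dunkl_integrand alpha lambda x y)].
Proof.
have [di df] := dunkl_product_formula lambda halpha hx hy.
have G z : opdam_G alpha (lambda / eps%:C) (eps * z) @[eps --> (0 : R)^'+]
    --> (dunkl_E alpha lambda z : R[i]^o).
  rewrite dunkl_EE//; have := @opdam_scaled_cvg R alpha lambda z halpha.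
  apply: cvg_trans; apply: near_eq_cvg.
  (* Below this value of [eps], |eps z| <= 1/4 as [opdam_GE] requires; the 1 in the denominator
     covers z = 0. *)
  have h : (0 : R) < 4^-1 / (`|z| + 1) by rewrite divr_gt0// ltr_wpDl.
  near=> eps.
  have e0 : 0 < eps by near: eps; exact: nbhs_right_gt.
  rewrite opdam_GE// normrM (gtr0_norm e0).
  have : eps <= 4^-1 / (`|z| + 1) by near: eps; exact: nbhs_right_le.
  rewrite ler_pdivlMr ?ltr_wpDl// mulrDr mulr1 => k.
  by apply: le_trans k; rewrite lerDl ltW.
split; [by apply: ccvgM; exact: G| |exact: di|exact: opdam_integral_cvg|exact: df].
by apply: filterS (near0_scaled_support hx hy) => eps [e0 eh]; case: (@opdam_integral_scale R alpha lambda x y eps).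
Unshelve. all: by end_near. Qed.
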